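(* Let $a,b,c,d,e,f,g$ be complex numbers and let $z=\frac{bcde}{aq}$, such that $\left|\frac{a^2q}{fgz}\right|<1$ and $\left|\frac{aq}{fg}\right|<1$. Then \begin{align*} &{}_{8}\psi_{8}\left[a; b,c,d,e,f,g; q, \tfrac{a^2q}{fgz}\right]\\ &=\left(1-\tfrac1z\right)\frac{(aq,q/a;q)_\infty}{\Omega(q;f,g)}\, \frac{\Omega(aq;\,bc,bd,be,cd,ce,de,fg,fz,gz)}{\Omega(aq;b,c,d,e)\;\Omega\!\left(\tfrac1z;\tfrac1b,\tfrac1c,\tfrac1d,\tfrac1e,\tfrac{fg}{a^2q}\right)}\; {}_{8}\psi_{8}\left[z; b,c,d,e,\tfrac{fz}{a},\tfrac{gz}{a}; q,\tfrac{aq}{fg}\right]\\ &\quad+\frac1z\,\frac{(aq,q/a;q)_\infty}{(aq/z^2,\,z^2q/a;q)_\infty}\, \frac{\Omega\!\left(\tfrac{aq}{z},zq;f,g\right)}{\Omega(q,aq;f,g)}\, \frac{(b,c,d,e;q)_\infty\,\Omega\!\left(\tfrac{aq}{z};b,c,d,e\right)}{\Omega\!\left(\tfrac1z;\tfrac1b,\tfrac1c,\tfrac1d,\tfrac1e\right)\Omega(aq;b,c,d,e)}\\ &\qquad\times{}_{8}\psi_{8}\left[\tfrac{z^2}{a};\tfrac{bz}{a},\tfrac{cz}{a},\tfrac{dz}{a},\tfrac{ez}{a},\tfrac{fz}{a},\tfrac{gz}{a};q,\tfrac{a^2q}{fgz}\right]. \end{align*}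
   Context: Fix a complex number $q$ with $0<|q|<1$. Set $(x;q)_\infty=\prod_{n\ge 0}(1-xq^n)$, $(x;q)_n=(x;q)_\infty/(xq^n;q)_\infty$ for every integer $n$ (positive, zero or negative), and $(x_1,\dots,x_m;q)_n=\prod_i (x_i;q)_n$ (also for $n=\infty$). Notation: $\Omega(x_1,\dots,x_n;a_1,\dots,a_m)=\prod_{i=1}^n\prod_{j=1}^m (x_i/a_j;q)_\infty$. Very-well-poised bilateral series: ${}_8\psi_8[a;a_3,\dots,a_8;q,Z]=\sum_{n=-\infty}^{\infty}\frac{(q\sqrt a,-q\sqrt a,a_3,\dots,a_8;q)_n}{(\sqrt a,-\sqrt a,aq/a_3,\dots,aq/a_8;q)_n}Z^n=\sum_{n=-\infty}^{\infty}\frac{1-aq^{2n}}{1-a}\prod_{i=3}^{8}\frac{(a_i;q)_n}{(aq/a_i;q)_n}\,Z^n$. Convention: all parameters are nonzero and such that no denominator appearing (in coefficients or in terms of series) vanishes. *)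

(* Defs.v *)
(* Complex numbers are those of Coquelicot, over the reals of Stdlib. *)
From Stdlib Require Import Reals ZArith List Lia Lra.
From Coquelicot Require Import Coquelicot.
Import ListNotations.
Open Scope C_scope.

(* x ^ n for an integer exponent; Coquelicot only has the natural powers. *)
Definition Cpowz (x : C) (n : Z) : C :=
  match n with
  | Z0 => 1
  | Zpos p => x ^ Pos.to_nat p
  | Zneg p => / x ^ Pos.to_nat p
  end.

Definition Cprod (l : list C) : C := fold_right Cmult 1 l.

(* (1 - x) (1 - x q) ... (1 - x q^(n-1)) *)
Fixpoint qprod (q x : C) (n : nat) : C :=
  match n with
  | O => 1
  | S m => qprod q x m * (1 - x * q ^ m)
  end.

(* (x;q)_oo as the limit of its partial products, which exists for every x as
   soon as |q| < 1: see [is_qinf]. *)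
Definition qinf (q x : C) : C :=
  iota (T := C_CompleteNormedModule)
    (fun l : C => filterlim (qprod q x) eventually (locally l)).

(* (x;q)_n for an integer n.  It equals (x;q)_oo / (x q^n;q)_oo whenever the
   denominator is nonzero ([qpoch_ratio]); the finite products also give the
   usual value at, say, x = q^(-k), where that quotient reads 0/0.
   For n < 0 it is / 0 = 0 at a pole x = q^m with 1 <= m <= -n, and then its
   inverse is / 0 = 0 too, which is the correct value of 1/(x;q)_n. *)
Definition qpoch (q x : C) (n : Z) : C :=
  match n with
  | Z0 => 1
  | Zpos p => qprod q x (Pos.to_nat p)
  | Zneg p => / qprod q (x / q ^ Pos.to_nat p) (Pos.to_nat p)
  end.

(* (x1,...,xm;q)_oo *)
Definition qinfs (q : C) (xs : list C) : C := Cprod (map (qinf q) xs).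

(* Omega(x1,...,xn; a1,...,am) *)
Definition Omega (q : C) (xs ys : list C) : C :=
  Cprod (map (fun x => Cprod (map (fun y => qinf q (x / y)) ys)) xs).

(* Both halves of the series over Z are required to converge. *)
Definition is_biseries (u : Z -> C) (l : C) : Prop :=
  exists l1 l2 : C,
    is_series (fun n : nat => u (Z.of_nat n)) l1 /\
    is_series (fun n : nat => u (- Z.of_nat (S n))%Z) l2 /\
    l = l1 + l2.

Definition ex_biseries (u : Z -> C) : Prop := exists l : C, is_biseries u l.

Definition Biseries (u : Z -> C) : C :=
  iota (T := C_CompleteNormedModule) (is_biseries u).

(* The general term of the very-well-poised series with base parameter a and
   further parameters [xs]; with r - 2 of them this is the r-psi-r series. *)
Definition vwp_term (q a : C) (xs : list C) (w : C) (n : Z) : C :=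
  (1 - a * Cpowz q (2 * n)) / (1 - a) *
  Cprod (map (fun x => qpoch q x n / qpoch q (a * q / x) n) xs) *
  Cpowz w n.

Definition vwp_psi (q a : C) (xs : list C) (w : C) : C :=
  Biseries (vwp_term q a xs w).

(* No denominator of a term vanishes: 1 - a <> 0; for n < 0 the parameter x
   is not a pole of (x;q)_n; for n >= 0, (aq/x;q)_n <> 0. *)
Definition vwp_regular (q a : C) (xs : list C) : Prop :=
  a <> 1 /\
  List.Forall (fun x => forall k : nat, x <> q ^ S k /\ x <> a * q ^ S k) xs.

Lemma qprod_bound (q x : C) (n : nat) :
  (Cmod q < 1)%R ->
  (Cmod (qprod q x n) <= exp (Cmod x / (1 - Cmod q)))%R.
Proof.
intros Hq.
assert (H : (Cmod (qprod q x n) <=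
             exp (Cmod x * ((1 - Cmod q ^ n) / (1 - Cmod q))))%R).
{ induction n as [|n IH].
  - simpl. rewrite Cmod_1.
    replace (Cmod x * ((1 - 1) / (1 - Cmod q)))%R with 0%R
      by (field; lra).
    rewrite exp_0. lra.
  - simpl qprod. rewrite Cmod_mult.
    replace (Cmod x * ((1 - Cmod q ^ S n) / (1 - Cmod q)))%R
      with (Cmod x * ((1 - Cmod q ^ n) / (1 - Cmod q)) + Cmod x * Cmod q ^ n)%R
      by (simpl; field; lra).
    rewrite exp_plus.
    apply Rmult_le_compat; try apply Cmod_ge_0; auto.
    apply Rle_trans with (1 + Cmod x * Cmod q ^ n)%R.
    + unfold Cminus. eapply Rle_trans. { apply Cmod_triangle. }
      rewrite Cmod_1, Cmod_opp, Cmod_mult, Cmod_pow. lra.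
    + apply exp_ineq1_le. }
eapply Rle_trans. { exact H. }
assert (Hp : (0 <= Cmod q ^ n)%R) by (apply pow_le, Cmod_ge_0).
assert (H0 := Cmod_ge_0 x).
destruct (Rle_lt_or_eq_dec
  (Cmod x * ((1 - Cmod q ^ n) / (1 - Cmod q))) (Cmod x / (1 - Cmod q)))
  as [Hlt|Heq].
- unfold Rdiv. apply Rmult_le_compat_l; auto.
  rewrite <- (Rmult_1_l (/ (1 - Cmod q))) at 2.
  apply Rmult_le_compat_r; [|lra].
  left. apply Rinv_0_lt_compat. lra.
- left. now apply exp_increasing.
- rewrite Heq. apply Rle_refl.
Qed.

Lemma ex_qinf (q x : C) :
  (Cmod q < 1)%R ->
  exists l : C, filterlim (qprod q x) eventually (locally l).
Proof.
intros Hq.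
set (u := fun n : nat => - (x * q ^ n * qprod q x n)).
assert (Hs : ex_series (V := C_CompleteNormedModule) u).
{ apply (ex_series_le (K := C_AbsRing) (V := C_CompleteNormedModule) u
    (fun n => exp (Cmod x / (1 - Cmod q)) * Cmod x * Cmod q ^ n)%R).
  - intros n. change (norm (u n)) with (Cmod (u n)). unfold u.
    rewrite Cmod_opp, !Cmod_mult, Cmod_pow.
    assert (Hb := qprod_bound q x n Hq).
    assert (Hp : (0 <= Cmod q ^ n)%R) by (apply pow_le, Cmod_ge_0).
    assert (H0 := Cmod_ge_0 x).
    replace (exp (Cmod x / (1 - Cmod q)) * Cmod x * Cmod q ^ n)%R
      with (Cmod x * Cmod q ^ n * exp (Cmod x / (1 - Cmod q)))%R by ring.
    apply Rmult_le_compat_l; auto. now apply Rmult_le_pos.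
  - apply (ex_series_scal (K := R_AbsRing) (V := R_NormedModule)
      (exp (Cmod x / (1 - Cmod q)) * Cmod x)%R (fun n => Cmod q ^ n)%R).
    apply ex_series_geom. rewrite Rabs_pos_eq; auto. apply Cmod_ge_0. }
assert (Hsum : forall n, sum_n (G := C_AbelianMonoid) u n = qprod q x (S n) - 1).
{ intros n. induction n as [|n IH].
  - rewrite sum_O. unfold u. simpl. ring.
  - rewrite sum_Sn, IH. change plus with Cplus. unfold u. simpl. ring. }
destruct Hs as [l Hl]. exists (l + 1).
apply filterlim_locally. intros eps.
assert (Hl' : filterlim (fun n => sum_n (G := C_AbelianMonoid) u n + 1)
                eventually (locally (l + 1))).
{ apply (filterlim_comp_2 (F := eventually) (G := locally l)
    (H := locally (T := C_UniformSpace) (RtoC 1))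
    (sum_n (G := C_AbelianMonoid) u) (fun _ => RtoC 1) Cplus).
  - exact Hl.
  - apply filterlim_const.
  - apply (filterlim_plus (K := C_AbsRing) (V := C_NormedModule) l (RtoC 1)). }
destruct (proj1 (filterlim_locally _ _) Hl' eps) as [N HN].
exists (S N). intros [|n] Hn; [lia|].
replace (qprod q x (S n)) with (sum_n (G := C_AbelianMonoid) u n + 1)
  by (rewrite Hsum; ring).
apply HN. lia.
Qed.

Lemma is_qinf (q x : C) :
  (Cmod q < 1)%R -> filterlim (qprod q x) eventually (locally (qinf q x)).
Proof.
intros Hq. destruct (ex_qinf q x Hq) as [l Hl].
assert (E : qinf q x = l)
  by exact (iota_filterlim_locally (K := C_AbsRing)
    (V := C_CompleteNormedModule) (qprod q x) l Hl).
rewrite E. exact Hl.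
Qed.

Lemma qprod_add (q x : C) (n m : nat) :
  qprod q x (n + m) = qprod q x n * qprod q (x * q ^ n) m.
Proof.
induction m as [|m IH].
- rewrite Nat.add_0_r. simpl. ring.
- rewrite Nat.add_succ_r. simpl. rewrite IH, Cpow_add_r. ring.
Qed.

Lemma qinf_shift (q x : C) (n : nat) :
  (Cmod q < 1)%R -> qinf q x = qprod q x n * qinf q (x * q ^ n).
Proof.
intros Hq.
apply (filterlim_locally_unique (K := C_AbsRing) (V := C_NormedModule)
  (F := eventually) (fun m => qprod q x (m + n))).
- intros P HP. destruct (is_qinf q x Hq P HP) as [N HN].
  exists N. intros m Hm. apply HN. lia.
- apply filterlim_ext with (fun m => qprod q x n * qprod q (x * q ^ n) m).
  { intros m. rewrite <- qprod_add. f_equal. lia. }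
  apply (filterlim_comp _ _ _ (qprod q (x * q ^ n)) (Cmult (qprod q x n)) eventually
    (locally (qinf q (x * q ^ n))) _).
  + now apply is_qinf.
  + apply (filterlim_scal_r (K := C_AbsRing) (V := C_NormedModule)).
Qed.

Lemma qpoch_ratio (q x : C) (n : Z) :
  (0 < Cmod q < 1)%R -> qinf q (x * Cpowz q n) <> 0 ->
  qpoch q x n = qinf q x / qinf q (x * Cpowz q n).
Proof.
intros [H0 H1] Hn.
assert (Hq : forall k, q ^ k <> 0).
{ intros k. apply Cpow_nz. intros ->. rewrite Cmod_0 in H0. lra. }
destruct n as [|p|p]; simpl in *.
- rewrite Cmult_1_r in *. now field.
- rewrite (qinf_shift q x (Pos.to_nat p) H1). now field.
- fold (x / q ^ Pos.to_nat p) in *.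
  assert (E := qinf_shift q (x / q ^ Pos.to_nat p) (Pos.to_nat p) H1).
  replace (x / q ^ Pos.to_nat p * q ^ Pos.to_nat p) with x in E
    by (field; apply Hq).
  rewrite E in Hn |- *.
  assert (A : qprod q (x / q ^ Pos.to_nat p) (Pos.to_nat p) <> 0)
    by (intros A; apply Hn; rewrite A; ring).
  assert (B : qinf q x <> 0) by (intros B; apply Hn; rewrite B; ring).
  field. split; assumption.
Qed.

Lemma Biseries_unique (u : Z -> C) (l : C) :
  is_biseries u l -> Biseries u = l.
Proof.
intros H. unfold Biseries.
apply (iota_unique (K := C_AbsRing) (V := C_CompleteNormedModule)
  (is_biseries u) l); [|exact H].
intros y (y1 & y2 & Y1 & Y2 & ->). destruct H as (l1 & l2 & L1 & L2 & ->).
f_equal.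
- exact (filterlim_locally_unique (K := C_AbsRing) (V := C_NormedModule)
    (F := eventually) _ _ _ Y1 L1).
- exact (filterlim_locally_unique (K := C_AbsRing) (V := C_NormedModule)
    (F := eventually) _ _ _ Y2 L2).
Qed.

(* Main.v *)
(** The proof evaluates a double series T(n,k), k >= n, in two ways.  Put
    F = fz/a and G = gz/a.  For fixed k the sum over n is a nonterminating
    6-phi-5 and gives the k-th term of the series with base a.  For fixed n the
    sum over k is a nonterminating balanced 8-phi-7; because z = bcde/(aq),
    Jackson's two-term summation applies and yields the n-th term of the series
    with base z plus a companion 8-phi-7.  The companion is the column -n of the
    same double series for (a,b,...,e,z,F,G) replaced by
    (a/z^2,b/z,...,e/z,1/z,F/z,G/z), whose rows give the series with base a/z^2;
    reversing the order of summation turns it into the one with base z^2/a.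
    Convergence of all this is governed by |a^2q/(fgz)| < 1 and |aq/(fg)| < 1.

    Both auxiliary summations are proved by telescoping in the number of factors
    q absorbed by the parameters: for the 6-phi-5, a -> aq; for Jackson's sum,
    (a,b,c) -> (aq,bq,cq) and its permutations, which preserve b/a, so that the
    limit is a function of b/a alone.

    The argument needs the parameters to avoid the powers of q.  The general
    case follows by scaling a, z by t^2 and the other parameters by t, and
    letting t tend to 1. *)
Require Import Defs.
From Stdlib Require Import Reals ZArith List Lia Lra.
From Coquelicot Require Import Coquelicot.
Import ListNotations.
Open Scope C_scope.

(** * Limits and series of complex numbers *)

(** Terms of unilateral series are multiplied by the infinite products that clear their
    denominators: 1/(y;q)_m becomes (y q^m;q)_oo. The telescoping identities and recursions then
    hold for all nonzero parameters, and the terms are continuous in them; division is postponed to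
    the assembly of rows and columns.

    For Jackson's sum the telescoping leaves a boundary term at infinity, so neither series has a
    homogeneous recursion by itself; only their combination does. One shift is not symmetric in c,
    d, e, f. Four rotated shifts multiply a and b by q^4 and the other parameters by q, which sends
    all of a, b, c, aq/c and bc/a to 0.

    The companion needs no second theory: (a, b, ..., z) -> (a/z^2, b/z, ..., 1/z) is an involution
    that preserves bcde = azq and fixes both zq/(fg) and z^2 q/(afg) (with f, g standing for F, G),
    so the same double-series lemma applies to the image.

    Scaling by t leaves the arguments of the series unchanged; hence one geometric majorant serves
    for all t, and the coefficients only have to be normalized so that they stay finite in the
    limit. *)

Definition climit (u : nat -> C) (l : C) : Prop :=
  forall eps : R, (0 < eps)%R ->
  exists N, forall n, (N <= n)%nat -> (Cmod (u n - l) < eps)%R.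

Lemma climit_filterlim (u : nat -> C) (l : C) :
  filterlim u eventually (locally l) <-> climit u l.
Proof.
split.
- intros H eps Heps.
  (* Balls of [C] are taken coordinatewise, so [Cmod] may exceed the radius by a factor sqrt 2. *)
  assert (Hs : (0 < sqrt 2)%R) by (apply sqrt_lt_R0; lra).
  assert (He : (0 < eps / sqrt 2)%R) by now apply Rdiv_lt_0_compat.
  destruct (proj1 (filterlim_locally _ _) H (mkposreal _ He)) as [N HN].
  exists N. intros n Hn.
  assert (T := C_NormedModule_mixin_compat2 l (u n) _ (HN n Hn)).
  simpl in T. replace (sqrt 2 * (eps / sqrt 2))%R with eps in T by (field; lra).
  exact T.
- intros H. apply filterlim_locally. intros eps.
  destruct (H eps (cond_pos eps)) as [N HN]. exists N.
  intros n Hn. apply C_NormedModule_mixin_compat1. exact (HN n Hn).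
Qed.

Lemma climit_ext (u v : nat -> C) (l : C) :
  (forall n, u n = v n) -> climit u l -> climit v l.
Proof.
intros E H eps Heps. destruct (H eps Heps) as [N HN]. exists N.
intros n Hn. rewrite <- E. auto.
Qed.

Lemma climit_unique (u : nat -> C) (l m : C) :
  climit u l -> climit u m -> l = m.
Proof.
intros Hl Hm. apply climit_filterlim in Hl. apply climit_filterlim in Hm.
exact (filterlim_locally_unique (K := C_AbsRing) (V := C_NormedModule)
  (F := eventually) u l m Hl Hm).
Qed.

Lemma climit_const (l : C) : climit (fun _ => l) l.
Proof.
intros eps Heps. exists 0%nat. intros n _.
replace (l - l) with (RtoC 0) by ring. now rewrite Cmod_0.
Qed.

Lemma climit_plus (u v : nat -> C) (l m : C) :
  climit u l -> climit v m -> climit (fun n => u n + v n) (l + m).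
Proof.
intros Hu Hv eps Heps.
destruct (Hu (eps / 2)%R) as [N HN]; [lra|].
destruct (Hv (eps / 2)%R) as [M HM]; [lra|].
exists (N + M)%nat. intros n Hn.
replace (u n + v n - (l + m)) with ((u n - l) + (v n - m)) by ring.
eapply Rle_lt_trans; [apply Cmod_triangle|].
specialize (HN n). specialize (HM n).
assert (Cmod (u n - l) < eps / 2)%R by (apply HN; lia).
assert (Cmod (v n - m) < eps / 2)%R by (apply HM; lia). lra.
Qed.

Lemma climit_mult (u v : nat -> C) (l m : C) :
  climit u l -> climit v m -> climit (fun n => u n * v n) (l * m).
Proof.
intros Hu Hv eps Heps.
assert (Hl := Cmod_ge_0 l). assert (Hm := Cmod_ge_0 m).
(* |uv - lm| <= d^2 + |l| d + |m| d <= d (1 + |l| + |m|), the last step because d <= 1. *)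
set (d := Rmin 1 (eps / (1 + Cmod l + Cmod m))).
assert (Hd : (0 < d)%R).
{ apply Rmin_glb_lt; [lra|]. apply Rdiv_lt_0_compat; lra. }
assert (Hd1 : (d <= 1)%R) by apply Rmin_l.
assert (Hd2 : (d * (1 + Cmod l + Cmod m) <= eps)%R).
{ replace eps with (eps / (1 + Cmod l + Cmod m) * (1 + Cmod l + Cmod m))%R
    by (field; lra).
  apply Rmult_le_compat_r; [lra|apply Rmin_r]. }
destruct (Hu d Hd) as [N HN]. destruct (Hv d Hd) as [M HM].
exists (N + M)%nat. intros n Hn.
assert (A : (Cmod (u n - l) < d)%R) by (apply HN; lia).
assert (B : (Cmod (v n - m) < d)%R) by (apply HM; lia).
assert (A0 := Cmod_ge_0 (u n - l)). assert (B0 := Cmod_ge_0 (v n - m)).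
replace (u n * v n - l * m)
  with (((u n - l) * (v n - m) + l * (v n - m)) + (u n - l) * m) by ring.
eapply Rle_lt_trans; [apply Cmod_triangle|].
eapply Rle_lt_trans; [apply Rplus_le_compat_r, Cmod_triangle|].
rewrite !Cmod_mult. nra.
Qed.

Lemma climit_scal (c : C) (u : nat -> C) (l : C) :
  climit u l -> climit (fun n => c * u n) (c * l).
Proof. intros H. apply climit_mult; [apply climit_const|exact H]. Qed.

Lemma climit_opp (u : nat -> C) (l : C) :
  climit u l -> climit (fun n => - u n) (- l).
Proof.
intros H. replace (- l) with (- (1) * l) by ring.
apply climit_ext with (fun n => - (1) * u n); [intros n; ring|].
now apply climit_scal.
Qed.

Lemma climit_minus (u v : nat -> C) (l m : C) :
  climit u l -> climit v m -> climit (fun n => u n - v n) (l - m).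
Proof. intros Hu Hv. apply climit_plus; [auto|now apply climit_opp]. Qed.

Lemma climit_comp (u : nat -> C) (l : C) (f : nat -> nat) :
  climit u l -> (forall n, (n <= f n)%nat) -> climit (fun n => u (f n)) l.
Proof.
intros H Hf eps Heps. destruct (H eps Heps) as [N HN]. exists N.
intros n Hn. apply HN. specialize (Hf n). lia.
Qed.

Lemma climit_shift (u : nat -> C) (l : C) (k : nat) :
  climit (fun n => u (k + n)%nat) l -> climit u l.
Proof.
intros H eps Heps. destruct (H eps Heps) as [N HN]. exists (k + N)%nat.
intros n Hn. replace n with (k + (n - k))%nat by lia. apply HN. lia.
Qed.

Lemma climit_le (u : nat -> C) (l c : C) (M : R) :
  climit u l -> (forall n, (Cmod (u n - c) <= M)%R) -> (Cmod (l - c) <= M)%R.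
Proof.
intros H HM. apply le_epsilon. intros eps Heps.
destruct (H eps Heps) as [N HN]. specialize (HN N (Nat.le_refl N)).
replace (l - c) with ((u N - c) + - (u N - l)) by ring.
eapply Rle_trans; [apply Cmod_triangle|]. rewrite Cmod_opp.
specialize (HM N). lra.
Qed.

Lemma climit_squeeze (u : nat -> C) (l : C) (v : nat -> R) :
  (forall n, (Cmod (u n - l) <= v n)%R) -> is_lim_seq v 0 -> climit u l.
Proof.
intros H Hv eps Heps. apply is_lim_seq_spec in Hv.
destruct (Hv (mkposreal eps Heps)) as [N HN]. exists N. intros n Hn.
specialize (HN n Hn). simpl in HN. rewrite Rminus_0_r in HN.
eapply Rle_lt_trans; [apply H|]. eapply Rle_lt_trans; [apply Rle_abs|exact HN].
Qed.

Lemma climit_geom (K r : R) (u : nat -> C) (l : C) :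
  (0 <= r < 1)%R -> (forall n, (Cmod (u n - l) <= K * r ^ n)%R) -> climit u l.
Proof.
intros Hr H. apply climit_squeeze with (fun n => K * r ^ n)%R; auto.
replace (Finite 0) with (Rbar_mult K 0) by (simpl; f_equal; ring).
apply is_lim_seq_scal_l. apply is_lim_seq_geom. rewrite Rabs_pos_eq; lra.
Qed.

Lemma climit_inv (u : nat -> C) (l : C) :
  climit u l -> l <> 0 -> climit (fun n => / u n) (/ l).
Proof.
intros H Hl eps Heps.
assert (Hm : (0 < Cmod l)%R) by now apply Cmod_gt_0.
(* The first bound keeps |u n| above |l|/2; the second then makes |u n - l| / (|u n| |l|) smaller
   than eps. *)
destruct (H (Rmin (Cmod l / 2) (eps * (Cmod l / 2 * Cmod l)))%R) as [N HN].
{ apply Rmin_glb_lt; [lra|].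
  apply Rmult_lt_0_compat; [lra|]. apply Rmult_lt_0_compat; lra. }
exists N. intros n Hn. specialize (HN n Hn).
assert (H1 : (Cmod (u n - l) < Cmod l / 2)%R)
  by (eapply Rlt_le_trans; [exact HN|apply Rmin_l]).
assert (H2 : (Cmod (u n - l) < eps * (Cmod l / 2 * Cmod l))%R)
  by (eapply Rlt_le_trans; [exact HN|apply Rmin_r]).
assert (Hu : (Cmod l / 2 <= Cmod (u n))%R).
{ assert (T := Cmod_triangle (u n) (- (u n - l))).
  replace (u n + - (u n - l)) with l in T by ring. rewrite Cmod_opp in T. lra. }
assert (Hn0 : u n <> 0) by (apply Cmod_gt_0; lra).
replace (/ u n - / l) with (- (u n - l) / (u n * l)) by (field; auto).
rewrite Cmod_div by now apply Cmult_neq_0.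
rewrite Cmod_opp, Cmod_mult. apply Rlt_div_l.
{ apply Rmult_gt_0_compat; lra. }
eapply Rlt_le_trans; [exact H2|]. apply Rmult_le_compat_l; [lra|].
apply Rmult_le_compat_r; lra.
Qed.

Lemma climit_div (u v : nat -> C) (l m : C) :
  climit u l -> climit v m -> m <> 0 -> climit (fun n => u n / v n) (l / m).
Proof. intros Hu Hv Hm. apply climit_mult; [auto|now apply climit_inv]. Qed.

Lemma climit_pow (u : nat -> C) (l : C) (k : nat) :
  climit u l -> climit (fun n => u n ^ k) (l ^ k).
Proof.
intros H. induction k as [|k IH]; simpl; [apply climit_const|].
now apply climit_mult.
Qed.

Lemma climit_qpow (q : C) : (Cmod q < 1)%R -> climit (fun n => q ^ n) 0.
Proof.
intros Hq. apply climit_geom with 1%R (Cmod q).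
- split; [apply Cmod_ge_0|auto].
- intros n. replace (q ^ n - 0) with (q ^ n) by ring. rewrite Cmod_pow. lra.
Qed.

(** * Series with a geometric majorant *)

Fixpoint psum (u : nat -> C) (n : nat) : C :=
  match n with
  | O => 0
  | S m => psum u m + u m
  end.

Definition has_sum (u : nat -> C) (l : C) : Prop := climit (psum u) l.

(** The convergence criterion used throughout. K and r are explicit so that one pair can serve a
    whole family of series, which is the uniformity that [tannery] asks for. *)
Definition geom_bounded (K r : R) (u : nat -> C) : Prop :=
  forall n, (Cmod (u n) <= K * r ^ n)%R.

Lemma psum_sum_n (u : nat -> C) (n : nat) :
  sum_n (G := C_AbelianMonoid) u n = psum u (S n).
Proof.
induction n as [|n IH].
- rewrite sum_O. simpl. ring.
- rewrite sum_Sn, IH. reflexivity.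
Qed.

Lemma has_sum_is_series (u : nat -> C) (l : C) :
  has_sum u l <-> is_series (V := C_NormedModule) u l.
Proof.
split.
- intros H. apply climit_filterlim.
  apply climit_ext with (fun n => psum u (S n)).
  { intros n. symmetry. apply psum_sum_n. }
  apply (climit_comp (psum u) l S); auto.
- intros H. apply (climit_shift _ _ 1). apply climit_filterlim.
  apply filterlim_ext with (2 := H). intros n. apply psum_sum_n.
Qed.

Lemma psum_ext (u v : nat -> C) (n : nat) :
  (forall i, u i = v i) -> psum u n = psum v n.
Proof. intros E. induction n as [|n IH]; simpl; congruence. Qed.

Lemma psum_plus (u v : nat -> C) (n : nat) :
  psum (fun i => u i + v i) n = psum u n + psum v n.
Proof. induction n as [|n IH]; simpl; [ring|]. rewrite IH. ring. Qed.

Lemma psum_scal (c : C) (u : nat -> C) (n : nat) :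
  psum (fun i => c * u i) n = c * psum u n.
Proof. induction n as [|n IH]; simpl; [ring|]. rewrite IH. ring. Qed.

Lemma psum_head (u : nat -> C) (n : nat) :
  psum u (S n) = u 0%nat + psum (fun i => u (S i)) n.
Proof.
induction n as [|n IH]; [simpl; ring|].
change (psum u (S (S n))) with (psum u (S n) + u (S n)). rewrite IH.
simpl. ring.
Qed.

Lemma has_sum_ext (u v : nat -> C) (l : C) :
  (forall n, u n = v n) -> has_sum u l -> has_sum v l.
Proof.
intros E. apply climit_ext. intros n. now apply psum_ext.
Qed.

Lemma has_sum_unique (u : nat -> C) (l m : C) :
  has_sum u l -> has_sum u m -> l = m.
Proof. apply climit_unique. Qed.

Lemma has_sum_plus (u v : nat -> C) (l m : C) :
  has_sum u l -> has_sum v m -> has_sum (fun n => u n + v n) (l + m).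
Proof.
intros Hu Hv. apply climit_ext with (fun n => psum u n + psum v n).
- intros n. symmetry. apply psum_plus.
- now apply climit_plus.
Qed.

Lemma has_sum_scal (c : C) (u : nat -> C) (l : C) :
  has_sum u l -> has_sum (fun n => c * u n) (c * l).
Proof.
intros Hu. apply climit_ext with (fun n => c * psum u n).
- intros n. symmetry. apply psum_scal.
- now apply climit_scal.
Qed.

Lemma has_sum_head (u : nat -> C) (l : C) :
  has_sum u l <-> has_sum (fun n => u (S n)) (l - u 0%nat).
Proof.
split; intros H.
- apply climit_ext with (fun n => psum u (S n) - u 0%nat).
  { intros n. rewrite psum_head. ring. }
  apply climit_minus; [|apply climit_const].
  apply (climit_comp (psum u) l S); auto.
- apply (climit_shift _ _ 1). simpl.
  apply climit_ext with (fun n => u 0%nat + psum (fun i => u (S i)) n).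
  { intros n. rewrite <- psum_head. reflexivity. }
  replace l with (u 0%nat + (l - u 0%nat)) by ring.
  apply climit_plus; [apply climit_const|exact H].
Qed.

Lemma has_sum_first (u : nat -> C) :
  (forall n, u (S n) = 0) -> has_sum u (u 0%nat).
Proof.
intros H. apply (climit_shift _ _ 1).
apply climit_ext with (fun _ => u 0%nat); [|apply climit_const].
intros n. induction n as [|n IH]; simpl in *; [ring|].
rewrite <- IH, H. ring.
Qed.

Lemma geom_bounded_pos (K r : R) (u : nat -> C) :
  geom_bounded K r u -> (0 <= K)%R.
Proof.
intros H. specialize (H 0%nat). simpl in H.
assert (T := Cmod_ge_0 (u 0%nat)). lra.
Qed.

Lemma ex_has_sum (K r : R) (u : nat -> C) :
  (0 <= r < 1)%R -> geom_bounded K r u -> exists l, has_sum u l.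
Proof.
intros Hr Hu.
destruct (ex_series_le (K := C_AbsRing) (V := C_CompleteNormedModule) u
  (fun n => K * r ^ n)%R) as [l Hl].
- exact Hu.
- apply (ex_series_scal (K := R_AbsRing) (V := R_NormedModule) K
    (fun n => r ^ n)%R).
  apply ex_series_geom. rewrite Rabs_pos_eq; lra.
- exists l. now apply has_sum_is_series.
Qed.

Lemma psum_tail_bound (K r : R) (u : nat -> C) (N p : nat) :
  (0 <= r < 1)%R -> geom_bounded K r u ->
  (Cmod (psum u (N + p) - psum u N) <= K * r ^ N / (1 - r))%R.
Proof.
intros Hr Hu. assert (HK := geom_bounded_pos _ _ _ Hu).
assert (H : (Cmod (psum u (N + p) - psum u N)
             <= K * r ^ N * ((1 - r ^ p) / (1 - r)))%R).
{ induction p as [|p IH].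
  - rewrite Nat.add_0_r. replace (psum u N - psum u N) with (RtoC 0) by ring.
    rewrite Cmod_0. simpl. unfold Rdiv. rewrite Rminus_diag, Rmult_0_l. lra.
  - rewrite Nat.add_succ_r. simpl psum.
    replace (psum u (N + p) + u (N + p)%nat - psum u N)
      with ((psum u (N + p) - psum u N) + u (N + p)%nat) by ring.
    eapply Rle_trans; [apply Cmod_triangle|].
    replace (K * r ^ N * ((1 - r ^ S p) / (1 - r)))%R
      with (K * r ^ N * ((1 - r ^ p) / (1 - r)) + K * r ^ (N + p))%R.
    + apply Rplus_le_compat; [exact IH|apply Hu].
    + rewrite pow_add. simpl. field. lra. }
eapply Rle_trans; [exact H|].
assert (0 <= r ^ N)%R by (apply pow_le; lra).
assert (0 <= r ^ p)%R by (apply pow_le; lra).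
unfold Rdiv. rewrite <- Rmult_assoc. apply Rmult_le_compat_r.
- left. apply Rinv_0_lt_compat. lra.
- rewrite <- (Rmult_1_r (K * r ^ N)) at 2. apply Rmult_le_compat_l; [|lra].
  now apply Rmult_le_pos.
Qed.

Lemma has_sum_tail_bound (K r : R) (u : nat -> C) (l : C) (N : nat) :
  (0 <= r < 1)%R -> geom_bounded K r u -> has_sum u l ->
  (Cmod (l - psum u N) <= K * r ^ N / (1 - r))%R.
Proof.
intros Hr Hu Hl. apply climit_le with (fun p => psum u (N + p)).
- apply climit_comp with (f := fun p => (N + p)%nat); [exact Hl|intros; lia].
- intros p. now apply psum_tail_bound.
Qed.

Lemma has_sum_bound (K r : R) (u : nat -> C) (l : C) :
  (0 <= r < 1)%R -> geom_bounded K r u -> has_sum u l ->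
  (Cmod l <= K / (1 - r))%R.
Proof.
intros Hr Hu Hl. assert (H := has_sum_tail_bound K r u l 0 Hr Hu Hl).
simpl in H. replace (l - 0) with l in H by ring.
now rewrite Rmult_1_r in H.
Qed.

Lemma climit_psum (u : nat -> nat -> C) (v : nat -> C) (N : nat) :
  (forall n, climit (fun j => u j n) (v n)) ->
  climit (fun j => psum (u j) N) (psum v N).
Proof.
intros H. induction N as [|N IH]; simpl; [apply climit_const|].
now apply climit_plus.
Qed.

(** Dominated convergence: the tails beyond N are at most K r^N/(1-r) for all j at once, the finite
    heads converge termwise, and the limiting terms inherit the majorant. *)
Lemma tannery (K r : R) (u : nat -> nat -> C) (v l : nat -> C) (m : C) :
  (0 <= r < 1)%R -> (forall j, geom_bounded K r (u j)) ->
  (forall n, climit (fun j => u j n) (v n)) ->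
  (forall j, has_sum (u j) (l j)) -> has_sum v m -> climit l m.
Proof.
intros Hr Hu Hv Hl Hm.
assert (HK := geom_bounded_pos _ _ _ (Hu 0%nat)).
assert (Hvb : geom_bounded K r v).
{ intros n. replace (v n) with (v n - 0) by ring.
  apply climit_le with (fun j => u j n); [apply Hv|].
  intros j. replace (u j n - 0) with (u j n) by ring. apply Hu. }
intros eps Heps.
assert (HN : exists N, (K * r ^ N / (1 - r) < eps / 3)%R).
{ destruct (climit_geom (K / (1 - r)) r (fun n => RtoC (K / (1 - r) * r ^ n)) 0 Hr)
    with (eps := (eps / 3)%R) as [N HN]; [|lra|].
  - intros n. replace (RtoC (K / (1 - r) * r ^ n) - 0)
      with (RtoC (K / (1 - r) * r ^ n)) by ring.
    rewrite Cmod_R, Rabs_pos_eq; [lra|].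
    apply Rmult_le_pos; [|apply pow_le; lra].
    apply Rmult_le_pos; [auto|]. left. apply Rinv_0_lt_compat. lra.
  - exists N. specialize (HN N (Nat.le_refl N)).
    replace (RtoC (K / (1 - r) * r ^ N) - 0)
      with (RtoC (K / (1 - r) * r ^ N)) in HN by ring.
    rewrite Cmod_R in HN.
    replace (K * r ^ N / (1 - r))%R with (K / (1 - r) * r ^ N)%R by (field; lra).
    eapply Rle_lt_trans; [apply Rle_abs|exact HN]. }
destruct HN as [N HN].
destruct (climit_psum u v N Hv (eps / 3)%R) as [J HJ]; [lra|].
exists J. intros j Hj. specialize (HJ j Hj).
assert (H1 := has_sum_tail_bound K r (u j) (l j) N Hr (Hu j) (Hl j)).
assert (H2 := has_sum_tail_bound K r v m N Hr Hvb Hm).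
replace (l j - m)
  with ((l j - psum (u j) N) + (psum (u j) N - psum v N) + - (m - psum v N))
  by ring.
eapply Rle_lt_trans; [apply Cmod_triangle|].
assert (H3 := Cmod_triangle (l j - psum (u j) N) (psum (u j) N - psum v N)).
rewrite Cmod_opp. lra.
Qed.

Lemma has_sum_psum (u : nat -> nat -> C) (R : nat -> C) (N : nat) :
  (forall i, has_sum (u i) (R i)) ->
  has_sum (fun j => psum (fun i => u i j) N) (psum R N).
Proof.
intros H. induction N as [|N IH]; simpl.
- apply climit_ext with (fun _ => RtoC 0); [|apply climit_const].
  intros n. induction n as [|n IHn]; simpl; [reflexivity|].
  rewrite <- IHn. ring.
- now apply has_sum_plus.
Qed.

(** By linearity [psum A N] is the sum over j of the N-term inner sums. As N grows, [tannery]
    applies to these with the majorant K/(1-r) r^j, and their limit is the sum of B. *)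
Lemma has_sum_exchange (K r : R) (u : nat -> nat -> C) (A B : nat -> C) (l : C) :
  (0 <= r < 1)%R ->
  (forall i j, (Cmod (u i j) <= K * r ^ i * r ^ j)%R) ->
  (forall i, has_sum (u i) (A i)) ->
  (forall j, has_sum (fun i => u i j) (B j)) ->
  has_sum A l -> has_sum B l.
Proof.
intros Hr Hu HA HB Hl.
assert (Hg : forall j, geom_bounded (K * r ^ j) r (fun i => u i j)).
{ intros j i. specialize (Hu i j). lra. }
assert (HBb : geom_bounded (K / (1 - r)) r B).
{ intros j. eapply Rle_trans.
  - apply (has_sum_bound (K * r ^ j) r (fun i => u i j)); auto.
  - right. field. lra. }
destruct (ex_has_sum _ _ B Hr HBb) as [m Hm].
assert (E : climit (psum A) m).
{ apply (tannery (K / (1 - r)) r (fun N j => psum (fun i => u i j) N) B); auto.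
  - intros N j. assert (T := psum_tail_bound _ _ _ 0 N Hr (Hg j)). simpl in T.
    replace (psum (fun i => u i j) N - 0) with (psum (fun i => u i j) N) in T
      by ring.
    eapply Rle_trans; [exact T|]. right. field. lra.
  - intros N. now apply has_sum_psum. }
now rewrite (climit_unique _ _ _ Hl E).
Qed.

(** * Finite and infinite q-shifted factorials *)

Lemma q_neq0 (q : C) : (0 < Cmod q < 1)%R -> q <> 0.
Proof. intros Hq. apply Cmod_gt_0. lra. Qed.

Lemma Cpowz_of_nat (q : C) (n : nat) : Cpowz q (Z.of_nat n) = q ^ n.
Proof.
destruct n as [|n]; [reflexivity|].
change (q ^ Pos.to_nat (Pos.of_succ_nat n) = q ^ S n).
now rewrite SuccNat2Pos.id_succ.
Qed.

Lemma Cpowz_opp_of_nat (q : C) (n : nat) :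
  Cpowz q (- Z.of_nat n) = / q ^ n.
Proof.
destruct n as [|n].
- simpl. field.
- change (/ q ^ Pos.to_nat (Pos.of_succ_nat n) = / q ^ S n).
  now rewrite SuccNat2Pos.id_succ.
Qed.

Lemma Cinv_neq0 (x : C) : x <> 0 -> / x <> 0.
Proof.
intros Hx H. apply C1_nz. rewrite <- (Cinv_r x Hx), H. ring.
Qed.

Lemma Cdiv_neq0 (x y : C) : x <> 0 -> y <> 0 -> x / y <> 0.
Proof. intros Hx Hy. apply Cmult_neq_0; [auto|now apply Cinv_neq0]. Qed.

Lemma Cpowz_neq0 (q : C) (n : Z) : q <> 0 -> Cpowz q n <> 0.
Proof.
intros Hq. destruct n; simpl.
- exact C1_nz.
- now apply Cpow_nz.
- now apply Cinv_neq0, Cpow_nz.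
Qed.

Lemma Cpowz_succ (q : C) (n : Z) : q <> 0 -> Cpowz q (n + 1) = Cpowz q n * q.
Proof.
intros Hq. destruct (Z_le_gt_dec 0 n) as [H|H].
- replace (n + 1)%Z with (Z.of_nat (S (Z.to_nat n))) by lia.
  replace n with (Z.of_nat (Z.to_nat n)) at 2 by lia.
  rewrite !Cpowz_of_nat. simpl. ring.
- replace (n + 1)%Z with (- Z.of_nat (Z.to_nat (- n - 1)))%Z by lia.
  replace n with (- Z.of_nat (S (Z.to_nat (- n - 1))))%Z at 2 by lia.
  rewrite !Cpowz_opp_of_nat. simpl.
  field. split; [now apply Cpow_nz|auto].
Qed.

Lemma Cpowz_add_nat (q : C) (n : Z) (k : nat) :
  q <> 0 -> Cpowz q (n + Z.of_nat k) = Cpowz q n * q ^ k.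
Proof.
intros Hq. induction k as [|k IH].
- simpl. rewrite Z.add_0_r. ring.
- replace (n + Z.of_nat (S k))%Z with (n + Z.of_nat k + 1)%Z by lia.
  rewrite Cpowz_succ, IH by auto. simpl. ring.
Qed.

Lemma Cpowz_add (q : C) (n m : Z) :
  q <> 0 -> Cpowz q (n + m) = Cpowz q n * Cpowz q m.
Proof.
intros Hq. destruct (Z_le_gt_dec 0 m) as [H|H].
- replace m with (Z.of_nat (Z.to_nat m)) by lia.
  now rewrite Cpowz_add_nat, Cpowz_of_nat.
- replace m with (- Z.of_nat (Z.to_nat (- m)))%Z by lia.
  set (k := Z.to_nat (- m)). rewrite Cpowz_opp_of_nat.
  replace n with (n + - Z.of_nat k + Z.of_nat k)%Z at 2 by lia.
  rewrite Cpowz_add_nat by auto. field. now apply Cpow_nz.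
Qed.

Lemma Cpowz_opp (q : C) (n : Z) : q <> 0 -> Cpowz q (- n) = / Cpowz q n.
Proof.
intros Hq. assert (E := Cpowz_add q n (- n) Hq).
rewrite Z.add_opp_diag_r in E. simpl in E.
assert (H := Cpowz_neq0 q n Hq).
replace (Cpowz q (- n)) with (/ Cpowz q n * (Cpowz q n * Cpowz q (- n)))
  by (field; auto).
rewrite <- E. ring.
Qed.

Lemma Cpowz_double (q : C) (n : Z) :
  q <> 0 -> Cpowz q (2 * n) = Cpowz q n * Cpowz q n.
Proof. intros Hq. rewrite <- Cpowz_add by auto. f_equal. lia. Qed.

Lemma Cpowz_1 (q : C) : Cpowz q 1 = q.
Proof. simpl. ring. Qed.

Lemma Cpowz_mult (x y : C) (n : Z) :
  x <> 0 -> y <> 0 -> Cpowz (x * y) n = Cpowz x n * Cpowz y n.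
Proof.
intros Hx Hy. destruct n; simpl; [ring|apply Cpow_mult_l|].
rewrite Cpow_mult_l. field. split; now apply Cpow_nz.
Qed.

Lemma qprod_head (q x : C) (n : nat) :
  qprod q x (S n) = (1 - x) * qprod q (x * q) n.
Proof.
change (S n) with (1 + n)%nat. rewrite qprod_add. simpl.
replace (x * (q * 1)) with (x * q) by ring. ring.
Qed.

Lemma qinf_step (q x : C) :
  (Cmod q < 1)%R -> qinf q x = (1 - x) * qinf q (x * q).
Proof.
intros Hq. rewrite (qinf_shift q x 1 Hq). simpl.
replace (x * (q * 1)) with (x * q) by ring. ring.
Qed.

Lemma climit_qprod_qinf (q x : C) :
  (Cmod q < 1)%R -> climit (qprod q x) (qinf q x).
Proof. intros Hq. apply climit_filterlim. now apply is_qinf. Qed.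

Lemma qinf_bound (q x : C) :
  (Cmod q < 1)%R -> (Cmod (qinf q x) <= exp (Cmod x / (1 - Cmod q)))%R.
Proof.
intros Hq. replace (qinf q x) with (qinf q x - 0) by ring.
apply climit_le with (qprod q x); [now apply climit_qprod_qinf|].
intros n. replace (qprod q x n - 0) with (qprod q x n) by ring.
now apply qprod_bound.
Qed.

Lemma exp_div_le (q : C) (a b : R) :
  (Cmod q < 1)%R -> (a <= b)%R ->
  (exp (a / (1 - Cmod q)) <= exp (b / (1 - Cmod q)))%R.
Proof.
intros Hq H. destruct H as [H|H]; [|rewrite H; apply Rle_refl].
left. apply exp_increasing. apply Rmult_lt_compat_r; [|exact H].
apply Rinv_0_lt_compat. lra.
Qed.

(** Multiplying p by 1 - t multiplies |p - 1| + 1 by at most 1 + |t|, so this quantity is dominated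
    by the product of the 1 + |x q^i|, hence by an exponential. *)
Lemma qprod_1_bound (q x : C) (n : nat) :
  (Cmod q < 1)%R ->
  (Cmod (qprod q x n - 1) <= exp (Cmod x / (1 - Cmod q)) - 1)%R.
Proof.
intros Hq. set (E := exp (Cmod x / (1 - Cmod q))).
assert (H : (Cmod (qprod q x n - 1) + 1
             <= exp (Cmod x * ((1 - Cmod q ^ n) / (1 - Cmod q))))%R).
{ induction n as [|n IH].
  - simpl. replace (1 - 1) with (RtoC 0) by ring. rewrite Cmod_0.
    replace (Cmod x * ((1 - 1) / (1 - Cmod q)))%R with 0%R by (field; lra).
    rewrite exp_0. lra.
  - simpl qprod.
    replace (Cmod x * ((1 - Cmod q ^ S n) / (1 - Cmod q)))%R
      with (Cmod x * ((1 - Cmod q ^ n) / (1 - Cmod q)) + Cmod x * Cmod q ^ n)%R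
      by (simpl; field; lra).
    rewrite exp_plus.
    set (p := qprod q x n) in *. set (t := x * q ^ n).
    assert (Ht : (Cmod x * Cmod q ^ n)%R = Cmod t)
      by (unfold t; now rewrite Cmod_mult, Cmod_pow).
    rewrite Ht. set (F := exp (Cmod x * ((1 - Cmod q ^ n) / (1 - Cmod q)))) in *.
    replace (p * (1 - t) - 1) with ((p - 1) + - ((p - 1) * t + t)) by ring.
    assert (T1 := Cmod_triangle (p - 1) (- ((p - 1) * t + t))).
    assert (T2 := Cmod_triangle ((p - 1) * t) t).
    rewrite Cmod_opp in T1. rewrite Cmod_mult in T2.
    assert (T3 := exp_ineq1_le (Cmod t)).
    assert (T4 := Cmod_ge_0 t). assert (T5 := Cmod_ge_0 (p - 1)).
    apply Rle_trans with ((Cmod (p - 1) + 1) * (1 + Cmod t))%R; [lra|].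
    apply Rmult_le_compat; lra. }
assert (Hp : (0 <= Cmod q ^ n)%R) by (apply pow_le, Cmod_ge_0).
assert (H0 := Cmod_ge_0 x).
assert (Hle : (exp (Cmod x * ((1 - Cmod q ^ n) / (1 - Cmod q))) <= E)%R).
{ unfold E. replace (Cmod x * ((1 - Cmod q ^ n) / (1 - Cmod q)))%R
    with (Cmod x * (1 - Cmod q ^ n) / (1 - Cmod q))%R by (field; lra).
  apply exp_div_le; nra. }
lra.
Qed.

Lemma qprod_neq0 (q x : C) (n : nat) :
  (forall k, (k < n)%nat -> x * q ^ k <> 1) -> qprod q x n <> 0.
Proof.
induction n as [|n IH]; intros H; simpl.
- exact C1_nz.
- apply Cmult_neq_0; [apply IH; auto|].
  intros E. apply (H n); [lia|].
  replace (x * q ^ n) with (1 - (1 - x * q ^ n)) by ring. rewrite E. ring.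
Qed.

(** After N factors, which are nonzero by hypothesis, the remaining argument y is so small that
    |(y;q)_oo - 1| <= exp(1/2) - 1 < 1. *)
Lemma qinf_neq0 (q x : C) :
  (Cmod q < 1)%R -> (forall k : nat, x * q ^ k <> 1) -> qinf q x <> 0.
Proof.
intros Hq H.
assert (H0 := Cmod_ge_0 x). assert (H0q := Cmod_ge_0 q).
assert (HN : exists N, (Cmod (x * q ^ N) / (1 - Cmod q) < / 2)%R).
{ destruct (climit_scal x _ _ (climit_qpow q Hq) ((1 - Cmod q) / 2)%R)
    as [N HN]; [lra|].
  exists N. specialize (HN N (Nat.le_refl N)).
  replace (x * q ^ N - x * 0) with (x * q ^ N) in HN by ring.
  apply Rlt_div_l; lra. }
destruct HN as [N HN].
rewrite (qinf_shift q x N Hq). apply Cmult_neq_0.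
- apply qprod_neq0. auto.
- set (y := x * q ^ N) in *. intros E.
  assert (B : (Cmod (qinf q y - 1) <= exp (Cmod y / (1 - Cmod q)) - 1)%R).
  { apply climit_le with (qprod q y); [now apply climit_qprod_qinf|].
    intros n. now apply qprod_1_bound. }
  rewrite E in B. replace (0 - 1) with (- (1)) in B by ring.
  rewrite Cmod_opp, Cmod_1 in B.
  assert (T := exp_increasing _ _ HN).
  assert (T2 : (exp (/ 2) < 2)%R).
  { assert (S := exp_le_3).
    replace (exp 1) with (exp (/ 2) * exp (/ 2))%R in S
      by (rewrite <- exp_plus; f_equal; lra).
    assert (P := exp_pos (/ 2)). nra. }
  lra.
Qed.

Lemma Cmod_qpow_le1 (q : C) (n : nat) : (Cmod q < 1)%R -> (Cmod (q ^ n) <= 1)%R.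
Proof.
intros Hq. rewrite Cmod_pow. assert (L := pow_incr (Cmod q) 1 n).
rewrite pow1 in L. apply L. split; [apply Cmod_ge_0|lra].
Qed.

Lemma Cmod_mult_qpow_le (q x : C) (n : nat) :
  (Cmod q < 1)%R -> (Cmod (x * q ^ n) <= Cmod x)%R.
Proof.
intros Hq. rewrite Cmod_mult. assert (L := Cmod_qpow_le1 q n Hq).
assert (T := Cmod_ge_0 x). nra.
Qed.

Lemma qinf_small_neq0 (q x : C) :
  (Cmod q < 1)%R -> (Cmod x < 1)%R -> qinf q x <> 0.
Proof.
intros Hq Hx. apply qinf_neq0; [auto|]. intros k E.
assert (L := Cmod_mult_qpow_le q x k Hq). rewrite E, Cmod_1 in L. lra.
Qed.

Lemma has_sum_qinf (q x : C) :
  (Cmod q < 1)%R ->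
  has_sum (fun n => - (x * q ^ n * qprod q x n)) (qinf q x - 1).
Proof.
intros Hq. apply climit_ext with (fun n => qprod q x n - 1).
- intros n. induction n as [|n IH]; simpl; [ring|]. rewrite <- IH. ring.
- apply climit_minus; [now apply climit_qprod_qinf|apply climit_const].
Qed.

Lemma climit_qprod (q : C) (xs : nat -> C) (x : C) (n : nat) :
  climit xs x -> climit (fun j => qprod q (xs j) n) (qprod q x n).
Proof.
intros H. induction n as [|n IH]; simpl; [apply climit_const|].
apply climit_mult; [exact IH|].
apply climit_minus; [apply climit_const|].
apply climit_mult; [exact H|apply climit_const].
Qed.

Lemma climit_bounded (u : nat -> C) (l : C) :
  climit u l -> exists k, forall n, (Cmod (u (k + n)%nat) <= Cmod l + 1)%R.
Proof.
intros H. destruct (H 1%R) as [k Hk]; [lra|]. exists k. intros n.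
specialize (Hk (k + n)%nat). assert (k <= k + n)%nat by lia.
specialize (Hk H0). replace (u (k + n)%nat) with (l + (u (k + n)%nat - l)) by ring.
eapply Rle_trans; [apply Cmod_triangle|]. lra.
Qed.

(** (x;q)_oo - 1 is the series of the increments of its partial products ([has_sum_qinf]), with a
    majorant uniform for bounded x, so [tannery] gives continuity. The sequence is known to be
    bounded only from an index k on, hence the shift. *)
Lemma climit_qinf (q : C) (xs : nat -> C) (x : C) :
  (Cmod q < 1)%R -> climit xs x ->
  climit (fun j => qinf q (xs j)) (qinf q x).
Proof.
intros Hq H. destruct (climit_bounded xs x H) as [k Hk].
apply (climit_shift _ _ k).
assert (H' : climit (fun j => xs (k + j)%nat) x).
{ apply climit_comp with (f := fun j => (k + j)%nat); [exact H|intros; lia]. }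
replace (qinf q x) with (1 + (qinf q x - 1)) by ring.
apply climit_ext with (fun j => 1 + (qinf q (xs (k + j)%nat) - 1)).
{ intros n. ring. }
apply climit_plus; [apply climit_const|].
assert (H0q := Cmod_ge_0 q).
apply (tannery ((Cmod x + 1) * exp ((Cmod x + 1) / (1 - Cmod q))) (Cmod q)
  (fun j n => - (xs (k + j)%nat * q ^ n * qprod q (xs (k + j)%nat) n))
  (fun n => - (x * q ^ n * qprod q x n))).
- lra.
- intros j n. rewrite Cmod_opp, !Cmod_mult, Cmod_pow.
  assert (B := qprod_bound q (xs (k + j)%nat) n Hq).
  assert (B2 := exp_div_le q _ _ Hq (Hk j)).
  assert (P : (0 <= Cmod q ^ n)%R) by now apply pow_le.
  replace ((Cmod x + 1) * exp ((Cmod x + 1) / (1 - Cmod q)) * Cmod q ^ n)%R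
    with ((Cmod x + 1) * Cmod q ^ n * exp ((Cmod x + 1) / (1 - Cmod q)))%R by ring.
  apply Rmult_le_compat; [|apply Cmod_ge_0| |lra].
  + apply Rmult_le_pos; [apply Cmod_ge_0|auto].
  + apply Rmult_le_compat_r; [auto|apply Hk].
- intros n. apply climit_opp, climit_mult; [|now apply climit_qprod].
  apply climit_mult; [exact H'|apply climit_const].
- intros j. now apply has_sum_qinf.
- now apply has_sum_qinf.
Qed.

Lemma qprod_0 (q : C) (n : nat) : qprod q 0 n = 1.
Proof. induction n as [|n IH]; simpl; [reflexivity|]. rewrite IH. ring. Qed.

Lemma qinf_0 (q : C) : (Cmod q < 1)%R -> qinf q 0 = 1.
Proof.
intros Hq. apply climit_unique with (qprod q 0).
- now apply climit_qprod_qinf.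
- apply climit_ext with (fun _ => RtoC 1); [|apply climit_const].
  intros n. now rewrite qprod_0.
Qed.

Lemma qinf_1 (q : C) : (Cmod q < 1)%R -> qinf q 1 = 0.
Proof. intros Hq. rewrite (qinf_step q 1 Hq). ring. Qed.

(* Each factor [1 - x q^-i] of the left-hand product equals
   [(- x q^-i) (1 - q^i / x)]; the powers of [q] cancel between the sides. *)
Lemma qprod_reverse (q x y : C) (m : nat) :
  q <> 0 -> x <> 0 -> y <> 0 ->
  qprod q (x / q ^ m) m * (y ^ m * qprod q (q / y) m) =
  qprod q (y / q ^ m) m * (x ^ m * qprod q (q / x) m).
Proof.
intros Hq Hx Hy. induction m as [|m IH]; [simpl; ring|].
assert (Hm := Cpow_nz q m Hq).
rewrite !(qprod_head q (_ / q ^ S m)).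
replace (x / q ^ S m * q) with (x / q ^ m) by (simpl; field; auto).
replace (y / q ^ S m * q) with (y / q ^ m) by (simpl; field; auto).
simpl.
transitivity (qprod q (x / q ^ m) m * (y ^ m * qprod q (q / y) m) *
  ((1 - x / (q * q ^ m)) * (y * (1 - q / y * q ^ m)))); [ring|].
rewrite IH.
replace ((1 - x / (q * q ^ m)) * (y * (1 - q / y * q ^ m)))
  with ((1 - y / (q * q ^ m)) * (x * (1 - q / x * q ^ m)))
  by (field; auto).
ring.
Qed.

(** Stable under x -> x q^n, 1/x and q/x, and enough to make every (x;q)_n and (x q^n;q)_oo finite
    and nonzero, so that [qpoch] is a genuine quotient of infinite products. *)
Definition off_lattice (q x : C) : Prop :=
  x <> 0 /\ forall n : Z, x <> Cpowz q n.

Lemma off_lattice_mult (q x : C) (n : Z) :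
  q <> 0 -> off_lattice q x -> off_lattice q (x * Cpowz q n).
Proof.
intros Hq [Hx H]. assert (Hn := Cpowz_neq0 q n Hq). split.
- now apply Cmult_neq_0.
- intros m E. apply (H (m - n)%Z). unfold Z.sub.
  rewrite Cpowz_add, Cpowz_opp, <- E by auto. field. auto.
Qed.

Lemma off_lattice_q (q x : C) :
  q <> 0 -> off_lattice q x -> off_lattice q (x * q).
Proof.
intros Hq H. rewrite <- (Cpowz_1 q) at 2. now apply off_lattice_mult.
Qed.

Lemma off_lattice_inv (q x : C) :
  q <> 0 -> off_lattice q x -> off_lattice q (/ x).
Proof.
intros Hq [Hx H]. split; [now apply Cinv_neq0|].
intros n E. apply (H (- n)%Z). rewrite Cpowz_opp, <- E by auto. field. auto.
Qed.

Lemma off_lattice_qinf (q x : C) :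
  (0 < Cmod q < 1)%R -> off_lattice q x -> qinf q x <> 0.
Proof.
intros Hq [Hx H]. assert (Hq0 := q_neq0 q Hq).
apply qinf_neq0; [lra|]. intros k E. apply (H (- Z.of_nat k)%Z).
rewrite Cpowz_opp_of_nat. assert (Hk := Cpow_nz q k Hq0).
replace x with (x * q ^ k * / q ^ k) by (field; auto). rewrite E. ring.
Qed.

Lemma off_lattice_qinf_powz (q x : C) (n : Z) :
  (0 < Cmod q < 1)%R -> off_lattice q x -> qinf q (x * Cpowz q n) <> 0.
Proof.
intros Hq H. apply off_lattice_qinf; [auto|].
apply off_lattice_mult; [now apply q_neq0|auto].
Qed.

Lemma off_lattice_neq1 (q x : C) : off_lattice q x -> 1 - x <> 0.
Proof.
intros [_ H] E. apply (H 0%Z). simpl.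
replace x with (1 - (1 - x)) by ring. rewrite E. ring.
Qed.

Lemma off_lattice_qprod (q x : C) (n : nat) :
  q <> 0 -> off_lattice q x -> qprod q x n <> 0.
Proof.
intros Hq [Hx H]. apply qprod_neq0. intros k _ E.
apply (H (- Z.of_nat k)%Z). rewrite Cpowz_opp_of_nat.
assert (Hk := Cpow_nz q k Hq).
replace x with (x * q ^ k * / q ^ k) by (field; auto). rewrite E. ring.
Qed.

Lemma qpoch_qinf (q x : C) (n : Z) :
  (0 < Cmod q < 1)%R -> off_lattice q x ->
  qpoch q x n = qinf q x / qinf q (x * Cpowz q n).
Proof.
intros Hq H. apply qpoch_ratio; [exact Hq|]. now apply off_lattice_qinf_powz.
Qed.

Lemma qpoch_neq0 (q x : C) (n : Z) :
  (0 < Cmod q < 1)%R -> off_lattice q x -> qpoch q x n <> 0.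
Proof.
intros Hq H. rewrite qpoch_qinf by auto.
apply Cdiv_neq0; [now apply off_lattice_qinf|now apply off_lattice_qinf_powz].
Qed.

Lemma qpoch_add_nat (q x : C) (n : Z) (m : nat) :
  (0 < Cmod q < 1)%R -> off_lattice q x ->
  qpoch q x (n + Z.of_nat m) = qpoch q x n * qprod q (x * Cpowz q n) m.
Proof.
intros Hq H. assert (Hq0 := q_neq0 q Hq). rewrite !qpoch_qinf by auto.
assert (A := off_lattice_qinf_powz q x n Hq H).
assert (B := off_lattice_qinf_powz q x (n + Z.of_nat m) Hq H).
rewrite Cpowz_add_nat, Cmult_assoc in * by auto.
rewrite (qinf_shift q (x * Cpowz q n) m) in A |- * by lra.
assert (D : qprod q (x * Cpowz q n) m <> 0).
{ apply off_lattice_qprod; [auto|now apply off_lattice_mult]. }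
field. auto.
Qed.

(** Reversing (x;q)_{n-m} alone brings in a power of q quadratic in m. It is the same for y and
    cancels in the quotient, which leaves only the geometric factor (y/x)^m. *)
Lemma qpoch_ratio_sub_nat (q x y : C) (n : Z) (m : nat) :
  (0 < Cmod q < 1)%R -> off_lattice q x -> off_lattice q y ->
  qpoch q x (n - Z.of_nat m) / qpoch q y (n - Z.of_nat m) =
  qpoch q x n / qpoch q y n *
  ((y / x) ^ m * (qprod q (Cpowz q (1 - n) / y) m /
                  qprod q (Cpowz q (1 - n) / x) m)).
Proof.
intros Hq Hx Hy. assert (Hq0 := q_neq0 q Hq).
assert (Hn := Cpowz_neq0 q n Hq0). assert (Hm := Cpow_nz q m Hq0).
assert (Ex := qpoch_add_nat q x (n - Z.of_nat m) m Hq Hx).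
assert (Ey := qpoch_add_nat q y (n - Z.of_nat m) m Hq Hy).
replace (n - Z.of_nat m + Z.of_nat m)%Z with n in Ex, Ey by lia.
assert (EQ : Cpowz q (n - Z.of_nat m) = Cpowz q n / q ^ m).
{ unfold Z.sub. now rewrite Cpowz_add, Cpowz_opp_of_nat. }
assert (Nx : qprod q (x * Cpowz q (n - Z.of_nat m)) m <> 0).
{ apply off_lattice_qprod; [auto|now apply off_lattice_mult]. }
assert (Ny : qprod q (y * Cpowz q (n - Z.of_nat m)) m <> 0).
{ apply off_lattice_qprod; [auto|now apply off_lattice_mult]. }
assert (Px := qpoch_neq0 q x (n - Z.of_nat m) Hq Hx).
assert (Py := qpoch_neq0 q y (n - Z.of_nat m) Hq Hy).
rewrite Ex, Ey. rewrite EQ in Nx, Ny |- *.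
destruct Hx as [Hx0 Hx]. destruct Hy as [Hy0 Hy].
assert (R := qprod_reverse q (x * Cpowz q n) (y * Cpowz q n) m Hq0
  (Cmult_neq_0 _ _ Hx0 Hn) (Cmult_neq_0 _ _ Hy0 Hn)).
replace (x * Cpowz q n / q ^ m) with (x * (Cpowz q n / q ^ m)) in R
  by (field; auto).
replace (y * Cpowz q n / q ^ m) with (y * (Cpowz q n / q ^ m)) in R
  by (field; auto).
assert (E1 : forall t : C, t <> 0 -> q / (t * Cpowz q n) = Cpowz q (1 - n) / t).
{ intros t Ht. unfold Z.sub. rewrite Cpowz_add, Cpowz_opp, Cpowz_1 by auto.
  field. auto. }
rewrite !E1 in R by auto. rewrite !Cpow_mult_l in R.
assert (Q : qprod q (Cpowz q (1 - n) / x) m <> 0).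
{ apply off_lattice_qprod; [auto|]. unfold Cdiv. rewrite Cmult_comm.
  apply off_lattice_mult, off_lattice_inv; auto. now split. }
assert (D : (y / x) ^ m = y ^ m / x ^ m).
{ unfold Cdiv. rewrite Cpow_mult_l, Cpow_inv by auto. reflexivity. }
rewrite D.
assert (Hxm := Cpow_nz x m Hx0). assert (Hnm := Cpow_nz _ m Hn).
set (A := qprod q (x * (Cpowz q n / q ^ m)) m) in *.
set (B := qprod q (y * (Cpowz q n / q ^ m)) m) in *.
set (U := qprod q (Cpowz q (1 - n) / x) m) in *.
set (V := qprod q (Cpowz q (1 - n) / y) m) in *.
assert (R' : A * (y ^ m * V) = B * (x ^ m * U)).
{ replace (A * (y ^ m * V))
    with (A * (y ^ m * Cpowz q n ^ m * V) / Cpowz q n ^ m) by (field; auto).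
  rewrite R. field. auto. }
transitivity (qpoch q x (n - Z.of_nat m) / qpoch q y (n - Z.of_nat m) *
  (A * (y ^ m * V)) / (B * (x ^ m * U))); [rewrite R'|]; field; auto.
Qed.

(** * The nonterminating 6-phi-5 sum *)

Definition total (u : nat -> C) : C :=
  iota (T := C_CompleteNormedModule) (has_sum u).

Lemma total_eq (u : nat -> C) (l : C) : has_sum u l -> total u = l.
Proof.
intros H. unfold total.
apply (iota_unique (K := C_AbsRing) (V := C_CompleteNormedModule)
  (has_sum u) l); [|exact H].
intros y Hy. exact (has_sum_unique u y l Hy H).
Qed.

Lemma total_has_sum (K r : R) (u : nat -> C) :
  (0 <= r < 1)%R -> geom_bounded K r u -> has_sum u (total u).
Proof.
intros Hr Hu. destruct (ex_has_sum K r u Hr Hu) as [l Hl].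
now rewrite (total_eq u l Hl).
Qed.

(** The index type is free: with pairs of a family index and a summation index, one bound covers a
    whole family of series. *)
Definition bounded {I : Type} (u : I -> C) : Prop :=
  exists K : R, forall i, (Cmod (u i) <= K)%R.

Lemma bounded_const (I : Type) (c : C) : bounded (fun _ : I => c).
Proof. exists (Cmod c). intros _. apply Rle_refl. Qed.

Lemma bounded_mult (I : Type) (u v : I -> C) :
  bounded u -> bounded v -> bounded (fun i => u i * v i).
Proof.
intros [K HK] [L HL]. exists (K * L)%R. intros i. rewrite Cmod_mult.
apply Rmult_le_compat; auto; apply Cmod_ge_0.
Qed.

Lemma bounded_minus (I : Type) (u v : I -> C) :
  bounded u -> bounded v -> bounded (fun i => u i - v i).
Proof.
intros [K HK] [L HL]. exists (K + L)%R. intros i.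
eapply Rle_trans; [apply Cmod_triangle|]. rewrite Cmod_opp.
apply Rplus_le_compat; auto.
Qed.

Lemma bounded_qpow (I : Type) (q : C) (n : I -> nat) :
  (Cmod q < 1)%R -> bounded (fun i => q ^ n i).
Proof.
intros Hq. exists 1%R. intros i. now apply Cmod_qpow_le1.
Qed.

Lemma bounded_qprod (I : Type) (q : C) (x : I -> C) (n : I -> nat) :
  (Cmod q < 1)%R -> bounded x -> bounded (fun i => qprod q (x i) (n i)).
Proof.
intros Hq [K HK]. exists (exp (K / (1 - Cmod q))). intros i.
eapply Rle_trans; [now apply qprod_bound|]. now apply exp_div_le.
Qed.

Lemma bounded_qinf (I : Type) (q : C) (x : I -> C) :
  (Cmod q < 1)%R -> bounded x -> bounded (fun i => qinf q (x i)).
Proof.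
intros Hq [K HK]. exists (exp (K / (1 - Cmod q))). intros i.
eapply Rle_trans; [now apply qinf_bound|]. now apply exp_div_le.
Qed.

Ltac bounded_tac :=
  repeat first
    [ apply bounded_const
    | apply bounded_qpow; assumption
    | apply bounded_qprod; [assumption|]
    | apply bounded_qinf; [assumption|]
    | apply bounded_mult
    | apply bounded_minus ].

Ltac climit_tac :=
  repeat first
    [ assumption
    | apply climit_const
    | apply climit_qprod
    | apply climit_qinf; [assumption|]
    | apply climit_minus
    | apply climit_mult ].

(* The term of the nonterminating 6-phi-5, cleared of its denominators by the
   factors (q;q)_oo, (aq/b;q)_oo, (aq/c;q)_oo, (aq/d;q)_oo. *)
Definition phi65_term (q a b c d w : C) (m : nat) : C :=
  (1 - a * q ^ m * q ^ m) *
  (qprod q a m * qprod q b m * qprod q c m * qprod q d m) *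
  (qinf q (q * q ^ m) * qinf q (a * q / b * q ^ m) *
   qinf q (a * q / c * q ^ m) * qinf q (a * q / d * q ^ m)) * w ^ m.

Lemma qprod_q_head (q a : C) (m : nat) :
  (1 - a) * qprod q (a * q) m = qprod q a m * (1 - a * q ^ m).
Proof. rewrite <- qprod_head. reflexivity. Qed.

Lemma qinf_qpow_step (q x : C) (m : nat) :
  (Cmod q < 1)%R ->
  qinf q (x * q ^ m) = (1 - x * q ^ m) * qinf q (x * q * q ^ m).
Proof.
intros Hq. rewrite (qinf_step q (x * q ^ m) Hq). do 2 f_equal. ring.
Qed.

(** The combination of the terms for a and aq is the increment of the right-hand side, whose factor
    (q^M;q)_oo vanishes at M = 0. The relation w = aq/(bcd) is kept by the simultaneous shift w ->
    wq. *)
Lemma phi65_telescope (q a b c d w : C) (M : nat) :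
  (Cmod q < 1)%R -> a <> 0 -> b <> 0 -> c <> 0 -> d <> 0 ->
  w = a * q / (b * c * d) ->
  psum (fun m => (1 - w) * phi65_term q a b c d w m -
    (1 - a) * (1 - a * q / (b * c)) * (1 - a * q / (b * d)) *
    (1 - a * q / (c * d)) * phi65_term q (a * q) b c d (w * q) m) M =
  - ((1 - a * w * q ^ M) *
  (qprod q a M * qprod q b M * qprod q c M * qprod q d M) *
  (qinf q (q ^ M) * qinf q (a * q / b * q ^ M) *
   qinf q (a * q / c * q ^ M) * qinf q (a * q / d * q ^ M)) * w ^ M).
Proof.
intros Hq Ha Hb Hc Hd Hw. induction M as [|M IH].
- simpl. rewrite qinf_1 by auto. ring.
- simpl psum. rewrite IH. unfold phi65_term.
  rewrite Cpow_mult_l.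
  replace (q ^ S M) with (q * q ^ M) by reflexivity.
  replace (w ^ S M) with (w * w ^ M) by reflexivity.
  replace (qinf q (q ^ M)) with ((1 - q ^ M) * qinf q (q * q ^ M))
    by (rewrite (qinf_step q (q ^ M) Hq); do 2 f_equal; ring).
  replace (a * q * q / b) with (a * q / b * q) by (field; auto).
  replace (a * q * q / c) with (a * q / c * q) by (field; auto).
  replace (a * q * q / d) with (a * q / d * q) by (field; auto).
  rewrite (qinf_qpow_step q (a * q / b) M Hq).
  rewrite (qinf_qpow_step q (a * q / c) M Hq).
  rewrite (qinf_qpow_step q (a * q / d) M Hq).
  replace (a * q / b * (q * q ^ M)) with (a * q / b * q * q ^ M) by ring.
  replace (a * q / c * (q * q ^ M)) with (a * q / c * q * q ^ M) by ring.
  replace (a * q / d * (q * q ^ M)) with (a * q / d * q * q ^ M) by ring.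
  set (Xb := qinf q (a * q / b * q * q ^ M)).
  set (Xc := qinf q (a * q / c * q * q ^ M)).
  set (Xd := qinf q (a * q / d * q * q ^ M)).
  set (Xq := qinf q (q * q ^ M)).
  simpl qprod.
  assert (E := qprod_q_head q a M).
  set (Ya := qprod q a M) in *. set (Yb := qprod q b M).
  set (Yc := qprod q c M). set (Yd := qprod q d M). set (x := q ^ M) in *.
  set (W := w ^ M). set (Y := qprod q (a * q) M) in *.
  set (K := (1 - a * q / (b * c)) * (1 - a * q / (b * d)) * (1 - a * q / (c * d))).
  (* All infinite products now have the arguments belonging to M + 1. Once [E] turns (1-a)(aq;q)_M
     into (a;q)_M (1 - a q^M), both sides share their products and a rational identity in x = q^M
     remains. *)
  transitivity (- ((1 - a * w * x) * (Ya * Yb * Yc * Yd) *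
    ((1 - x) * Xq * ((1 - a * q / b * x) * Xb) * ((1 - a * q / c * x) * Xc) *
    ((1 - a * q / d * x) * Xd)) * W) + ((1 - w) *
    ((1 - a * x * x) * (Ya * Yb * Yc * Yd) * (Xq * ((1 - a * q / b * x) * Xb) *
    ((1 - a * q / c * x) * Xc) * ((1 - a * q / d * x) * Xd)) * W) -
    K * ((1 - a * q * x * x) * (((1 - a) * Y) * Yb * Yc * Yd) *
    (Xq * Xb * Xc * Xd) * (W * x)))).
  { unfold K. ring. }
  rewrite E. unfold K. rewrite Hw. field. auto.
Qed.

Lemma phi65_term_bounded (q a b c d w : C) :
  (0 < Cmod q < 1)%R ->
  exists K : R, forall N, geom_bounded K (Cmod w)
    (phi65_term q (a * q ^ N) b c d (w * q ^ N)).
Proof.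
intros [Hq0 Hq].
assert (B : bounded (fun i : nat * nat =>
  (1 - a * q ^ fst i * q ^ snd i * q ^ snd i) *
  (qprod q (a * q ^ fst i) (snd i) * qprod q b (snd i) * qprod q c (snd i) *
   qprod q d (snd i)) *
  (qinf q (q * q ^ snd i) * qinf q (a * q ^ fst i * q * / b * q ^ snd i) *
   qinf q (a * q ^ fst i * q * / c * q ^ snd i) *
   qinf q (a * q ^ fst i * q * / d * q ^ snd i)))).
{ bounded_tac. }
destruct B as [K HK]. exists K. intros N m. unfold phi65_term.
rewrite Cmod_mult. specialize (HK (N, m)). simpl in HK.
apply Rmult_le_compat; try apply Cmod_ge_0; [exact HK|].
rewrite Cmod_pow. apply pow_incr.
split; [apply Cmod_ge_0|now apply Cmod_mult_qpow_le].
Qed.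

Lemma climit_bounded_mult_0 (u v : nat -> C) :
  bounded u -> climit v 0 -> climit (fun n => u n * v n) 0.
Proof.
intros [K HK] H eps Heps.
assert (HK0 : (0 <= K)%R) by (eapply Rle_trans; [apply (Cmod_ge_0 (u 0%nat))|auto]).
destruct (H (eps / (K + 1))%R) as [N HN]; [apply Rdiv_lt_0_compat; lra|].
exists N. intros n Hn. specialize (HN n Hn). specialize (HK n).
replace (u n * v n - 0) with (u n * v n) by ring.
replace (v n - 0) with (v n) in HN by ring.
rewrite Cmod_mult. apply Rlt_div_r in HN; [|lra].
assert (H0 := Cmod_ge_0 (v n)). nra.
Qed.

Lemma phi65_term_has_sum (q a b c d w : C) (N : nat) :
  (0 < Cmod q < 1)%R -> (Cmod w < 1)%R ->
  has_sum (phi65_term q (a * q ^ N) b c d (w * q ^ N))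
    (total (phi65_term q (a * q ^ N) b c d (w * q ^ N))).
Proof.
intros Hq Hw. destruct (phi65_term_bounded q a b c d w Hq) as [K HK].
apply (total_has_sum K (Cmod w)); [|apply HK].
split; [apply Cmod_ge_0|auto].
Qed.

Lemma phi65_step (q a b c d w : C) :
  (0 < Cmod q < 1)%R -> a <> 0 -> b <> 0 -> c <> 0 -> d <> 0 ->
  w = a * q / (b * c * d) -> (Cmod w < 1)%R ->
  (1 - w) * total (phi65_term q a b c d w) =
  (1 - a) * (1 - a * q / (b * c)) * (1 - a * q / (b * d)) *
  (1 - a * q / (c * d)) * total (phi65_term q (a * q) b c d (w * q)).
Proof.
intros Hq Ha Hb Hc Hd Hw Hw1. assert (Hq1 : (Cmod q < 1)%R) by lra.
assert (T := fun M => phi65_telescope q a b c d w M Hq1 Ha Hb Hc Hd Hw).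
set (k := (1 - a) * (1 - a * q / (b * c)) * (1 - a * q / (b * d)) *
  (1 - a * q / (c * d))) in *.
assert (S0 := phi65_term_has_sum q a b c d w 0 Hq Hw1).
assert (S1 := phi65_term_has_sum q a b c d w 1 Hq Hw1).
simpl in S0, S1. repeat rewrite Cmult_1_r in S0. repeat rewrite Cmult_1_r in S1.
apply climit_unique with (psum (fun m => (1 - w) * phi65_term q a b c d w m +
  k * phi65_term q (a * q) b c d (w * q) m -
  k * phi65_term q (a * q) b c d (w * q) m)).
- apply climit_ext with (psum (fun m => (1 - w) * phi65_term q a b c d w m)).
  + intros M. apply psum_ext. intros m. ring.
  + now apply has_sum_scal.
- set (G := fun M : nat => - ((1 - a * w * q ^ M) *
    (qprod q a M * qprod q b M * qprod q c M * qprod q d M) *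
    (qinf q (q ^ M) * qinf q (a * q / b * q ^ M) *
     qinf q (a * q / c * q ^ M) * qinf q (a * q / d * q ^ M)) * w ^ M)) in *.
  assert (HG : climit G 0).
  (* A bounded factor times w^M. The sign is written as a difference from 0 because [bounded_tac]
     splits products and differences only. *)
  { apply climit_ext with (fun M => ((0 - (1 - a * w * q ^ M)) *
      (qprod q a M * qprod q b M * qprod q c M * qprod q d M) *
      (qinf q (q ^ M) * qinf q (a * q / b * q ^ M) *
       qinf q (a * q / c * q ^ M) * qinf q (a * q / d * q ^ M))) * w ^ M).
    { intros M. unfold G. ring. }
    apply (climit_bounded_mult_0 _ (fun M => w ^ M)); [|now apply climit_qpow].
    bounded_tac. }
  replace (k * total (phi65_term q (a * q) b c d (w * q)))
    with (0 + k * total (phi65_term q (a * q) b c d (w * q))) by ring.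
  apply climit_ext with (fun M => G M +
    psum (fun m => k * phi65_term q (a * q) b c d (w * q) m) M).
  + intros M. unfold G. rewrite <- T, <- psum_plus. apply psum_ext. intros m. ring.
  + apply climit_plus; [exact HG|]. now apply has_sum_scal.
Qed.

(* Iterating a -> a q lets the argument w q^N tend to 0, where only the
   term m = 0 survives. *)
Lemma has_sum_phi65 (q a b c d w : C) :
  (0 < Cmod q < 1)%R -> a <> 0 -> b <> 0 -> c <> 0 -> d <> 0 ->
  w = a * q / (b * c * d) -> (Cmod w < 1)%R ->
  has_sum (phi65_term q a b c d w)
    (qinf q q * qinf q a * qinf q (a * q / (b * c)) * qinf q (a * q / (b * d)) *
     qinf q (a * q / (c * d)) / qinf q w).
Proof.
intros Hq Ha Hb Hc Hd Hw Hw1.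
assert (Hq0 := q_neq0 q Hq). assert (Hq1 : (Cmod q < 1)%R) by lra.
assert (Hw0 := Cmod_ge_0 w).
destruct (phi65_term_bounded q a b c d w Hq) as [K HK].
set (S := fun N => total (phi65_term q (a * q ^ N) b c d (w * q ^ N))).
assert (Hstep : forall N, qprod q w N * S 0%nat =
  qprod q a N * qprod q (a * q / (b * c)) N * qprod q (a * q / (b * d)) N *
  qprod q (a * q / (c * d)) N * S N).
{ induction N as [|N IH]; [simpl; ring|].
  assert (HN := Cpow_nz q N Hq0).
  assert (T := phi65_step q (a * q ^ N) b c d (w * q ^ N) Hq
    (Cmult_neq_0 _ _ Ha HN) Hb Hc Hd).
  assert (Hw' : w * q ^ N = a * q ^ N * q / (b * c * d))
    by (rewrite Hw; field; auto).
  assert (Hw1' : (Cmod (w * q ^ N) < 1)%R).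
  { eapply Rle_lt_trans; [now apply Cmod_mult_qpow_le|auto]. }
  specialize (T Hw' Hw1').
  replace (a * q ^ N * q / (b * c)) with (a * q / (b * c) * q ^ N) in T
    by (field; auto).
  replace (a * q ^ N * q / (b * d)) with (a * q / (b * d) * q ^ N) in T
    by (field; auto).
  replace (a * q ^ N * q / (c * d)) with (a * q / (c * d) * q ^ N) in T
    by (field; auto).
  replace (a * q ^ N * q) with (a * q ^ Datatypes.S N) in T by (simpl; ring).
  replace (w * q ^ N * q) with (w * q ^ Datatypes.S N) in T by (simpl; ring).
  fold (S N) in T. fold (S (Datatypes.S N)) in T.
  simpl qprod.
  transitivity ((1 - w * q ^ N) * (qprod q w N * S 0%nat)); [ring|].
  rewrite IH.
  transitivity (qprod q a N * qprod q (a * q / (b * c)) N *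
    qprod q (a * q / (b * d)) N * qprod q (a * q / (c * d)) N *
    ((1 - w * q ^ N) * S N)); [ring|].
  rewrite T. ring. }
(* The limiting term carries 0^m, which is 1 at m = 0 and 0 afterwards; |w| is a common ratio for
   all N because |w q^N| <= |w|. *)
assert (HS : climit S (qinf q q)).
{ apply (tannery K (Cmod w)
    (fun N => phi65_term q (a * q ^ N) b c d (w * q ^ N))
    (fun m => qprod q b m * qprod q c m * qprod q d m *
      qinf q (q * q ^ m) * 0 ^ m)).
  - lra.
  - exact HK.
  - intros m. unfold phi65_term.
    replace (qprod q b m * qprod q c m * qprod q d m * qinf q (q * q ^ m) * 0 ^ m)
      with ((1 - a * 0 * q ^ m * q ^ m) *
        (qprod q (a * 0) m * qprod q b m * qprod q c m * qprod q d m) *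
        (qinf q (q * q ^ m) * qinf q (a * 0 * q / b * q ^ m) *
         qinf q (a * 0 * q / c * q ^ m) * qinf q (a * 0 * q / d * q ^ m)) *
        (w * 0) ^ m).
    + assert (HqN := climit_qpow q Hq1).
      apply climit_mult; [|apply climit_pow]; climit_tac.
    + replace (a * 0 * q / b * q ^ m) with (RtoC 0) by (field; auto).
      replace (a * 0 * q / c * q ^ m) with (RtoC 0) by (field; auto).
      replace (a * 0 * q / d * q ^ m) with (RtoC 0) by (field; auto).
      rewrite !Cmult_0_r, qprod_0, qinf_0 by auto. ring.
  - intros N. now apply phi65_term_has_sum.
  - replace (qinf q q) with (qprod q b 0 * qprod q c 0 * qprod q d 0 *
      qinf q (q * q ^ 0) * 0 ^ 0).
    + apply has_sum_first. intros n. simpl. ring.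
    + simpl. rewrite !Cmult_1_r. ring. }
assert (Hqw : qinf q w <> 0) by now apply qinf_small_neq0.
assert (E : qinf q w * S 0%nat = qinf q a * qinf q (a * q / (b * c)) *
  qinf q (a * q / (b * d)) * qinf q (a * q / (c * d)) * qinf q q).
{ apply climit_unique with (fun N => qprod q w N * S 0%nat).
  - apply climit_mult; [now apply climit_qprod_qinf|apply climit_const].
  - apply climit_ext with (fun N => qprod q a N * qprod q (a * q / (b * c)) N *
      qprod q (a * q / (b * d)) N * qprod q (a * q / (c * d)) N * S N).
    { intros N. now rewrite Hstep. }
    repeat apply climit_mult; auto; now apply climit_qprod_qinf. }
assert (S0 := phi65_term_has_sum q a b c d w 0 Hq Hw1). fold (S 0%nat) in S0.
simpl in S0. repeat rewrite Cmult_1_r in S0.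
replace (qinf q q * qinf q a * qinf q (a * q / (b * c)) *
  qinf q (a * q / (b * d)) * qinf q (a * q / (c * d)) / qinf q w)
  with (S 0%nat); [exact S0|].
replace (S 0%nat) with (qinf q w * S 0%nat / qinf q w) by (field; auto).
rewrite E. field. auto.
Qed.

(** * The nonterminating form of Jackson's sum *)

(** The factor (bc/a;q)_oo does not depend on m: it is part of the weight of the first series in the
    two-term sum. For the companion it becomes (c;q)_oo, since b (bc/a) / (b^2/a) = c. *)
Definition jackson_factor (q a b c : C) (m : nat) : C :=
  qprod q c m * qinf q (a * q / c * q ^ m) * qinf q (b * c / a).

(* The term of a balanced nonterminating 8-phi-7 (argument q), cleared of
   denominators; the companion series is the one with the parameters
   [b^2/a; b, bc/a, bd/a, be/a, bf/a]. *)
Definition jackson_term (q a b c d e f : C) (m : nat) : C :=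
  (1 - a * q ^ m * q ^ m) * (qprod q a m * qprod q b m) *
  (qinf q (q * q ^ m) * qinf q (a * q / b * q ^ m)) *
  (jackson_factor q a b c m * jackson_factor q a b d m *
   jackson_factor q a b e m * jackson_factor q a b f m) * q ^ m.

(** The shift multiplies a, b, c by q and keeps the balancing condition. In the boundary term
    (bq;q)_M and (cq;q)_M stand for (b;q)_{M+1}/(1-b) and (c;q)_{M+1}/(1-c), which would require
    division for an empty sum; the sum is therefore taken over at least one term and the base case
    is a separate identity. *)
Lemma jackson_telescope (q a b c d e f : C) (M : nat) :
  (0 < Cmod q < 1)%R ->
  a <> 0 -> b <> 0 -> c <> 0 -> d <> 0 -> e <> 0 -> f <> 0 ->
  a ^ 2 * q = b * c * d * e * f ->
  psum (fun m => jackson_term q a b c d e f m -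
    (1 - a) * ((1 - a * q / (d * e)) * (1 - a * q / (d * f)) *
    (1 - a * q / (e * f))) * jackson_term q (a * q) (b * q) (c * q) d e f m)
    (S M) =
  - (b * c / a * (1 - b * c * q ^ S M) * qinf q (q ^ S M) *
  (qprod q (b * q) M * qprod q (c * q) M * qprod q d (S M) * qprod q e (S M) *
   qprod q f (S M) * qprod q a (S M)) *
  (qinf q (a / b * q ^ S M) * qinf q (a / c * q ^ S M) *
   qinf q (a * q / d * q ^ S M) * qinf q (a * q / e * q ^ S M) *
   qinf q (a * q / f * q ^ S M)) *
  (qinf q (b * c / a * q) * qinf q (b * d / a) * qinf q (b * e / a) *
   qinf q (b * f / a))).
Proof.
intros Hq Ha Hb Hc Hd He Hf Hbal. assert (Hq0 := q_neq0 q Hq).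
assert (Hq1 : (Cmod q < 1)%R) by lra.
assert (Ef : f = a ^ 2 * q / (b * c * d * e)).
{ rewrite Hbal. field. auto. }
set (k := (1 - a * q / (d * e)) * (1 - a * q / (d * f)) *
  (1 - a * q / (e * f))).
assert (Hterm : forall m, jackson_term q a b c d e f m =
  (1 - a * q ^ m * q ^ m) * (qprod q a m * qprod q b m) *
  (qinf q (q * q ^ m) * qinf q (a * q / b * q ^ m)) *
  (qprod q c m * qinf q (a * q / c * q ^ m) *
     ((1 - b * c / a) * qinf q (b * c / a * q)) *
   (qprod q d m * ((1 - a * q / d * q ^ m) * qinf q (a * q / d * q * q ^ m)) *
    qinf q (b * d / a)) *
   (qprod q e m * ((1 - a * q / e * q ^ m) * qinf q (a * q / e * q * q ^ m)) *
    qinf q (b * e / a)) *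
   (qprod q f m * ((1 - a * q / f * q ^ m) * qinf q (a * q / f * q * q ^ m)) *
    qinf q (b * f / a))) * q ^ m).
{ intros m. unfold jackson_term, jackson_factor.
  rewrite (qinf_qpow_step q (a * q / d) m Hq1), (qinf_qpow_step q (a * q / e) m Hq1),
    (qinf_qpow_step q (a * q / f) m Hq1), (qinf_step q (b * c / a) Hq1).
  reflexivity. }
assert (Hterm' : forall m, (1 - a) * jackson_term q (a * q) (b * q) (c * q) d e f m =
  (1 - a * q * q ^ m * q ^ m) *
  (qprod q a m * (1 - a * q ^ m) * qprod q (b * q) m) *
  (qinf q (q * q ^ m) * qinf q (a * q / b * q ^ m)) *
  (qprod q (c * q) m * qinf q (a * q / c * q ^ m) * qinf q (b * c / a * q) *
   (qprod q d m * qinf q (a * q / d * q * q ^ m) * qinf q (b * d / a)) *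
   (qprod q e m * qinf q (a * q / e * q * q ^ m) * qinf q (b * e / a)) *
   (qprod q f m * qinf q (a * q / f * q * q ^ m) * qinf q (b * f / a))) * q ^ m).
{ intros m. unfold jackson_term, jackson_factor. rewrite <- qprod_q_head.
  replace (a * q * q / (b * q)) with (a * q / b) by (field; auto).
  replace (a * q * q / (c * q)) with (a * q / c) by (field; auto).
  replace (b * q * (c * q) / (a * q)) with (b * c / a * q) by (field; auto).
  replace (a * q * q / d) with (a * q / d * q) by (field; auto).
  replace (a * q * q / e) with (a * q / e * q) by (field; auto).
  replace (a * q * q / f) with (a * q / f * q) by (field; auto).
  replace (b * q * d / (a * q)) with (b * d / a) by (field; auto).
  replace (b * q * e / (a * q)) with (b * e / a) by (field; auto).
  replace (b * q * f / (a * q)) with (b * f / a) by (field; auto).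
  ring. }
assert (Hab : forall m, a / b * q ^ S m = a * q / b * q ^ m)
  by (intros m; simpl; field; auto).
assert (Hac : forall m, a / c * q ^ S m = a * q / c * q ^ m)
  by (intros m; simpl; field; auto).
assert (Had : forall m, a * q / d * q ^ S m = a * q / d * q * q ^ m)
  by (intros m; simpl; ring).
assert (Hae : forall m, a * q / e * q ^ S m = a * q / e * q * q ^ m)
  by (intros m; simpl; ring).
assert (Haf : forall m, a * q / f * q ^ S m = a * q / f * q * q ^ m)
  by (intros m; simpl; ring).
induction M as [|M IH].
- simpl psum. rewrite Hterm.
  replace ((1 - a) * k * jackson_term q (a * q) (b * q) (c * q) d e f 0)
    with (k * ((1 - a) * jackson_term q (a * q) (b * q) (c * q) d e f 0)) by ring.
  rewrite Hterm', Hab, Hac, Had, Hae, Haf. simpl. rewrite !Cmult_1_r.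
  repeat rewrite Cmult_1_r.
  (* The balancing condition enters only through [Ef], here and in the corresponding identity of the
     inductive step. *)
  assert (I : (1 - b * c / a) * ((1 - a * q / d) * (1 - a * q / e) *
      (1 - a * q / f)) - k * (1 - a * q) =
      - (b * c / a * (1 - b * c * q) * ((1 - d) * (1 - e) * (1 - f)))).
  { unfold k. rewrite Ef. field. repeat split; auto. }
  match type of I with ?L = _ => transitivity (L * ((1 - a) * qinf q q *
      qinf q (a * q / b) * qinf q (a * q / c) * qinf q (a * q / d * q) *
      qinf q (a * q / e * q) * qinf q (a * q / f * q) * qinf q (b * c / a * q) *
      qinf q (b * d / a) * qinf q (b * e / a) * qinf q (b * f / a)));
    [ring|rewrite I; ring] end.
- set (F := fun m => jackson_term q a b c d e f m -
    (1 - a) * k * jackson_term q (a * q) (b * q) (c * q) d e f m) in *.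
  change (psum F (S (S M))) with (psum F (S M) + F (S M)). rewrite IH.
  unfold F. rewrite Hterm.
  replace ((1 - a) * k * jackson_term q (a * q) (b * q) (c * q) d e f (S M))
    with (k * ((1 - a) * jackson_term q (a * q) (b * q) (c * q) d e f (S M)))
    by ring.
  rewrite Hterm'. rewrite !(Hab (S M)), !(Hac (S M)), !(Had (S M)), !(Hae (S M)),
    !(Haf (S M)).
  rewrite (qinf_qpow_step q (a / b) (S M) Hq1).
  rewrite (qinf_qpow_step q (a / c) (S M) Hq1).
  rewrite (qinf_qpow_step q (a * q / d) (S M) Hq1).
  rewrite (qinf_qpow_step q (a * q / e) (S M) Hq1).
  rewrite (qinf_qpow_step q (a * q / f) (S M) Hq1).
  rewrite (qinf_step q (q ^ S M) Hq1).
  replace (a / b * q) with (a * q / b) by (field; auto).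
  replace (a / c * q) with (a * q / c) by (field; auto).
  rewrite (qprod_head q b M), (qprod_head q c M).
  change (qprod q (b * q) (S M)) with (qprod q (b * q) M * (1 - b * q * q ^ M)).
  change (qprod q (c * q) (S M)) with (qprod q (c * q) M * (1 - c * q * q ^ M)).
  change (qprod q a (S (S M))) with (qprod q a (S M) * (1 - a * q ^ S M)).
  change (qprod q d (S (S M))) with (qprod q d (S M) * (1 - d * q ^ S M)).
  change (qprod q e (S (S M))) with (qprod q e (S M) * (1 - e * q ^ S M)).
  change (qprod q f (S (S M))) with (qprod q f (S M) * (1 - f * q ^ S M)).
  replace (b * q * q ^ M) with (b * q ^ S M) by (simpl; ring).
  replace (c * q * q ^ M) with (c * q ^ S M) by (simpl; ring).
  replace (q ^ S M * q) with (q * q ^ S M) by ring.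
  replace (q ^ S (S M)) with (q * q ^ S M) by reflexivity.
  set (X := q ^ S M).
  set (Ya := qprod q a (S M)). set (Yb := qprod q (b * q) M).
  set (Yc := qprod q (c * q) M). set (Yd := qprod q d (S M)).
  set (Ye := qprod q e (S M)). set (Yf := qprod q f (S M)).
  set (Xq := qinf q (q * X)). set (Xb := qinf q (a * q / b * X)).
  set (Xc := qinf q (a * q / c * X)). set (Xd := qinf q (a * q / d * q * X)).
  set (Xe := qinf q (a * q / e * q * X)). set (Xf := qinf q (a * q / f * q * X)).
  set (Z1 := qinf q (b * c / a * q)). set (Z2 := qinf q (b * d / a)).
  set (Z3 := qinf q (b * e / a)). set (Z4 := qinf q (b * f / a)).
  assert (I : - (b * c / a * (1 - b * c * X) * (1 - X) * ((1 - a / b * X) *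
      (1 - a / c * X) * (1 - a * q / d * X) * (1 - a * q / e * X) *
      (1 - a * q / f * X))) + (X * ((1 - a * X * X) * (1 - b) * (1 - c) *
      (1 - b * c / a) * ((1 - a * q / d * X) * (1 - a * q / e * X) *
      (1 - a * q / f * X))) - X * (k * ((1 - a * q * X * X) * (1 - a * X) *
      (1 - b * X) * (1 - c * X)))) =
      - (b * c / a * (1 - b * c * (q * X)) * ((1 - a * X) * (1 - b * X) *
      (1 - c * X) * (1 - d * X) * (1 - e * X) * (1 - f * X)))).
  { unfold k. rewrite Ef. field. repeat split; auto. }
  match type of I with ?L = _ => transitivity (L * (Ya * Yb * Yc * Yd * Ye *
      Yf * Xq * Xb * Xc * Xd * Xe * Xf * Z1 * Z2 * Z3 * Z4));
    [ring|rewrite I; ring] end.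
Qed.

(** The parameters are families so that one majorant serves along the iteration. The quotients aq/b,
    bc/a, ... are bounded by hypothesis because a itself may tend to 0. *)
Lemma jackson_term_bounded (I : Type) (q : C) (a b c d e f : I -> C) :
  (Cmod q < 1)%R -> bounded a -> bounded b -> bounded c -> bounded d ->
  bounded e -> bounded f ->
  bounded (fun i : I => a i * q / b i) -> bounded (fun i : I => a i * q / c i) ->
  bounded (fun i : I => a i * q / d i) -> bounded (fun i : I => a i * q / e i) ->
  bounded (fun i : I => a i * q / f i) ->
  bounded (fun i : I => b i * c i / a i) -> bounded (fun i : I => b i * d i / a i) ->
  bounded (fun i : I => b i * e i / a i) -> bounded (fun i : I => b i * f i / a i) ->
  exists K : R, forall i, geom_bounded K (Cmod q)
    (jackson_term q (a i) (b i) (c i) (d i) (e i) (f i)).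
Proof.
intros Hq Ha Hb Hc Hd He Hf Hab Hac Had Hae Haf Hbc Hbd Hbe Hbf.
assert (lift : forall u : I -> C, bounded u ->
  bounded (fun p : I * nat => u (fst p))).
{ intros u [K HK]. exists K. intros p. apply HK. }
assert (B : bounded (fun p : I * nat => let i := fst p in let m := snd p in
  (1 - a i * q ^ m * q ^ m) * (qprod q (a i) m * qprod q (b i) m) *
  (qinf q (q * q ^ m) * qinf q (a i * q / b i * q ^ m)) *
  (jackson_factor q (a i) (b i) (c i) m * jackson_factor q (a i) (b i) (d i) m *
   jackson_factor q (a i) (b i) (e i) m * jackson_factor q (a i) (b i) (f i) m))).
{ apply lift in Ha, Hb, Hc, Hd, He, Hf, Hab, Hac, Had, Hae, Haf, Hbc, Hbd, Hbe, Hbf.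
  unfold jackson_factor. cbv zeta.
  repeat first [ assumption | apply bounded_const | apply bounded_qpow; assumption
    | apply bounded_qprod; [assumption|] | apply bounded_qinf; [assumption|]
    | apply bounded_mult | apply bounded_minus ]. }
destruct B as [K HK]. exists K. intros i m. unfold jackson_term.
rewrite Cmod_mult, Cmod_pow. apply Rmult_le_compat_r.
- apply pow_le, Cmod_ge_0.
- exact (HK (i, m)).
Qed.

Lemma jackson_term_has_sum (q a b c d e f : C) :
  (0 < Cmod q < 1)%R ->
  has_sum (jackson_term q a b c d e f) (total (jackson_term q a b c d e f)).
Proof.
intros Hq.
destruct (jackson_term_bounded unit q (fun _ => a) (fun _ => b) (fun _ => c)
  (fun _ => d) (fun _ => e) (fun _ => f)) as [K HK];
  try apply bounded_const; [lra|].
apply (total_has_sum K (Cmod q)); [lra|exact (HK tt)].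
Qed.

Lemma climit_S (u : nat -> C) (l : C) :
  climit u l -> climit (fun n => u (S n)) l.
Proof. intros H. apply (climit_comp u l S); auto. Qed.

(** Unlike for the 6-phi-5, the boundary term has no decaying factor: each product with argument
    proportional to q^M tends to 1 and the others to infinite products, so the recursion is
    inhomogeneous. *)
Lemma jackson_total_step (q a b c d e f : C) :
  (0 < Cmod q < 1)%R ->
  a <> 0 -> b <> 0 -> c <> 0 -> d <> 0 -> e <> 0 -> f <> 0 ->
  a ^ 2 * q = b * c * d * e * f ->
  total (jackson_term q a b c d e f) =
  (1 - a) * ((1 - a * q / (d * e)) * (1 - a * q / (d * f)) *
    (1 - a * q / (e * f))) *
    total (jackson_term q (a * q) (b * q) (c * q) d e f) -
  b * c / a * qinf q a * (qinf q (b * q) * qinf q (c * q) *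
    qinf q d * qinf q e * qinf q f * (qinf q (b * c / a * q) *
    qinf q (b * d / a) * qinf q (b * e / a) * qinf q (b * f / a))).
Proof.
intros Hq Ha Hb Hc Hd He Hf Hbal. assert (Hq1 : (Cmod q < 1)%R) by lra.
assert (T := fun M => jackson_telescope q a b c d e f M Hq Ha Hb Hc Hd He Hf Hbal).
set (k := (1 - a) * ((1 - a * q / (d * e)) * (1 - a * q / (d * f)) *
    (1 - a * q / (e * f)))) in *.
assert (S0 := jackson_term_has_sum q a b c d e f Hq).
assert (S1 := jackson_term_has_sum q (a * q) (b * q) (c * q) d e f Hq).
set (s0 := total (jackson_term q a b c d e f)) in *.
set (s1 := total (jackson_term q (a * q) (b * q) (c * q) d e f)) in *.
set (L := - (b * c / a * (1 - b * c * 0) * qinf q 0 *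
  (qinf q (b * q) * qinf q (c * q) * qinf q d * qinf q e *
   qinf q f * qinf q a) *
  (qinf q (a / b * 0) * qinf q (a / c * 0) *
   qinf q (a * q / d * 0) * qinf q (a * q / e * 0) *
   qinf q (a * q / f * 0)) *
  (qinf q (b * c / a * q) * qinf q (b * d / a) * qinf q (b * e / a) *
   qinf q (b * f / a)))).
assert (E : s0 - k * s1 = L).
{ apply climit_unique with (fun M => psum (fun m => jackson_term q a b c d e f m -
    k * jackson_term q (a * q) (b * q) (c * q) d e f m) (S M)).
  - apply (climit_S (psum (fun m => jackson_term q a b c d e f m -
      k * jackson_term q (a * q) (b * q) (c * q) d e f m))).
    replace (s0 - k * s1) with (s0 + - k * s1) by ring.
    apply (has_sum_ext (fun m => jackson_term q a b c d e f m +
      - k * jackson_term q (a * q) (b * q) (c * q) d e f m)).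
    + intros m. ring.
    + apply has_sum_plus; [exact S0|]. now apply has_sum_scal.
  - eapply climit_ext. { intros M. symmetry. apply T. }
    assert (HqS := climit_S _ _ (climit_qpow q Hq1)).
    unfold L. apply climit_opp.
    repeat first
      [ exact HqS
      | apply climit_const
      | apply (climit_qprod_qinf q _ Hq1)
      | apply (climit_S (qprod q _)), climit_qprod_qinf; exact Hq1
      | apply climit_qinf; [exact Hq1|]
      | apply climit_minus
      | apply climit_mult ]. }
unfold L in E. rewrite !Cmult_0_r in E.
repeat rewrite Cmult_0_r in E. rewrite qinf_0 in E by auto.
replace s0 with (s0 - k * s1 + k * s1) by ring. rewrite E. ring.
Qed.

(** The left side of the two-term summation. The involution (a, b, c, ...) -> (b^2/a, b, bc/a, ...)
    exchanges the two series and multiplies the combination by -a/b. *)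
Definition jackson (q a b c d e f : C) : C :=
  qinf q (b * b / a) * total (jackson_term q a b c d e f) -
  b / a * qinf q a * total (jackson_term q (b * b / a) b (b * c / a)
    (b * d / a) (b * e / a) (b * f / a)).

(* The boundary terms at infinity of the two telescoping sums cancel. *)
Lemma jackson_step (q a b c d e f : C) :
  (0 < Cmod q < 1)%R ->
  a <> 0 -> b <> 0 -> c <> 0 -> d <> 0 -> e <> 0 -> f <> 0 ->
  a ^ 2 * q = b * c * d * e * f ->
  jackson q a b c d e f =
  (1 - a) * (1 - b * b / a) *
  ((1 - a * q / (d * e)) * (1 - a * q / (d * f)) * (1 - a * q / (e * f))) *
  jackson q (a * q) (b * q) (c * q) d e f.
Proof.
intros Hq Ha Hb Hc Hd He Hf Hbal. assert (Hq0 := q_neq0 q Hq).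
assert (Hq1 : (Cmod q < 1)%R) by lra.
unfold jackson.
rewrite (jackson_total_step q a b c d e f) by auto.
rewrite (jackson_total_step q (b * b / a) b (b * c / a) (b * d / a) (b * e / a)
  (b * f / a)); auto; try (apply Cdiv_neq0; auto; apply Cmult_neq_0; auto).
2:{ transitivity (b * b * b * b * (a ^ 2 * q) / (a * a * a * a)).
    - field. auto.
    - rewrite Hbal. field. auto. }
(* The involution fixes aq/(de), aq/(df) and aq/(ef), so both recursions have the same multiplier,
   while c and bc/a change places. *)
replace (b * b / a * q / (b * d / a * (b * e / a))) with (a * q / (d * e))
  by (field; auto).
replace (b * b / a * q / (b * d / a * (b * f / a))) with (a * q / (d * f))
  by (field; auto).
replace (b * b / a * q / (b * e / a * (b * f / a))) with (a * q / (e * f))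
  by (field; auto).
replace (b * (b * c / a) / (b * b / a)) with c by (field; auto).
replace (b * (b * d / a) / (b * b / a)) with d by (field; auto).
replace (b * (b * e / a) / (b * b / a)) with e by (field; auto).
replace (b * (b * f / a) / (b * b / a)) with f by (field; auto).
replace (b * q * (b * q) / (a * q)) with (b * b / a * q) by (field; auto).
replace (b * q * (c * q) / (a * q)) with (b * c / a * q) by (field; auto).
replace (b * q * d / (a * q)) with (b * d / a) by (field; auto).
replace (b * q * e / (a * q)) with (b * e / a) by (field; auto).
replace (b * q * f / (a * q)) with (b * f / a) by (field; auto).
replace (b * q / (a * q)) with (b / a) by (field; auto).
rewrite (qinf_step q a Hq1), (qinf_step q (b * b / a) Hq1).
set (k := (1 - a * q / (d * e)) * (1 - a * q / (d * f)) * (1 - a * q / (e * f))).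
unfold Cdiv. ring.
Qed.

Lemma jackson_term_perm (q a b c d e f : C) (m : nat) :
  jackson_term q a b c d e f m = jackson_term q a b d e f c m.
Proof. unfold jackson_term. ring. Qed.

Lemma total_ext (u v : nat -> C) :
  (forall n, u n = v n) -> has_sum v (total v) -> total u = total v.
Proof.
intros E H. apply total_eq. apply has_sum_ext with v; auto.
Qed.

Lemma jackson_perm (q a b c d e f : C) :
  (0 < Cmod q < 1)%R -> jackson q a b c d e f = jackson q a b d e f c.
Proof.
intros Hq. unfold jackson.
rewrite (total_ext (jackson_term q a b c d e f) (jackson_term q a b d e f c)),
  (total_ext (jackson_term q (b * b / a) b (b * c / a) (b * d / a) (b * e / a)
     (b * f / a)) (jackson_term q (b * b / a) b (b * d / a) (b * e / a) (b * f / a)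
     (b * c / a)));
  auto using jackson_term_perm, jackson_term_has_sum.
Qed.

(** * The limit of the iterated Jackson combination and its value *)

Lemma bounded_ext (I : Type) (u v : I -> C) :
  (forall i, u i = v i) -> bounded u -> bounded v.
Proof. intros E [K HK]. exists K. intros i. rewrite <- E. apply HK. Qed.

Lemma climit_qpow_mult (q : C) (k : nat) :
  (Cmod q < 1)%R -> (0 < k)%nat -> climit (fun n => q ^ (k * n)) 0.
Proof.
intros Hq Hk. apply (climit_comp (fun n => q ^ n) 0 (fun n => (k * n)%nat)).
- now apply climit_qpow.
- intros n. nia.
Qed.

Definition jackson_limit_term (q t : C) (m : nat) : C :=
  qinf q (q * q ^ m) * qinf q (t * q ^ m) * q ^ m.

(** Along the iteration a, b, c, aq/c and bc/a carry the powers q^(4N), q^(4N), q^N, q^(3N) and q^N,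
    while a/b is fixed. Hence only (q^(m+1);q)_oo and (a q^(m+1)/b;q)_oo survive in the m-th
    term. *)
Lemma climit_jackson_total (q a b c d e f : C) :
  (0 < Cmod q < 1)%R ->
  a <> 0 -> b <> 0 -> c <> 0 -> d <> 0 -> e <> 0 -> f <> 0 ->
  climit (fun N => total (jackson_term q (a * q ^ (4 * N)) (b * q ^ (4 * N))
      (c * q ^ N) (d * q ^ N) (e * q ^ N) (f * q ^ N)))
    (total (jackson_limit_term q (a * q / b))).
Proof.
intros Hq Ha Hb Hc Hd He Hf. assert (Hq0 := q_neq0 q Hq).
assert (Hq1 : (Cmod q < 1)%R) by lra.
assert (Eab : forall N, a * q / b = a * q ^ (4 * N) * q / (b * q ^ (4 * N))).
{ intros N. assert (H := Cpow_nz q (4 * N) Hq0). field. auto. }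
assert (Eac : forall (x : C) (N : nat), x <> 0 ->
  a * q / x * q ^ (3 * N) = a * q ^ (4 * N) * q / (x * q ^ N)).
{ intros x N Hx. assert (H := Cpow_nz q N Hq0).
  replace (4 * N)%nat with (3 * N + N)%nat by lia. rewrite Cpow_add_r.
  field. auto. }
assert (Ebc : forall (x : C) (N : nat), b * x / a * q ^ N =
  b * q ^ (4 * N) * (x * q ^ N) / (a * q ^ (4 * N))).
{ intros x N. assert (H := Cpow_nz q (4 * N) Hq0). field. auto. }
destruct (jackson_term_bounded nat q (fun N => a * q ^ (4 * N))
  (fun N => b * q ^ (4 * N)) (fun N => c * q ^ N) (fun N => d * q ^ N)
  (fun N => e * q ^ N) (fun N => f * q ^ N)) as [K HK];
  try (now bounded_tac); auto;
  try (eapply bounded_ext; [intros i; apply Eab|]; bounded_tac);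
  try (eapply bounded_ext; [intros i; apply Eac; assumption|];
    now bounded_tac);
  try (eapply bounded_ext; [intros i; apply Ebc|]; now bounded_tac).
assert (Hlim : forall m, climit (fun N => jackson_term q (a * q ^ (4 * N))
    (b * q ^ (4 * N)) (c * q ^ N) (d * q ^ N) (e * q ^ N) (f * q ^ N) m)
    (jackson_limit_term q (a * q / b) m)).
{ intros m.
  assert (L1 := climit_qpow q Hq1).
  assert (L3 := climit_qpow_mult q 3 Hq1 ltac:(lia)).
  assert (L4 := climit_qpow_mult q 4 Hq1 ltac:(lia)).
  assert (F : forall x : C, x <> 0 -> climit (fun N => jackson_factor q
      (a * q ^ (4 * N)) (b * q ^ (4 * N)) (x * q ^ N) m) 1).
  { intros x Hx.
    replace (RtoC 1) with (qprod q (x * 0) m * qinf q (a * q / x * 0 * q ^ m) *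
      qinf q (b * x / a * 0)).
    - apply climit_ext with (fun N => qprod q (x * q ^ N) m *
        qinf q (a * q / x * q ^ (3 * N) * q ^ m) * qinf q (b * x / a * q ^ N)).
      { intros N. unfold jackson_factor. now rewrite <- Eac, <- Ebc. }
      climit_tac.
    - replace (a * q / x * 0 * q ^ m) with (RtoC 0) by (field; auto).
      rewrite !Cmult_0_r. repeat rewrite Cmult_0_r.
      rewrite qprod_0, qinf_0 by auto. ring. }
  replace (jackson_limit_term q (a * q / b) m) with
    ((1 - a * 0 * q ^ m * q ^ m) * (qprod q (a * 0) m * qprod q (b * 0) m) *
     (qinf q (q * q ^ m) * qinf q (a * q / b * q ^ m)) * (1 * 1 * 1 * 1) * q ^ m).
  - unfold jackson_term.
    apply climit_ext with (fun N => (1 - a * q ^ (4 * N) * q ^ m * q ^ m) *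
      (qprod q (a * q ^ (4 * N)) m * qprod q (b * q ^ (4 * N)) m) *
      (qinf q (q * q ^ m) * qinf q (a * q / b * q ^ m)) *
      (jackson_factor q (a * q ^ (4 * N)) (b * q ^ (4 * N)) (c * q ^ N) m *
       jackson_factor q (a * q ^ (4 * N)) (b * q ^ (4 * N)) (d * q ^ N) m *
       jackson_factor q (a * q ^ (4 * N)) (b * q ^ (4 * N)) (e * q ^ N) m *
       jackson_factor q (a * q ^ (4 * N)) (b * q ^ (4 * N)) (f * q ^ N) m) * q ^ m).
    { intros N. now rewrite <- Eab. }
    apply climit_mult; [|apply climit_const].
    apply climit_mult; [|repeat apply climit_mult; auto].
    climit_tac.
  - unfold jackson_limit_term. rewrite !Cmult_0_r. repeat rewrite Cmult_0_r.
    rewrite !qprod_0. ring. }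
assert (Hb0 : geom_bounded K (Cmod q) (jackson_limit_term q (a * q / b))).
{ intros m. replace (jackson_limit_term q (a * q / b) m)
    with (jackson_limit_term q (a * q / b) m - 0) by ring.
  eapply climit_le; [apply Hlim|]. intros N. cbv beta.
  match goal with |- Rle (Cmod (Cminus ?t ?o)) _ =>
    replace (Cminus t o) with t by ring end.
  apply HK. }
apply (tannery K (Cmod q) (fun N => jackson_term q (a * q ^ (4 * N))
    (b * q ^ (4 * N)) (c * q ^ N) (d * q ^ N) (e * q ^ N) (f * q ^ N))
    (jackson_limit_term q (a * q / b))); auto; try lra.
- intros N. now apply jackson_term_has_sum.
- apply (total_has_sum K (Cmod q)); [lra|auto].
Qed.

(** One shift for each of c, d, e, f in turn. A pair gains a factor in each of the two steps that
    shift neither of its members, which accounts for six products of length 2; each aq/(cd) is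
    multiplied by q^2 in total. *)
Lemma jackson_step4 (q a b c d e f : C) :
  (0 < Cmod q < 1)%R ->
  a <> 0 -> b <> 0 -> c <> 0 -> d <> 0 -> e <> 0 -> f <> 0 ->
  a ^ 2 * q = b * c * d * e * f ->
  jackson q a b c d e f =
  qprod q a 4 * qprod q (b * b / a) 4 *
  (qprod q (a * q / (c * d)) 2 * qprod q (a * q / (c * e)) 2 *
   qprod q (a * q / (c * f)) 2 * qprod q (a * q / (d * e)) 2 *
   qprod q (a * q / (d * f)) 2 * qprod q (a * q / (e * f)) 2) *
  jackson q (a * q ^ 4) (b * q ^ 4) (c * q) (d * q) (e * q) (f * q).
Proof.
intros Hq Ha Hb Hc Hd He Hf Hbal. assert (Hq0 := q_neq0 q Hq).
assert (Ef : f = a ^ 2 * q / (b * c * d * e)).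
{ rewrite Hbal. field. auto. }
rewrite (jackson_step q a b c d e f), (jackson_perm q (a * q)) by auto.
rewrite (jackson_step q (a * q) (b * q) d e f (c * q)); auto using Cmult_neq_0.
2:{ transitivity (a ^ 2 * q * q * q); [ring|]. rewrite Hbal. ring. }
rewrite (jackson_perm q (a * q * q)) by auto.
rewrite (jackson_step q (a * q * q) (b * q * q) e f (c * q) (d * q));
  auto using Cmult_neq_0.
2:{ transitivity (a ^ 2 * q * q * q * q * q); [ring|]. rewrite Hbal. ring. }
rewrite (jackson_perm q (a * q * q * q)) by auto.
rewrite (jackson_step q (a * q * q * q) (b * q * q * q) f (c * q) (d * q) (e * q));
  auto 6 using Cmult_neq_0.
2:{ transitivity (a ^ 2 * q * q * q * q * q * q * q); [ring|]. rewrite Hbal. ring. }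
rewrite (jackson_perm q (a * q * q * q * q)) by auto.
replace (a * q * q * q * q) with (a * q ^ 4) by ring.
replace (b * q * q * q * q) with (b * q ^ 4) by ring.
set (J := jackson q (a * q ^ 4) (b * q ^ 4) (c * q) (d * q) (e * q) (f * q)).
simpl qprod.
replace (b * q * (b * q) / (a * q)) with (b * b / a * q) by (field; auto).
replace (b * q * q * (b * q * q) / (a * q * q)) with (b * b / a * q * q)
  by (field; auto).
replace (b * q * q * q * (b * q * q * q) / (a * q * q * q))
  with (b * b / a * q * q * q) by (field; auto).
replace (a * q * q / (e * (c * q))) with (a * q / (c * e)) by (field; auto).
replace (a * q * q / (f * (c * q))) with (a * q / (c * f)) by (field; auto).
replace (a * q * q * q / (f * (c * q))) with (a * q / (c * f) * q) by (field; auto).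
replace (a * q * q * q / (f * (d * q))) with (a * q / (d * f) * q) by (field; auto).
replace (a * q * q * q / (c * q * (d * q))) with (a * q / (c * d)) by (field; auto).
replace (a * q ^ 4 / (c * q * (d * q))) with (a * q / (c * d) * q)
  by (field; auto).
replace (a * q ^ 4 / (c * q * (e * q))) with (a * q / (c * e) * q)
  by (field; auto).
replace (a * q ^ 4 / (d * q * (e * q))) with (a * q / (d * e) * q)
  by (field; auto).
replace (a * q * q / (e * f)) with (a * q / (e * f) * q) by (field; auto).
ring.
Qed.

Lemma jackson_iter (q a b c d e f : C) (N : nat) :
  (0 < Cmod q < 1)%R ->
  a <> 0 -> b <> 0 -> c <> 0 -> d <> 0 -> e <> 0 -> f <> 0 ->
  a ^ 2 * q = b * c * d * e * f ->
  jackson q a b c d e f =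
  qprod q a (4 * N) * qprod q (b * b / a) (4 * N) *
  (qprod q (a * q / (c * d)) (2 * N) * qprod q (a * q / (c * e)) (2 * N) *
   qprod q (a * q / (c * f)) (2 * N) * qprod q (a * q / (d * e)) (2 * N) *
   qprod q (a * q / (d * f)) (2 * N) * qprod q (a * q / (e * f)) (2 * N)) *
  jackson q (a * q ^ (4 * N)) (b * q ^ (4 * N)) (c * q ^ N) (d * q ^ N)
    (e * q ^ N) (f * q ^ N).
Proof.
intros Hq Ha Hb Hc Hd He Hf Hbal. assert (Hq0 := q_neq0 q Hq).
induction N as [|N IH].
- simpl. rewrite !Cmult_1_r. repeat rewrite Cmult_1_r. ring.
- rewrite IH.
  assert (HN := Cpow_nz q N Hq0).
  assert (E4 : q ^ (4 * N) = q ^ N * q ^ N * q ^ N * q ^ N).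
  { replace (4 * N)%nat with (N + N + N + N)%nat by lia.
    now rewrite !Cpow_add_r. }
  assert (E2 : q ^ (2 * N) = q ^ N * q ^ N).
  { replace (2 * N)%nat with (N + N)%nat by lia. now rewrite !Cpow_add_r. }
  replace (4 * S N)%nat with (4 * N + 4)%nat by lia.
  replace (2 * S N)%nat with (2 * N + 2)%nat by lia.
  rewrite (jackson_step4 q (a * q ^ (4 * N))); auto using Cmult_neq_0, Cpow_nz.
  2:{ rewrite E4. transitivity (a ^ 2 * q * (q ^ N * q ^ N * q ^ N * q ^ N *
        (q ^ N * q ^ N * q ^ N * q ^ N))); [ring|]. rewrite Hbal. ring. }
  rewrite !qprod_add, E2.
  assert (EP : forall x y : C, x <> 0 -> y <> 0 ->
    a * q ^ (4 * N) * q / (x * q ^ N * (y * q ^ N)) =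
    a * q / (x * y) * (q ^ N * q ^ N)).
  { intros x y Hx Hy. rewrite E4. field. auto. }
  rewrite !EP by auto.
  replace (b * q ^ (4 * N) * (b * q ^ (4 * N)) / (a * q ^ (4 * N)))
    with (b * b / a * q ^ (4 * N)) by (rewrite E4; field; auto).
  rewrite Cpow_add_r.
  replace (a * q ^ (4 * N) * q ^ 4) with (a * (q ^ (4 * N) * q ^ 4)) by ring.
  replace (b * q ^ (4 * N) * q ^ 4) with (b * (q ^ (4 * N) * q ^ 4)) by ring.
  replace (q ^ S N) with (q ^ N * q) by (simpl; ring).
  rewrite !(Cmult_assoc _ (q ^ N) q).
  set (J := jackson _ _ _ _ _ _ _).
  ring.
Qed.

Lemma jackson_eq_limit (q a b c d e f : C) :
  (0 < Cmod q < 1)%R ->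
  a <> 0 -> b <> 0 -> c <> 0 -> d <> 0 -> e <> 0 -> f <> 0 ->
  a ^ 2 * q = b * c * d * e * f ->
  jackson q a b c d e f =
  qinf q a * qinf q (b * b / a) *
  (qinf q (a * q / (c * d)) * qinf q (a * q / (c * e)) *
   qinf q (a * q / (c * f)) * qinf q (a * q / (d * e)) *
   qinf q (a * q / (d * f)) * qinf q (a * q / (e * f))) *
  (total (jackson_limit_term q (a * q / b)) -
   b / a * total (jackson_limit_term q (b * q / a))).
Proof.
intros Hq Ha Hb Hc Hd He Hf Hbal. assert (Hq0 := q_neq0 q Hq).
assert (Hq1 : (Cmod q < 1)%R) by lra.
eapply climit_unique.
- apply climit_const with (l := jackson q a b c d e f).
- eapply climit_ext.
  { intros N. symmetry. now apply (jackson_iter q a b c d e f N). }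
  assert (L4 : forall x : C, climit (fun N => qprod q x (4 * N)) (qinf q x)).
  { intros x. apply (climit_comp (qprod q x) _ (fun N => (4 * N)%nat)).
    - now apply climit_qprod_qinf.
    - intros; lia. }
  assert (L2 : forall x : C, climit (fun N => qprod q x (2 * N)) (qinf q x)).
  { intros x. apply (climit_comp (qprod q x) _ (fun N => (2 * N)%nat)).
    - now apply climit_qprod_qinf.
    - intros; lia. }
  apply climit_mult; [repeat apply climit_mult; auto|].
  assert (Q4 := climit_qpow_mult q 4 Hq1 ltac:(lia)).
  replace (total (jackson_limit_term q (a * q / b)) -
    b / a * total (jackson_limit_term q (b * q / a))) with
    (qinf q (b * b / a * 0) * total (jackson_limit_term q (a * q / b)) -
     b / a * qinf q (a * 0) *
     total (jackson_limit_term q (b * b / a * q / b))).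
  2:{ rewrite !Cmult_0_r. repeat rewrite Cmult_0_r. rewrite qinf_0 by auto.
      replace (b * b / a * q / b) with (b * q / a) by (field; auto). ring. }
  unfold jackson. apply climit_ext with (fun N =>
    qinf q (b * b / a * q ^ (4 * N)) * total (jackson_term q (a * q ^ (4 * N))
      (b * q ^ (4 * N)) (c * q ^ N) (d * q ^ N) (e * q ^ N) (f * q ^ N)) -
    b / a * qinf q (a * q ^ (4 * N)) * total (jackson_term q
      (b * b / a * q ^ (4 * N)) (b * q ^ (4 * N)) (b * c / a * q ^ N)
      (b * d / a * q ^ N) (b * e / a * q ^ N) (b * f / a * q ^ N))).
  { intros N. assert (HN := Cpow_nz q (4 * N) Hq0).
    assert (EP : forall x : C, b * q ^ (4 * N) * (x * q ^ N) / (a * q ^ (4 * N)) =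
      b * x / a * q ^ N) by (intros x; field; auto).
    rewrite !EP.
    replace (b * q ^ (4 * N) * (b * q ^ (4 * N)) / (a * q ^ (4 * N)))
      with (b * b / a * q ^ (4 * N)) by (field; auto).
    replace (b * q ^ (4 * N) / (a * q ^ (4 * N))) with (b / a) by (field; auto).
    reflexivity. }
  apply climit_minus; apply climit_mult.
  + apply climit_qinf; [auto|]. apply climit_mult; [apply climit_const|auto].
  + now apply climit_jackson_total.
  + apply climit_mult; [apply climit_const|]. apply climit_qinf; [auto|].
    apply climit_mult; [apply climit_const|auto].
  + apply climit_jackson_total; auto; apply Cdiv_neq0; auto; apply Cmult_neq_0; auto.
Qed.

(* With d = 1 the first series reduces to its term m = 0 and the companion
   series vanishes. *)
Lemma jackson_d1 (q a b c e f : C) :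
  (0 < Cmod q < 1)%R ->
  a <> 0 -> b <> 0 -> c <> 0 -> e <> 0 -> f <> 0 ->
  a ^ 2 * q = b * c * e * f ->
  jackson q a b c 1 e f =
  qinf q a * qinf q (b * b / a) *
  (qinf q (a * q / (c * 1)) * qinf q (a * q / (c * e)) *
   qinf q (a * q / (c * f)) * qinf q (a * q / (1 * e)) *
   qinf q (a * q / (1 * f)) * qinf q (a * q / (e * f))) *
  (qinf q q * qinf q (b / a) * qinf q (a * q / b)).
Proof.
intros Hq Ha Hb Hc He Hf Hbal. assert (Hq1 : (Cmod q < 1)%R) by lra.
assert (Hq0 := q_neq0 q Hq). unfold jackson.
rewrite (total_eq (jackson_term q a b c 1 e f) (jackson_term q a b c 1 e f 0)).
2:{ apply has_sum_first. intros n. unfold jackson_term, jackson_factor.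
    rewrite (qprod_head q 1 n). ring. }
rewrite (total_eq (jackson_term q (b * b / a) b (b * c / a) (b * 1 / a)
  (b * e / a) (b * f / a)) 0).
2:{ apply has_sum_ext with (fun _ => RtoC 0).
    - intros n. unfold jackson_term, jackson_factor.
      replace (b * (b * 1 / a) / (b * b / a)) with (RtoC 1) by (field; auto).
      rewrite qinf_1 by auto. ring.
    - apply (has_sum_first (fun _ => RtoC 0)). auto. }
unfold jackson_term, jackson_factor. simpl.
repeat rewrite Cmult_1_r. rewrite (qinf_step q a Hq1).
repeat rewrite Cmult_1_l.
assert (Ef : f = a ^ 2 * q / (b * c * e)).
{ rewrite Hbal. field. auto. }
replace (b * c / a) with (a * q / (e * f)) by (rewrite Ef; field; auto).
replace (b * e / a) with (a * q / (c * f)) by (rewrite Ef; field; auto).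
replace (b * f / a) with (a * q / (c * e)) by (rewrite Ef; field; auto).
replace (a * q / 1) with (a * q) by field.
ring.
Qed.

(* The limit depends on b/a only, so it can be read off from the case d = 1;
   the choice of t makes all the infinite products to be cancelled nonzero. *)
Lemma jackson_limit_value (q r : C) :
  (0 < Cmod q < 1)%R -> r <> 0 ->
  total (jackson_limit_term q (q / r)) -
    r * total (jackson_limit_term q (r * q)) =
  qinf q q * qinf q r * qinf q (q / r).
Proof.
intros Hq Hr. assert (Hq0 := q_neq0 q Hq).
assert (Hr0 := Cmod_ge_0 r). assert (Hr1 := proj1 (Cmod_gt_0 r) Hr).
(* Makes both s and |r| s smaller than 1. *)
set (s := (/ (2 + Cmod r))%R).
assert (Hs : (0 < s)%R) by (apply Rinv_0_lt_compat; lra).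
assert (Hs1 : (s * (2 + Cmod r) = 1)%R) by (unfold s; field; lra).
assert (Hs2 : (s < 1)%R) by nra.
assert (Hs3 : (Cmod r * s < 1)%R) by nra.
set (t := RtoC s).
assert (Ht : t <> 0).
{ apply Cmod_gt_0. unfold t. rewrite Cmod_R, Rabs_pos_eq; lra. }
assert (Mt : Cmod t = s) by (unfold t; rewrite Cmod_R, Rabs_pos_eq; lra).
(* With c = e = t, d = 1, b = r a and f fixed by the balancing condition, the products to be
   cancelled have the arguments t^4, r^2 t^4, t^3 q, t^2 q, r t and r t^2, all of modulus below
   1. *)
set (a := t ^ 4). assert (Ha : a <> 0) by (apply Cpow_nz; auto).
set (b := r * a). assert (Hb : b <> 0) by (apply Cmult_neq_0; auto).
set (f := q * a / (r * t * t)).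
assert (Hf : f <> 0).
{ apply Cdiv_neq0; auto using Cmult_neq_0. }
assert (Hbal : a ^ 2 * q = b * t * t * f).
{ unfold f, b. field. auto. }
assert (J1 := jackson_d1 q a b t t f Hq Ha Hb Ht Ht Hf Hbal).
assert (J2 := jackson_eq_limit q a b t 1 t f Hq Ha Hb Ht C1_nz Ht Hf).
rewrite J1 in J2.
assert (Hbal' : a ^ 2 * q = b * t * 1 * t * f) by (rewrite Hbal; ring).
specialize (J2 Hbal').
replace (a * q / b) with (q / r) in J2 by (unfold b; field; auto).
replace (b * q / a) with (r * q) in J2 by (unfold b; field; auto).
replace (b / a) with r in J2 by (unfold b; field; auto).
set (k := qinf q a * qinf q (b * b / a) *
  (qinf q (a * q / (t * 1)) * qinf q (a * q / (t * t)) *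
   qinf q (a * q / (t * f)) * qinf q (a * q / (1 * t)) *
   qinf q (a * q / (1 * f)) * qinf q (a * q / (t * f)))) in J2.
assert (Hk : k <> 0).
{ assert (S2 : (s * s < 1)%R) by nra.
  assert (S3 : (s * s * s < 1)%R) by nra.
  assert (Mq : (0 < Cmod q < 1)%R) by auto.
  unfold k. repeat apply Cmult_neq_0; apply qinf_small_neq0; try lra.
  - unfold a. rewrite Cmod_pow, Mt. simpl. nra.
  - replace (b * b / a) with ((r * t) * (r * t) * (t * t))
      by (unfold b, a; field; auto).
    rewrite !Cmod_mult, Mt.
    assert (0 <= Cmod r * s)%R by nra.
    assert (Cmod r * s * (Cmod r * s) < 1)%R by nra. nra.
  - replace (a * q / (t * 1)) with (t * t * t * q) by (unfold a; field; auto).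
    rewrite !Cmod_mult, Mt. assert (0 < s * s * s)%R by nra. nra.
  - replace (a * q / (t * t)) with (t * t * q) by (unfold a; field; auto).
    rewrite !Cmod_mult, Mt. nra.
  - replace (a * q / (t * f)) with (r * t) by (unfold f; field; auto).
    rewrite !Cmod_mult, Mt. auto.
  - replace (a * q / (1 * t)) with (t * t * t * q) by (unfold a; field; auto).
    rewrite !Cmod_mult, Mt. assert (0 < s * s * s)%R by nra. nra.
  - replace (a * q / (1 * f)) with (r * t * t) by (unfold f; field; auto).
    rewrite !Cmod_mult, Mt. nra.
  - replace (a * q / (t * f)) with (r * t) by (unfold f; field; auto).
    rewrite !Cmod_mult, Mt. auto. }
match goal with |- ?L = ?R => replace L with (/ k * (k * L)) by (field; auto);
  replace R with (/ k * (k * R)) by (field; auto) end.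
f_equal. symmetry. exact J2.
Qed.

Lemma jackson_sum (q a b c d e f : C) :
  (0 < Cmod q < 1)%R ->
  a <> 0 -> b <> 0 -> c <> 0 -> d <> 0 -> e <> 0 -> f <> 0 ->
  a ^ 2 * q = b * c * d * e * f ->
  jackson q a b c d e f =
  qinf q a * qinf q (b * b / a) *
  (qinf q (a * q / (c * d)) * qinf q (a * q / (c * e)) *
   qinf q (a * q / (c * f)) * qinf q (a * q / (d * e)) *
   qinf q (a * q / (d * f)) * qinf q (a * q / (e * f))) *
  (qinf q q * qinf q (b / a) * qinf q (a * q / b)).
Proof.
intros Hq Ha Hb Hc Hd He Hf Hbal.
rewrite jackson_eq_limit by auto. f_equal.
assert (V := jackson_limit_value q (b / a) Hq (Cdiv_neq0 _ _ Hb Ha)).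
replace (q / (b / a)) with (a * q / b) in V by (field; auto).
replace (b / a * q) with (b * q / a) in V by (field; auto).
exact V.
Qed.

(** * Bilateral series *)

Ltac zarg := cbv beta; match goal with
  | |- ?u _ = ?u _ => apply (f_equal u); lia end.

Lemma is_biseries_iff (u : Z -> C) (l : C) :
  is_biseries u l <->
  exists l1 l2, has_sum (fun n => u (Z.of_nat n)) l1 /\
    has_sum (fun n => u (- Z.of_nat (S n))%Z) l2 /\ l = l1 + l2.
Proof.
split; intros (l1 & l2 & H1 & H2 & E); exists l1, l2; repeat split; auto;
  now apply has_sum_is_series.
Qed.

Lemma is_biseries_unique (u : Z -> C) (l m : C) :
  is_biseries u l -> is_biseries u m -> l = m.
Proof.
intros Hl Hm. rewrite <- (Biseries_unique u l Hl). now apply Biseries_unique.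
Qed.

Lemma is_biseries_ext (u v : Z -> C) (l : C) :
  (forall n, u n = v n) -> is_biseries u l -> is_biseries v l.
Proof.
intros E H. apply is_biseries_iff in H. apply is_biseries_iff.
destruct H as (l1 & l2 & H1 & H2 & El). exists l1, l2. repeat split; auto.
- now apply has_sum_ext with (2 := H1).
- now apply has_sum_ext with (2 := H2).
Qed.

Lemma is_biseries_plus (u v : Z -> C) (l m : C) :
  is_biseries u l -> is_biseries v m -> is_biseries (fun n => u n + v n) (l + m).
Proof.
intros H K. apply is_biseries_iff in H. apply is_biseries_iff in K.
apply is_biseries_iff.
destruct H as (l1 & l2 & H1 & H2 & ->). destruct K as (m1 & m2 & K1 & K2 & ->).
exists (l1 + m1), (l2 + m2). repeat split.
- exact (has_sum_plus _ _ _ _ H1 K1).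
- exact (has_sum_plus _ _ _ _ H2 K2).
- ring.
Qed.

Lemma is_biseries_scal (c : C) (u : Z -> C) (l : C) :
  is_biseries u l -> is_biseries (fun n => c * u n) (c * l).
Proof.
intros H. apply is_biseries_iff in H. apply is_biseries_iff.
destruct H as (l1 & l2 & H1 & H2 & ->).
exists (c * l1), (c * l2). repeat split.
- exact (has_sum_scal c _ _ H1).
- exact (has_sum_scal c _ _ H2).
- ring.
Qed.

Lemma is_biseries_opp (u : Z -> C) (l : C) :
  is_biseries u l -> is_biseries (fun n => u (- n)%Z) l.
Proof.
intros H. apply is_biseries_iff in H. apply is_biseries_iff.
destruct H as (l1 & l2 & H1 & H2 & ->).
exists (l2 + u 0%Z), (l1 - u 0%Z). repeat split.
- apply has_sum_head. simpl Z.of_nat. simpl Z.opp.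
  replace (l2 + u 0%Z - u 0%Z) with l2 by ring. exact H2.
- apply has_sum_ext with (fun n => u (Z.of_nat (S n))).
  + intros n. zarg.
  + exact (proj1 (has_sum_head _ _) H1).
- ring.
Qed.

Lemma is_biseries_succ (u : Z -> C) (l : C) :
  is_biseries u l -> is_biseries (fun n => u (n + 1)%Z) l.
Proof.
intros H. apply is_biseries_iff in H. apply is_biseries_iff.
destruct H as (l1 & l2 & H1 & H2 & ->).
exists (l1 - u 0%Z), (l2 + u 0%Z). repeat split.
- apply has_sum_ext with (fun n => u (Z.of_nat (S n))).
  + intros n. zarg.
  + exact (proj1 (has_sum_head _ _) H1).
- apply has_sum_head. simpl (u (- Z.of_nat 1 + 1)%Z).
  replace (l2 + u 0%Z - u 0%Z) with l2 by ring.
  apply has_sum_ext with (2 := H2). intros n. zarg.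
- ring.
Qed.

Lemma is_biseries_shift (u : Z -> C) (l : C) (k : Z) :
  is_biseries u l -> is_biseries (fun n => u (n + k)%Z) l.
Proof.
assert (Hnat : forall (k : nat) v, is_biseries v l ->
  is_biseries (fun n => v (n + Z.of_nat k)%Z) l).
{ induction k0 as [|j IH]; intros v Hv.
  - apply is_biseries_ext with (2 := Hv). intros n. zarg.
  - apply is_biseries_ext with (2 := is_biseries_succ _ _ (IH v Hv)).
    intros n. zarg. }
intros H. destruct (Z_le_gt_dec 0 k) as [Hk|Hk].
- apply is_biseries_ext with (2 := Hnat (Z.to_nat k) u H).
  intros n. zarg.
- apply is_biseries_ext with (2 := is_biseries_opp _ _ (Hnat (Z.to_nat (- k)) _
    (is_biseries_opp _ _ H))).
  intros n. zarg.
Qed.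

Lemma has_sum_0 (u : nat -> C) : (forall n, u n = 0) -> has_sum u 0.
Proof.
intros H. rewrite <- (H 0%nat). apply has_sum_first. intros n. apply H.
Qed.

Lemma is_biseries_supported (u : Z -> C) (l : C) (k : Z) :
  (forall n, (n < k)%Z -> u n = 0) ->
  has_sum (fun m => u (k + Z.of_nat m)%Z) l -> is_biseries u l.
Proof.
intros H0 H.
assert (B : is_biseries (fun n => u (n + k)%Z) l).
{ apply is_biseries_iff. exists l, 0. repeat split.
  - apply has_sum_ext with (2 := H). intros n. zarg.
  - apply has_sum_0. intros n. apply H0. lia.
  - ring. }
apply is_biseries_ext with (2 := is_biseries_shift _ _ (- k) B).
intros n. zarg.
Qed.

Lemma is_biseries_supported_le (u : Z -> C) (l : C) (k : Z) :
  (forall n, (k < n)%Z -> u n = 0) ->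
  has_sum (fun m => u (k - Z.of_nat m)%Z) l -> is_biseries u l.
Proof.
intros H0 H.
assert (B : is_biseries (fun n => u (- n)%Z) l).
{ apply is_biseries_supported with (- k)%Z.
  - intros n Hn. apply H0. lia.
  - apply has_sum_ext with (2 := H). intros n. zarg. }
apply is_biseries_ext with (2 := is_biseries_opp _ _ B).
intros n. zarg.
Qed.

(** Pairs n with -n-1, so that every integer occurs exactly once and bilateral sums reduce to sums
    over [nat]. *)
Definition zfold (u : Z -> C) (i : nat) : C :=
  u (Z.of_nat i) + u (- Z.of_nat (S i))%Z.

Lemma has_sum_zfold (u : Z -> C) (l : C) :
  is_biseries u l -> has_sum (zfold u) l.
Proof.
intros H. apply is_biseries_iff in H. destruct H as (l1 & l2 & H1 & H2 & ->).
exact (has_sum_plus _ _ _ _ H1 H2).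
Qed.

Definition zgeom_bounded (K r : R) (u : Z -> C) : Prop :=
  forall n, (Cmod (u n) <= K * r ^ Z.abs_nat n)%R.

Lemma pow_S_le (r : R) (n : nat) : (0 <= r < 1)%R -> (r ^ S n <= r ^ n)%R.
Proof.
intros Hr. simpl. assert (0 <= r ^ n)%R by (apply pow_le; lra). nra.
Qed.

Lemma zgeom_bounded_pos (K r : R) (u : Z -> C) :
  zgeom_bounded K r u -> (0 <= K)%R.
Proof.
intros H. specialize (H 0%Z). simpl in H.
assert (T := Cmod_ge_0 (u 0%Z)). lra.
Qed.

Lemma zgeom_bounded_zfold (K r : R) (u : Z -> C) :
  (0 <= r < 1)%R -> zgeom_bounded K r u -> geom_bounded (2 * K) r (zfold u).
Proof.
intros Hr H i. assert (HK := zgeom_bounded_pos _ _ _ H).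
assert (A := H (Z.of_nat i)). assert (B := H (- Z.of_nat (S i))%Z).
replace (Z.abs_nat (Z.of_nat i)) with i in A by lia.
replace (Z.abs_nat (- Z.of_nat (S i))) with (S i) in B by lia.
assert (L := pow_S_le r i Hr).
eapply Rle_trans; [apply Cmod_triangle|]. nra.
Qed.

Lemma ex_is_biseries (K r : R) (u : Z -> C) :
  (0 <= r < 1)%R -> zgeom_bounded K r u -> exists l, is_biseries u l.
Proof.
intros Hr H. assert (HK := zgeom_bounded_pos _ _ _ H).
destruct (ex_has_sum K r (fun n => u (Z.of_nat n))) as [l1 H1]; auto.
{ intros n. assert (A := H (Z.of_nat n)).
  now replace (Z.abs_nat (Z.of_nat n)) with n in A by lia. }
destruct (ex_has_sum K r (fun n => u (- Z.of_nat (S n))%Z)) as [l2 H2]; auto.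
{ intros n. assert (A := H (- Z.of_nat (S n))%Z).
  replace (Z.abs_nat (- Z.of_nat (S n))) with (S n) in A by lia.
  assert (L := pow_S_le r n Hr). nra. }
exists (l1 + l2). apply is_biseries_iff. now exists l1, l2.
Qed.

Lemma is_biseries_bound (K r : R) (u : Z -> C) (l : C) :
  (0 <= r < 1)%R -> zgeom_bounded K r u -> is_biseries u l ->
  (Cmod l <= 2 * K / (1 - r))%R.
Proof.
intros Hr H Hl. apply (has_sum_bound (2 * K) r (zfold u)); auto.
- now apply zgeom_bounded_zfold.
- now apply has_sum_zfold.
Qed.

(** Folding both indices puts four terms into one cell, whence the constant 4K for
    [has_sum_exchange]. The folded series only determines the value of the sum of B; the convergence
    of its two halves comes from the majorant. *)
Lemma is_biseries_exchange (K r : R) (u : Z -> Z -> C) (A B : Z -> C) (l : C) :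
  (0 <= r < 1)%R ->
  (forall n k, (Cmod (u n k) <= K * r ^ Z.abs_nat n * r ^ Z.abs_nat k)%R) ->
  (forall n, is_biseries (u n) (A n)) ->
  (forall k, is_biseries (fun n => u n k) (B k)) ->
  is_biseries A l -> is_biseries B l.
Proof.
intros Hr Hu HA HB Hl.
assert (Hk : forall k, zgeom_bounded (K * r ^ Z.abs_nat k) r (fun n => u n k)).
{ intros k n. specialize (Hu n k). lra. }
assert (Hn : forall n, zgeom_bounded (K * r ^ Z.abs_nat n) r (u n)).
{ intros n k. specialize (Hu n k). lra. }
assert (HBb : zgeom_bounded (2 * K / (1 - r)) r B).
{ intros k. eapply Rle_trans; [apply (is_biseries_bound _ r _ _ Hr (Hk k) (HB k))|].
  right. field. lra. }
destruct (ex_is_biseries _ _ _ Hr HBb) as [m Hm].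
assert (E : has_sum (zfold B) l).
{ apply (has_sum_exchange (4 * K) r (fun i j => zfold (fun n => zfold (u n) j) i)
    (zfold A)); auto.
  - intros i j.
    assert (Hj : zgeom_bounded (2 * K * r ^ j) r (fun n => zfold (u n) j)).
    { intros n. eapply Rle_trans; [apply (zgeom_bounded_zfold _ _ _ Hr (Hn n) j)|].
      right. ring. }
    eapply Rle_trans; [apply (zgeom_bounded_zfold _ _ _ Hr Hj i)|].
    right. ring.
  - intros i. exact (has_sum_plus _ _ _ _ (has_sum_zfold _ _ (HA (Z.of_nat i)))
      (has_sum_zfold _ _ (HA (- Z.of_nat (S i))%Z))).
  - intros j. apply has_sum_ext with (fun i => zfold (fun n => u n (Z.of_nat j)) i +
      zfold (fun n => u n (- Z.of_nat (S j))%Z) i).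
    + intros i. unfold zfold. ring.
    + apply has_sum_plus; apply has_sum_zfold; apply HB.
  - now apply has_sum_zfold. }
now rewrite (has_sum_unique _ _ _ E (has_sum_zfold _ _ Hm)).
Qed.

(** * The double series *)

Definition qratio (q x y : C) (n : Z) : C := qpoch q x n / qpoch q y n.

(** The value 0 for m < 0 is the convention 1/(q;q)_m = 0; it confines the double series to k >=
    n. *)
Definition qkernel (q x : C) (m : Z) : C :=
  if (0 <=? m)%Z then qprod q x (Z.to_nat m) / qprod q q (Z.to_nat m) else 0.

(* Summing over n gives the very-well-poised term of base [a] (a 6-phi-5);
   summing over k gives that of base [z] up to a companion series (a
   nonterminating 8-phi-7).  From here on [f] and [g] stand for fz/a and gz/a,
   the parameters of the series with base [z]; those of the series with base
   [a] are then [a * f / z] and [a * g / z]. *)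
Definition dterm (q a z b c d e f g : C) (n k : Z) : C :=
  (1 - a * Cpowz q (2 * k)) *
  (qratio q b (a * q / b) k * qratio q c (a * q / c) k *
   qratio q d (a * q / d) k * qratio q e (a * q / e) k) *
  qratio q a (z * q) (k + n) * qkernel q (a / z) (k - n) * Cpowz q k *
  ((1 - z * Cpowz q (2 * n)) *
   (qratio q f (z * q / f) n * qratio q g (z * q / g) n) *
   Cpowz (z / (f * g)) n).

Ltac split_Forall :=
  repeat match goal with H : List.Forall _ (_ :: _) |- _ =>
    let P := fresh "P" in let Q := fresh "Q" in
    pose proof (Forall_inv H) as P; pose proof (Forall_inv_tail H) as Q; clear H;
    cbv beta in P end.

(** The same predicate at (a/z^2, 1/z, b/z, ..., g/z) describes the companion; that b/z, ..., e/z
    avoid the powers of q is part of that second instance. *)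
Definition generic (q a z b c d e f g : C) : Prop :=
  off_lattice q a /\ off_lattice q z /\
  List.Forall (fun x => off_lattice q x /\ off_lattice q (a / x)) [b; c; d; e] /\
  List.Forall (fun x => off_lattice q x /\ off_lattice q (z / x) /\
    off_lattice q (a * x / z)) [f; g] /\
  a * z * q = b * c * d * e.

Lemma generic_inv (q a z b c d e f g : C) :
  generic q a z b c d e f g ->
  off_lattice q a /\ off_lattice q z /\
  (off_lattice q b /\ off_lattice q (a / b)) /\
  (off_lattice q c /\ off_lattice q (a / c)) /\
  (off_lattice q d /\ off_lattice q (a / d)) /\
  (off_lattice q e /\ off_lattice q (a / e)) /\
  (off_lattice q f /\ off_lattice q (z / f) /\ off_lattice q (a * f / z)) /\
  (off_lattice q g /\ off_lattice q (z / g) /\ off_lattice q (a * g / z)) /\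
  a * z * q = b * c * d * e.
Proof.
intros (Ha & Hz & H4 & H2 & E).
split_Forall.
tauto.
Qed.

(** * Growth of the factors and a majorant for the double series *)

Lemma qpoch_of_nat (q x : C) (m : nat) : qpoch q x (Z.of_nat m) = qprod q x m.
Proof.
destruct m as [|m]; [reflexivity|].
change (qprod q x (Pos.to_nat (Pos.of_succ_nat m)) = qprod q x (S m)).
now rewrite SuccNat2Pos.id_succ.
Qed.

Lemma qpoch_0 (q x : C) : qpoch q x 0 = 1.
Proof. reflexivity. Qed.

Lemma bounded_qprod_ratio (q x y : C) :
  (0 < Cmod q < 1)%R -> qinf q y <> 0 ->
  bounded (fun m => qprod q x m / qprod q y m).
Proof.
intros [Hq0 Hq] Hy.
apply bounded_ext with (fun m => qprod q x m * qinf q (y * q ^ m) * / qinf q y).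
- intros m. rewrite (qinf_shift q y m Hq) in Hy |- *.
  assert (qprod q y m <> 0) by (intros E; apply Hy; rewrite E; ring).
  assert (qinf q (y * q ^ m) <> 0) by (intros E; apply Hy; rewrite E; ring).
  field. auto.
- bounded_tac.
Qed.

Definition dominated {I : Type} (u : I -> C) (rho : I -> R) : Prop :=
  exists K : R, (0 <= K)%R /\ forall i, (Cmod (u i) <= K * rho i)%R.

Lemma dominated_mult (I : Type) (u v : I -> C) (rho sigma : I -> R) :
  dominated u rho -> dominated v sigma ->
  dominated (fun i => u i * v i) (fun i => rho i * sigma i)%R.
Proof.
intros (K & HK0 & HK) (L & HL0 & HL). exists (K * L)%R.
split; [now apply Rmult_le_pos|]. intros i. rewrite Cmod_mult.
replace (K * L * (rho i * sigma i))%R with (K * rho i * (L * sigma i))%R by ring.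
apply Rmult_le_compat; auto; apply Cmod_ge_0.
Qed.

Lemma dominated_comp (I J : Type) (h : I -> J) (u : J -> C) (rho : J -> R) :
  dominated u rho -> dominated (fun i => u (h i)) (fun i => rho (h i)).
Proof. intros (K & H0 & HK). exists K. auto. Qed.

(** The negative part max(0, -n), by truncation in [Z.to_nat]: it records growth that occurs only
    towards minus infinity. *)
Definition nneg (n : Z) : nat := Z.to_nat (- n).

Lemma bounded_nonneg (I : Type) (u : I -> C) :
  bounded u -> exists K, (0 <= K)%R /\ forall i, (Cmod (u i) <= K)%R.
Proof.
intros [K HK]. exists (Rmax 0 K). split; [apply Rmax_l|].
intros i. eapply Rle_trans; [apply HK|apply Rmax_r].
Qed.

(** For n >= 0 the quotient is bounded; for n = -m, reversal turns it into (y/x)^m times a bounded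
    quotient. *)
Lemma dominated_qratio (q x y : C) :
  (0 < Cmod q < 1)%R -> off_lattice q x -> off_lattice q y ->
  dominated (qratio q x y) (fun n => Cmod (y / x) ^ nneg n)%R.
Proof.
intros Hq Hx Hy. assert (Hq0 := q_neq0 q Hq).
assert (Hqx : off_lattice q (q / x)).
{ unfold Cdiv. rewrite Cmult_comm. apply off_lattice_q; auto.
  now apply off_lattice_inv. }
destruct (bounded_nonneg _ _ (bounded_qprod_ratio q x y Hq
  (off_lattice_qinf q y Hq Hy))) as (K & HK0 & HK).
destruct (bounded_nonneg _ _ (bounded_qprod_ratio q (q / y) (q / x) Hq
  (off_lattice_qinf q _ Hq Hqx))) as (L & HL0 & HL).
exists (K + L)%R. split; [lra|]. intros n. unfold qratio, nneg.
destruct (Z_le_gt_dec 0 n) as [Hn|Hn].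
- replace n with (Z.of_nat (Z.to_nat n)) at 1 2 by lia.
  rewrite !qpoch_of_nat. replace (Z.to_nat (- n)) with 0%nat by lia.
  simpl. specialize (HK (Z.to_nat n)). lra.
- replace n with (0 - Z.of_nat (Z.to_nat (- n)))%Z at 1 2 by lia.
  set (m := Z.to_nat (- n)).
  rewrite qpoch_ratio_sub_nat by auto. rewrite !qpoch_0.
  replace (1 - 0)%Z with 1%Z by lia. rewrite Cpowz_1.
  set (t := y / x).
  replace (1 / 1 * (t ^ m * (qprod q (q / y) m / qprod q (q / x) m)))
    with (t ^ m * (qprod q (q / y) m / qprod q (q / x) m)).
  2:{ field. now apply off_lattice_qprod. }
  rewrite Cmod_mult, Cmod_pow. specialize (HL m).
  assert (0 <= Cmod t ^ m)%R by (apply pow_le, Cmod_ge_0). nra.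
Qed.

Lemma dominated_vwp_factor (q a : C) :
  (0 < Cmod q < 1)%R ->
  dominated (fun k => 1 - a * Cpowz q (2 * k))
    (fun k => (/ Cmod q ^ 2) ^ nneg k)%R.
Proof.
intros Hq. assert (Hq0 := q_neq0 q Hq). exists (1 + Cmod a)%R.
assert (Ha := Cmod_ge_0 a). split; [lra|]. intros k. unfold nneg.
eapply Rle_trans; [apply Cmod_triangle|]. rewrite Cmod_opp, Cmod_1, Cmod_mult.
destruct (Z_le_gt_dec 0 k) as [Hk|Hk].
- replace (2 * k)%Z with (Z.of_nat (2 * Z.to_nat k)) by lia.
  rewrite Cpowz_of_nat. replace (Z.to_nat (- k)) with 0%nat by lia. simpl pow.
  assert (L := Cmod_qpow_le1 q (2 * Z.to_nat k) (proj2 Hq)). nra.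
- set (l := Z.to_nat (- k)). replace (2 * k)%Z with (- Z.of_nat (2 * l))%Z by lia.
  rewrite Cpowz_opp_of_nat, Cmod_inv by now apply Cpow_nz.
  rewrite Cmod_pow, pow_mult.
  assert (P : (0 < (Cmod q ^ 2) ^ l)%R).
  { apply pow_lt. apply pow_lt. lra. }
  rewrite pow_inv.
  assert (L : ((Cmod q ^ 2) ^ l <= 1)%R).
  { rewrite <- pow_mult, <- Cmod_pow. apply Cmod_qpow_le1. lra. }
  assert (1 <= / (Cmod q ^ 2) ^ l)%R.
  { rewrite <- Rinv_1. apply Rinv_le_contravar; lra. }
  nra.
Qed.

Definition zpow (x : R) (k : Z) : R :=
  (if (0 <=? k)%Z then x ^ Z.to_nat k else / x ^ Z.to_nat (- k))%R.

Lemma Cmod_Cpowz (x : C) (k : Z) : x <> 0 -> Cmod (Cpowz x k) = zpow (Cmod x) k.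
Proof.
intros Hx. unfold zpow. destruct (Z.leb_spec 0 k) as [Hk|Hk].
- replace k with (Z.of_nat (Z.to_nat k)) at 1 by lia.
  now rewrite Cpowz_of_nat, Cmod_pow.
- replace k with (- Z.of_nat (Z.to_nat (- k)))%Z at 1 by lia.
  rewrite Cpowz_opp_of_nat, Cmod_inv by now apply Cpow_nz.
  now rewrite Cmod_pow.
Qed.

Lemma dominated_qkernel (q x : C) :
  (0 < Cmod q < 1)%R -> dominated (qkernel q x) (fun _ => 1%R).
Proof.
intros Hq.
destruct (bounded_nonneg _ _ (bounded_qprod_ratio q x q Hq
  (qinf_small_neq0 q q (proj2 Hq) (proj2 Hq)))) as (K & HK0 & HK).
exists K. split; [auto|]. intros m. rewrite Rmult_1_r. unfold qkernel.
destruct (Z.leb_spec 0 m); [apply HK|]. now rewrite Cmod_0.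
Qed.

Lemma qkernel_neg (q x : C) (m : Z) : (m < 0)%Z -> qkernel q x m = 0.
Proof. intros H. unfold qkernel. destruct (Z.leb_spec 0 m); [lia|auto]. Qed.

Lemma qkernel_of_nat (q x : C) (m : nat) :
  qkernel q x (Z.of_nat m) = qprod q x m / qprod q q m.
Proof.
unfold qkernel. destruct (Z.leb_spec 0 (Z.of_nat m)); [|lia].
now rewrite Nat2Z.id.
Qed.

(* [A], [Z], [r], [y] stand for the moduli of a, z, q and z/(fg). *)
Lemma weight_bound (A Z r y s : R) (n k : BinNums.Z) :
  (0 < A)%R -> (0 < Z)%R -> (0 < r)%R -> (0 < y)%R -> (0 <= s <= 1)%R ->
  (r <= s * s)%R -> (y * r <= s * s)%R -> (y * r * Z / A <= s * s)%R ->
  (n <= k)%Z ->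
  (((A / Z) ^ 2) ^ nneg k * (Z * r / A) ^ nneg (k + n) * zpow r k *
   y ^ Z.abs_nat n <= s ^ Z.abs_nat n * s ^ Z.abs_nat k)%R.
Proof.
intros HA HZ Hr Hy Hs H1 H2 H3 Hnk.
assert (P2 : (0 < y * r)%R) by now apply Rmult_lt_0_compat.
assert (P3 : (0 < y * r * Z / A)%R).
{ apply Rdiv_lt_0_compat; [|auto]. now apply Rmult_lt_0_compat. }
assert (B : forall (u v : R) i j, (0 < u <= s * s)%R -> (0 < v <= s * s)%R ->
  (u ^ i * v ^ j <= s ^ (i + i + j + j))%R).
{ intros u v i j Hu Hv.
  replace (s ^ (i + i + j + j))%R with ((s * s) ^ i * (s * s) ^ j)%R.
  - apply Rmult_le_compat; try (apply pow_le; lra); apply pow_incr; lra.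
  - rewrite !Rpow_mult_distr, !pow_add. ring. }
assert (D : forall i j, (j <= i)%nat -> (s ^ i <= s ^ j)%R).
{ intros i j Hij. replace i with (j + (i - j))%nat by lia. rewrite pow_add.
  rewrite <- (Rmult_1_r (s ^ j)) at 2. apply Rmult_le_compat_l.
  - apply pow_le; lra.
  - rewrite <- (pow1 (i - j)). apply pow_incr. lra. }
(* There are three regions: k >= 0 with k + n >= 0, k >= 0 with k + n < 0, and k < 0. In each the
   weight collapses to u^i v^j with u, v among r, y r and y r Z/A, all at most s^2, and 2i + 2j is
   at least |n| + |k|. *)
unfold nneg, zpow.
destruct (Z.leb_spec 0 k) as [Hk|Hk].
- replace (Z.to_nat (- k)) with 0%nat by lia.
  destruct (Z_le_gt_dec 0 (k + n)) as [Hkn|Hkn].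
  + replace (Z.to_nat (- (k + n))) with 0%nat by lia. rewrite !pow_O.
    set (i := Z.abs_nat n). set (j := (Z.to_nat k - i)%nat).
    replace (Z.to_nat k) with (i + j)%nat by lia.
    replace (Z.abs_nat k) with (i + j)%nat by lia.
    rewrite <- pow_add.
    replace (1 * 1 * r ^ (i + j) * y ^ i)%R with ((y * r) ^ i * r ^ j)%R
      by (rewrite Rpow_mult_distr, pow_add; ring).
    eapply Rle_trans; [apply B; lra|]. apply D. lia.
  + set (j := Z.to_nat k). set (i := Z.to_nat (- (k + n))).
    replace (Z.abs_nat n) with (i + j)%nat by lia.
    replace (Z.abs_nat k) with j by lia. rewrite <- pow_add. rewrite pow_O.
    replace (1 * (Z * r / A) ^ i * r ^ j * y ^ (i + j))%R
      with ((y * r * Z / A) ^ i * (y * r) ^ j)%R.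
    * eapply Rle_trans; [apply B; lra|]. apply D. lia.
    * replace (y * r * Z / A)%R with (Z * r / A * y)%R by (field; lra).
      rewrite !(Rpow_mult_distr _ y), (Rpow_mult_distr y r), pow_add. ring.
- set (l := Z.to_nat (- k)). set (i := Z.to_nat (k - n)).
  replace (Z.to_nat (- (k + n))) with (i + (l + l))%nat by lia.
  replace (Z.abs_nat n) with (i + l)%nat by lia.
  replace (Z.abs_nat k) with l by lia. rewrite <- pow_add.
  replace (((A / Z) ^ 2) ^ l * (Z * r / A) ^ (i + (l + l)) * / r ^ l * y ^ (i + l))%R
    with ((y * r * Z / A) ^ i * (y * r) ^ l)%R.
  + eapply Rle_trans; [apply B; lra|]. apply D. lia.
  + replace (y * r * Z / A)%R with (Z * r / A * y)%R by (field; lra).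
    rewrite !(Rpow_mult_distr _ y), (Rpow_mult_distr y r), !pow_add.
    assert (E : (((A / Z) ^ 2) ^ l * ((Z * r / A) ^ l * (Z * r / A) ^ l) =
      r ^ l * r ^ l)%R).
    { rewrite <- !Rpow_mult_distr. f_equal. field. lra. }
    assert (Hrl : (0 < r ^ l)%R) by now apply pow_lt.
    transitivity ((Z * r / A) ^ i * (y ^ i * y ^ l) *
      (r ^ l * r ^ l) * / r ^ l)%R; [field; lra|]. rewrite <- E. ring.
Qed.

Lemma zpow_abs (y : R) (n : Z) :
  (0 < y)%R -> ((y ^ 2) ^ nneg n * zpow y n = y ^ Z.abs_nat n)%R.
Proof.
intros Hy. unfold nneg, zpow. destruct (Z.leb_spec 0 n) as [Hn|Hn].
- replace (Z.to_nat (- n)) with 0%nat by lia.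
  replace (Z.abs_nat n) with (Z.to_nat n) by lia. rewrite pow_O. ring.
- replace (Z.abs_nat n) with (Z.to_nat (- n)) by lia.
  rewrite <- pow_mult. replace (2 * Z.to_nat (- n))%nat
    with (Z.to_nat (- n) + Z.to_nat (- n))%nat by lia.
  rewrite pow_add. field. apply pow_nonzero. lra.
Qed.

Lemma off_lattice_mul_q_div (q a x : C) :
  q <> 0 -> x <> 0 -> off_lattice q (a / x) -> off_lattice q (a * q / x).
Proof.
intros Hq Hx H. replace (a * q / x) with (a / x * q) by (field; auto).
now apply off_lattice_q.
Qed.

Lemma dterm_supported (q a z b c d e f g : C) (n k : Z) :
  (k < n)%Z -> dterm q a z b c d e f g n k = 0.
Proof. intros H. unfold dterm. rewrite (qkernel_neg q (a / z) (k - n)) by lia. ring. Qed.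

Lemma dterm_bound (q a z b c d e f g : C) :
  (0 < Cmod q < 1)%R -> generic q a z b c d e f g ->
  (Cmod (z * q / (f * g)) < 1)%R -> (Cmod (z * z * q / (a * f * g)) < 1)%R ->
  exists K s : R, (0 <= s < 1)%R /\ forall n k,
    (Cmod (dterm q a z b c d e f g n k) <=
     K * s ^ Z.abs_nat n * s ^ Z.abs_nat k)%R.
Proof.
intros Hq Hgen W2 W1. assert (Hq0 := q_neq0 q Hq).
apply generic_inv in Hgen.
destruct Hgen as (Ha & Hz & [Hb Hab] & [Hc Hac] & [Hd Had] & [He Hae] &
  (Hf & Hzf & _) & (Hg & Hzg & _) & Hbal).
assert (a0 := proj1 Ha). assert (z0 := proj1 Hz). assert (b0 := proj1 Hb).
assert (c0 := proj1 Hc). assert (d0 := proj1 Hd). assert (e0 := proj1 He).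
assert (f0 := proj1 Hf). assert (g0 := proj1 Hg).
set (y := z / (f * g)).
assert (Hy : y <> 0) by (apply Cdiv_neq0; [auto|now apply Cmult_neq_0]).
assert (D : dominated (fun p : Z * Z => dterm q a z b c d e f g (fst p) (snd p))
  (fun p => (((Cmod a / Cmod z) ^ 2) ^ nneg (snd p) *
    (Cmod z * Cmod q / Cmod a) ^ nneg (snd p + fst p) *
    zpow (Cmod q) (snd p) * Cmod y ^ Z.abs_nat (fst p))%R)).
{ assert (V1 := dominated_comp _ _ (fun p : Z * Z => snd p) _ _
    (dominated_vwp_factor q a Hq)).
  assert (V2 := dominated_comp _ _ (fun p : Z * Z => fst p) _ _
    (dominated_vwp_factor q z Hq)).
  assert (Rx := fun x (Hx : off_lattice q x) (Hax : off_lattice q (a / x)) =>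
    dominated_comp _ _ (fun p : Z * Z => snd p) _ _
    (dominated_qratio q x (a * q / x) Hq Hx
      (off_lattice_mul_q_div q a x Hq0 (proj1 Hx) Hax))).
  assert (Rz := fun x (Hx : off_lattice q x) (Hzx : off_lattice q (z / x)) =>
    dominated_comp _ _ (fun p : Z * Z => fst p) _ _
    (dominated_qratio q x (z * q / x) Hq Hx
      (off_lattice_mul_q_div q z x Hq0 (proj1 Hx) Hzx))).
  assert (Ra := dominated_comp _ _ (fun p : Z * Z => (snd p + fst p)%Z) _ _
    (dominated_qratio q a (z * q) Hq Ha (off_lattice_q q z Hq0 Hz))).
  assert (Kk := dominated_comp _ _ (fun p : Z * Z => (snd p - fst p)%Z) _ _
    (dominated_qkernel q (a / z) Hq)).
  assert (P1 : dominated (fun p : Z * Z => Cpowz q (snd p))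
    (fun p => zpow (Cmod q) (snd p))).
  { exists 1%R. split; [lra|]. intros p. rewrite Cmod_Cpowz by auto. lra. }
  assert (P2 : dominated (fun p : Z * Z => Cpowz y (fst p))
    (fun p => zpow (Cmod y) (fst p))).
  { exists 1%R. split; [lra|]. intros p. rewrite Cmod_Cpowz by auto. lra. }
  assert (M := dominated_mult _ _ _ _ _
    (dominated_mult _ _ _ _ _ (dominated_mult _ _ _ _ _ (dominated_mult _ _ _ _ _
      (dominated_mult _ _ _ _ _ V1
        (dominated_mult _ _ _ _ _ (dominated_mult _ _ _ _ _
          (dominated_mult _ _ _ _ _ (Rx b Hb Hab) (Rx c Hc Hac)) (Rx d Hd Had))
          (Rx e He Hae))) Ra) Kk) P1)
    (dominated_mult _ _ _ _ _ (dominated_mult _ _ _ _ _ V2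
      (dominated_mult _ _ _ _ _ (Rz f Hf Hzf) (Rz g Hg Hzg))) P2)).
  cbv beta in M. destruct M as (K & HK0 & HK). exists K. split; [auto|].
  intros p. eapply Rle_trans; [apply HK|]. right. f_equal.
  rewrite <- (zpow_abs (Cmod y)) by now apply Cmod_gt_0.
  (* Since bcde = azq, the product of the four aq/x^2 divided by q^2 is (a/z)^2. *)
  assert (E1 : ((Cmod a / Cmod z) ^ 2 = / Cmod q ^ 2 *
    (Cmod (a * q / b / b) * Cmod (a * q / c / c) * Cmod (a * q / d / d) *
     Cmod (a * q / e / e)))%R).
  { rewrite <- Cmod_div, <- !Cmod_pow, <- Cmod_inv, <- !Cmod_mult
      by (auto using Cpow_nz).
    f_equal.
    transitivity ((a * z * q) ^ 2 * a * a / (z * z * (a * z * q) ^ 2)).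
    { field. auto. }
    rewrite Hbal at 2. rewrite Cpow_mult_l.
    transitivity ((a * q) ^ 2 * a * a / (b * c * d * e) ^ 2).
    { field. auto. }
    field. auto. }
  assert (E2 : (Cmod y ^ 2 = / Cmod q ^ 2 *
    (Cmod (z * q / f / f) * Cmod (z * q / g / g)))%R).
  { rewrite <- !Cmod_pow, <- Cmod_inv, <- !Cmod_mult by (auto using Cpow_nz).
    f_equal. unfold y. field. auto. }
  rewrite E1, E2, !Rpow_mult_distr, Rmult_1_r.
  rewrite (Cmod_div (z * q) a), Cmod_mult by auto. ring. }
destruct D as (K & HK0 & HK).
(* The largest of the three ratios; its square root is used as s because each ratio is shared
   between the two indices. *)
set (r := Rmax (Cmod q) (Rmax (Cmod (z * q / (f * g))) (Cmod (z * z * q / (a * f * g))))).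
assert (Hr : (0 < r < 1)%R).
{ split.
  - eapply Rlt_le_trans; [apply (proj1 Hq)|apply Rmax_l].
  - repeat apply Rmax_lub_lt; lra. }
assert (B1 : (Cmod q <= r)%R) by apply Rmax_l.
assert (B2 : (Cmod (z * q / (f * g)) <= r)%R)
  by (eapply Rle_trans; [apply Rmax_l|apply Rmax_r]).
assert (B3 : (Cmod (z * z * q / (a * f * g)) <= r)%R)
  by (eapply Rle_trans; [apply Rmax_r|apply Rmax_r]).
assert (Hs2 : (sqrt r * sqrt r = r)%R) by (apply sqrt_sqrt; lra).
assert (Hs0 := sqrt_pos r).
assert (Hs1 : (sqrt r < 1)%R) by nra.
exists K, (sqrt r). split; [lra|]. intros n k.
destruct (Z_lt_le_dec k n) as [Hnk|Hnk].
- rewrite dterm_supported by auto. rewrite Cmod_0.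
  apply Rmult_le_pos; [apply Rmult_le_pos; auto|]; apply pow_le; lra.
- eapply Rle_trans; [apply (HK (n, k))|]. simpl fst. simpl snd.
  rewrite (Rmult_assoc K (_ ^ _)). apply Rmult_le_compat_l; [auto|].
  apply weight_bound; auto; try (apply Cmod_gt_0; auto); try lra.
  + rewrite Hs2. rewrite <- Cmod_mult.
    replace (y * q) with (z * q / (f * g)) by (unfold y; field; auto). auto.
  + rewrite Hs2. rewrite <- !Cmod_mult, <- Cmod_div by auto.
    replace (y * q * z / a) with (z * z * q / (a * f * g))
      by (unfold y; field; auto). auto.
Qed.

(** * Summation over the first index kept fixed *)

Lemma Z_geometric (u : Z -> C) (c : C) :
  c <> 0 -> (forall n, u (n + 1)%Z = c * u n) ->
  forall n, u n = u 0%Z * Cpowz c n.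
Proof.
intros Hc H.
assert (Hp : forall m : nat, u (Z.of_nat m) = u 0%Z * c ^ m).
{ induction m as [|m IH]; [simpl; ring|].
  replace (Z.of_nat (S m)) with (Z.of_nat m + 1)%Z by lia.
  rewrite H, IH. simpl. ring. }
assert (Hm : forall m : nat, u (- Z.of_nat m)%Z = u 0%Z / c ^ m).
{ induction m as [|m IH]; [simpl; field|].
  assert (Hcm := Cpow_nz c m Hc). specialize (H (- Z.of_nat (S m))%Z).
  replace (- Z.of_nat (S m) + 1)%Z with (- Z.of_nat m)%Z in H by lia.
  rewrite IH in H. simpl Cpow.
  replace (u (- Z.of_nat (S m))%Z) with (/ c * (c * u (- Z.of_nat (S m))%Z))
    by (field; auto).
  rewrite <- H. field. auto. }
intros n. destruct (Z_le_gt_dec 0 n) as [Hn|Hn].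
- replace n with (Z.of_nat (Z.to_nat n)) by lia. now rewrite Hp, Cpowz_of_nat.
- replace n with (- Z.of_nat (Z.to_nat (- n)))%Z by lia.
  now rewrite Hm, Cpowz_opp_of_nat.
Qed.

(** The modified Jacobi theta function. Its quasi-periodicity makes suitably matched quotients of
    its values at x q^n geometric in n, which converts products in q^(-n) into products in q^n. *)
Definition theta (q x : C) : C := qinf q x * qinf q (q / x).

Lemma theta_q (q x : C) :
  (0 < Cmod q < 1)%R -> x <> 0 -> theta q (x * q) = - theta q x / x.
Proof.
intros Hq Hx. assert (Hq0 := q_neq0 q Hq). unfold theta.
rewrite (qinf_step q x) by lra.
replace (q / (x * q)) with (1 / x) by (field; auto).
rewrite (qinf_step q (1 / x)) by lra.
replace (1 / x * q) with (q / x) by (field; auto). field. auto.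
Qed.

Lemma off_lattice_q_div (q x : C) :
  q <> 0 -> off_lattice q x -> off_lattice q (q / x).
Proof.
intros Hq H. unfold Cdiv. rewrite Cmult_comm. apply off_lattice_q; auto.
now apply off_lattice_inv.
Qed.

Lemma theta_neq0 (q x : C) :
  (0 < Cmod q < 1)%R -> off_lattice q x -> theta q x <> 0.
Proof.
intros Hq H. assert (Hq0 := q_neq0 q Hq).
apply Cmult_neq_0; apply off_lattice_qinf; auto. now apply off_lattice_q_div.
Qed.

Lemma qratio_reflect_nat (q z x : C) (m : nat) :
  (0 < Cmod q < 1)%R -> z <> 0 -> off_lattice q x -> off_lattice q (z / x) ->
  qratio q (x / z) (q / x) (- Z.of_nat m) =
  (z * q / (x * x)) ^ m * qratio q x (z * q / x) (Z.of_nat m).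
Proof.
intros Hq Hz Hx Hzx. assert (Hq0 := q_neq0 q Hq). assert (x0 := proj1 Hx).
unfold qratio. replace (- Z.of_nat m)%Z with (0 - Z.of_nat m)%Z by lia.
rewrite qpoch_ratio_sub_nat; auto.
2:{ replace (x / z) with (/ (z / x)) by (field; auto). now apply off_lattice_inv. }
2:{ now apply off_lattice_q_div. }
rewrite !qpoch_0, !qpoch_of_nat, Z.sub_0_r, Cpowz_1.
replace (q / (q / x)) with x by (field; auto).
replace (q / (x / z)) with (z * q / x) by (field; auto).
replace (q / x / (x / z)) with (z * q / (x * x)) by (field; auto).
field. apply off_lattice_qprod; auto. now apply off_lattice_mul_q_div.
Qed.

Lemma qratio_reflect (q z x : C) (n : Z) :
  (0 < Cmod q < 1)%R -> z <> 0 -> off_lattice q x -> off_lattice q (z / x) ->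
  qratio q (x / z) (q / x) (- n) =
  Cpowz (z * q / (x * x)) n * qratio q x (z * q / x) n.
Proof.
intros Hq Hz Hx Hzx. assert (Hq0 := q_neq0 q Hq). assert (x0 := proj1 Hx).
destruct (Z_le_gt_dec 0 n) as [Hn|Hn].
- replace n with (Z.of_nat (Z.to_nat n)) by lia.
  rewrite Cpowz_of_nat. now apply qratio_reflect_nat.
- replace n with (- Z.of_nat (Z.to_nat (- n)))%Z by lia.
  set (m := Z.to_nat (- n)).
  (* Replacing (z, x) by (1/z, x/z) exchanges the two sides of the formula, which gives the negative
     indices. *)
  assert (E := qratio_reflect_nat q (1 / z) (x / z) m Hq
    (Cdiv_neq0 _ _ C1_nz Hz)).
  replace (x / z / (1 / z)) with x in E by (field; auto).
  replace (q / (x / z)) with (z * q / x) in E by (field; auto).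
  replace (1 / z * q / (x / z * (x / z))) with (z * q / (x * x)) in E
    by (field; auto).
  replace (1 / z * q / (x / z)) with (q / x) in E by (field; auto).
  rewrite E.
  + rewrite Z.opp_involutive, Cpowz_opp_of_nat. field.
    apply Cpow_nz. apply Cdiv_neq0; auto using Cmult_neq_0.
  + replace (x / z) with (/ (z / x)) by (field; auto). now apply off_lattice_inv.
  + replace (1 / z / (x / z)) with (/ x) by (field; auto). now apply off_lattice_inv.
Qed.

(** What remains of column n besides [jackson_term]. The divisors (aq/b;q)_oo undo the clearing of
    denominators, and (b q^(-n)/z;q)_oo cancels the factor of [jackson_factor] that is constant in
    m; likewise for c, d, e. *)
Definition col_const (q a z b c d e f g : C) (n : Z) : C :=
  (qpoch q b n / (qinf q (a * q / b) * qinf q (b / z * Cpowz q (- n)))) *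
  (qpoch q c n / (qinf q (a * q / c) * qinf q (c / z * Cpowz q (- n)))) *
  (qpoch q d n / (qinf q (a * q / d) * qinf q (d / z * Cpowz q (- n)))) *
  (qpoch q e n / (qinf q (a * q / e) * qinf q (e / z * Cpowz q (- n)))) *
  (qpoch q a (2 * n) / (qinf q (z * q) * qinf q q)) * Cpowz q n *
  ((1 - z * Cpowz q (2 * n)) *
   (qratio q f (z * q / f) n * qratio q g (z * q / g) n) *
   Cpowz (z / (f * g)) n).

Definition col_sum (q a z b c d e : C) (n : Z) : C :=
  total (jackson_term q (a * Cpowz q (2 * n)) (a / z) (b * Cpowz q n)
    (c * Cpowz q n) (d * Cpowz q n) (e * Cpowz q n)).

Lemma inv_qpoch_add (q y : C) (n : Z) (m : nat) :
  (0 < Cmod q < 1)%R -> off_lattice q y ->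
  / qpoch q y (n + Z.of_nat m) = qinf q (y * Cpowz q n * q ^ m) / qinf q y.
Proof.
intros Hq Hy. assert (Hq0 := q_neq0 q Hq). rewrite qpoch_qinf by auto.
rewrite Cpowz_add_nat, Cmult_assoc by auto.
assert (A := off_lattice_qinf q y Hq Hy).
assert (B := off_lattice_qinf_powz q y (n + Z.of_nat m) Hq Hy).
rewrite Cpowz_add_nat, Cmult_assoc in B by auto. field. auto.
Qed.

Lemma qprod_q_inv (q : C) (m : nat) :
  (0 < Cmod q < 1)%R -> / qprod q q m = qinf q (q * q ^ m) / qinf q q.
Proof.
intros Hq. assert (H := qinf_small_neq0 q q (proj2 Hq) (proj2 Hq)).
rewrite (qinf_shift q q m) in H |- * by lra.
assert (qprod q q m <> 0) by (intros E; apply H; rewrite E; ring).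
assert (qinf q (q * q ^ m) <> 0) by (intros E; apply H; rewrite E; ring).
field. auto.
Qed.

Lemma qkernel_of_nat_qinf (q x : C) (m : nat) :
  (0 < Cmod q < 1)%R ->
  qkernel q x (Z.of_nat m) = qprod q x m * (qinf q (q * q ^ m) / qinf q q).
Proof.
intros Hq. rewrite qkernel_of_nat. unfold Cdiv at 1. now rewrite qprod_q_inv.
Qed.

Lemma qratio_add_nat (q x y : C) (n : Z) (m : nat) :
  (0 < Cmod q < 1)%R -> off_lattice q x -> off_lattice q y ->
  qratio q x y (n + Z.of_nat m) =
  qpoch q x n * qprod q (x * Cpowz q n) m *
  (qinf q (y * Cpowz q n * q ^ m) / qinf q y).
Proof.
intros Hq Hx Hy. unfold qratio, Cdiv at 1.
now rewrite qpoch_add_nat, inv_qpoch_add.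
Qed.

(* Read upwards from k = n, the sum over k is a balanced 8-phi-7 with base
   a q^(2n). *)
Lemma dterm_col (q a z b c d e f g : C) (n : Z) (m : nat) :
  (0 < Cmod q < 1)%R -> generic q a z b c d e f g ->
  off_lattice q (b / z) -> off_lattice q (c / z) ->
  off_lattice q (d / z) -> off_lattice q (e / z) ->
  dterm q a z b c d e f g n (n + Z.of_nat m) =
  col_const q a z b c d e f g n *
  jackson_term q (a * Cpowz q (2 * n)) (a / z) (b * Cpowz q n)
    (c * Cpowz q n) (d * Cpowz q n) (e * Cpowz q n) m.
Proof.
intros Hq Hgen Hbz Hcz Hdz Hez. assert (Hq0 := q_neq0 q Hq).
apply generic_inv in Hgen.
destruct Hgen as (Ha & Hz & [Hb Hab] & [Hc Hac] & [Hd Had] & [He Hae] &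
  _ & _ & _).
assert (a0 := proj1 Ha). assert (z0 := proj1 Hz). assert (b0 := proj1 Hb).
assert (c0 := proj1 Hc). assert (d0 := proj1 Hd). assert (e0 := proj1 He).
assert (Qn := Cpowz_neq0 q n Hq0).
assert (Nx : forall x : C, off_lattice q x -> off_lattice q (a / x) ->
  qinf q (a * q / x) <> 0).
{ intros x Hx Hax. apply off_lattice_qinf; auto.
  apply off_lattice_mul_q_div; auto. apply Hx. }
assert (Nz : forall x : C, off_lattice q (x / z) ->
  qinf q (x / z * Cpowz q (- n)) <> 0).
{ intros x Hx. now apply off_lattice_qinf_powz. }
assert (Ez := off_lattice_qinf q _ Hq (off_lattice_q q z Hq0 Hz)).
assert (Eq := qinf_small_neq0 q q (proj2 Hq) (proj2 Hq)).
unfold dterm, col_const, jackson_term, jackson_factor.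
replace (2 * (n + Z.of_nat m))%Z with (2 * n + Z.of_nat m + Z.of_nat m)%Z by lia.
replace (n + Z.of_nat m + n)%Z with (2 * n + Z.of_nat m)%Z by lia.
replace (n + Z.of_nat m - n)%Z with (Z.of_nat m) by lia.
assert (Oy : forall x : C, off_lattice q x -> off_lattice q (a / x) ->
  off_lattice q (a * q / x)).
{ intros x Hx Hax. apply off_lattice_mul_q_div; auto. apply Hx. }
rewrite !qratio_add_nat by (auto using off_lattice_q).
rewrite qkernel_of_nat_qinf by auto.
rewrite !Cpowz_add_nat by auto.
assert (E2 := Cpowz_double q n Hq0).
replace (a * Cpowz q (2 * n) * q / (a / z)) with (z * q * Cpowz q (2 * n))
  by (field; auto).
assert (Ex : forall x : C, x <> 0 -> a * Cpowz q (2 * n) * q / (x * Cpowz q n) =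
  a * q / x * Cpowz q n) by (intros x Hx; rewrite E2; field; auto).
assert (Ey : forall x : C, a / z * (x * Cpowz q n) / (a * Cpowz q (2 * n)) =
  x / z * Cpowz q (- n)).
{ intros x. rewrite E2, Cpowz_opp by auto. field. auto. }
rewrite !Ex, !Ey by auto.
assert (Nb := Nx b Hb Hab). assert (Nc := Nx c Hc Hac).
assert (Nd := Nx d Hd Had). assert (Ne := Nx e He Hae).
assert (Mb := Nz b Hbz). assert (Mc := Nz c Hcz).
assert (Md := Nz d Hdz). assert (Me := Nz e Hez).
set (A := (1 - z * Cpowz q (2 * n)) * _ * Cpowz (z / (f * g)) n).
field. repeat split; auto.
Qed.

(** The part of the double series that depends on n alone is, up to -1/z, invariant under (z, f, g,
    n) -> (1/z, f/z, g/z, -n). This lets the companion of column n be column -n of the image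
    parameters. *)
Lemma vwp_weight_reflect (q z f g : C) (n : Z) :
  (0 < Cmod q < 1)%R -> z <> 0 -> off_lattice q f -> off_lattice q (z / f) ->
  off_lattice q g -> off_lattice q (z / g) ->
  (1 - 1 / z * Cpowz q (2 * - n)) *
  (qratio q (f / z) (q / f) (- n) * qratio q (g / z) (q / g) (- n)) *
  Cpowz (1 / z / (f / z * (g / z))) (- n) =
  - (1 / z) * ((1 - z * Cpowz q (2 * n)) *
  (qratio q f (z * q / f) n * qratio q g (z * q / g) n) * Cpowz (z / (f * g)) n).
Proof.
intros Hq Hz Hf Hzf Hg Hzg. assert (Hq0 := q_neq0 q Hq).
assert (f0 := proj1 Hf). assert (g0 := proj1 Hg).
rewrite !qratio_reflect by auto.
replace (1 / z / (f / z * (g / z))) with (z / (f * g)) by (field; auto).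
assert (N : z / (f * g) <> 0) by (apply Cdiv_neq0; auto using Cmult_neq_0).
assert (Nf : z * q / (f * f) <> 0) by (apply Cdiv_neq0; auto using Cmult_neq_0).
assert (Ng : z * q / (g * g) <> 0) by (apply Cdiv_neq0; auto using Cmult_neq_0).
assert (Qn := Cpowz_neq0 q n Hq0).
assert (E2 := Cpowz_double q n Hq0).
replace (2 * - n)%Z with (- (2 * n))%Z by lia.
rewrite !Cpowz_opp, E2 by auto.
assert (E : Cpowz (z * q / (f * f)) n * Cpowz (z * q / (g * g)) n =
  Cpowz q n * Cpowz q n * (Cpowz (z / (f * g)) n * Cpowz (z / (f * g)) n)).
{ rewrite <- !Cpowz_mult by (auto using Cmult_neq_0). f_equal. field. auto. }
set (X := Cpowz (z * q / (f * f)) n) in *.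
set (Y := Cpowz (z * q / (g * g)) n) in *.
assert (M := Cpowz_neq0 _ n N). set (W := Cpowz (z / (f * g)) n) in *.
set (F := qratio q f (z * q / f) n). set (G := qratio q g (z * q / g) n).
set (Q := Cpowz q n) in *.
transitivity ((1 - 1 / z * / (Q * Q)) * (X * Y) * (F * G) * / W); [ring|].
rewrite E. field. auto.
Qed.

(** By quasi-periodicity the quotient gains a constant factor for each step in n, and bcde = azq
    makes it z/a. Together with q^n and (z/(fg))^n this produces the argument z^2 q/(afg) of the
    series with base z. *)
Lemma theta_product (q z b c d e a : C) (n : Z) :
  (0 < Cmod q < 1)%R -> a <> 0 -> z <> 0 ->
  off_lattice q (b / z) -> off_lattice q (c / z) ->
  off_lattice q (d / z) -> off_lattice q (e / z) ->
  a * z * q = b * c * d * e ->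
  theta q (z * q * Cpowz q (2 * n)) /
  (theta q (z * q / b * Cpowz q n) * theta q (z * q / c * Cpowz q n) *
   theta q (z * q / d * Cpowz q n) * theta q (z * q / e * Cpowz q n)) =
  theta q (z * q) / (theta q (z * q / b) * theta q (z * q / c) *
   theta q (z * q / d) * theta q (z * q / e)) * Cpowz (z / a) n.
Proof.
intros Hq Ha Hz Hb Hc Hd He Hbal. assert (Hq0 := q_neq0 q Hq).
assert (NZ : forall x, off_lattice q (x / z) -> x <> 0).
{ intros x [H _] E. apply H. rewrite E. field. auto. }
assert (b0 := NZ b Hb). assert (c0 := NZ c Hc). assert (d0 := NZ d Hd).
assert (e0 := NZ e He).
assert (O : forall (x : C) (m : Z), off_lattice q (x / z) ->
  theta q (z * q / x * Cpowz q m) <> 0).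
{ intros x m Hx. apply theta_neq0; auto. apply off_lattice_mult; auto.
  replace (z * q / x) with (q / (x / z)) by (field; auto).
  now apply off_lattice_q_div. }
rewrite (Z_geometric (fun n => theta q (z * q * Cpowz q (2 * n)) /
  (theta q (z * q / b * Cpowz q n) * theta q (z * q / c * Cpowz q n) *
   theta q (z * q / d * Cpowz q n) * theta q (z * q / e * Cpowz q n))) (z / a)).
- simpl. now rewrite !Cmult_1_r.
- now apply Cdiv_neq0.
- intros m. assert (Qm := Cpowz_neq0 q m Hq0).
  assert (S : forall x : C, x <> 0 -> theta q (z * q / x * Cpowz q (m + 1)) =
    - theta q (z * q / x * Cpowz q m) / (z * q / x * Cpowz q m)).
  { intros x Hx. rewrite Cpowz_succ, Cmult_assoc by auto. apply theta_q; auto.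
    apply Cmult_neq_0; auto. apply Cdiv_neq0; auto using Cmult_neq_0. }
  rewrite !S by auto.
  assert (E2 := Cpowz_double q m Hq0).
  replace (z * q * Cpowz q (2 * (m + 1))) with (z * q * Cpowz q (2 * m) * q * q).
  2:{ replace (2 * (m + 1))%Z with (2 * m + 1 + 1)%Z by lia.
      rewrite !Cpowz_succ by auto. ring. }
  assert (N2 := Cpowz_neq0 q (2 * m) Hq0).
  rewrite !theta_q by (auto using Cmult_neq_0).
  assert (Tb := O b m Hb). assert (Tc := O c m Hc).
  assert (Td := O d m Hd). assert (Te := O e m He).
  assert (Ea : a = b * c * d * e / (z * q)) by (rewrite <- Hbal; field; auto).
  rewrite Ea, E2. field. repeat split; auto.
Qed.

(** Generalizes each infinite product known to be nonzero to a variable, so that [field] faces an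
    identity of rational functions. *)
Ltac abstract_qinf :=
  repeat match goal with H : qinf _ _ <> _ |- _ =>
    match type of H with ?t <> _ =>
      let x := fresh "X" in set (x := t) in *; clearbody x;
      let K := fresh "NX" in rename H into K; revert K end end;
  intros.

Definition pair_product (q a b c d e : C) : C :=
  qinf q (a * q / (b * c)) * qinf q (a * q / (b * d)) *
  qinf q (a * q / (b * e)) * qinf q (a * q / (c * d)) *
  qinf q (a * q / (c * e)) * qinf q (a * q / (d * e)).

Definition main_coef (q a z b c d e : C) : C :=
  pair_product q a b c d e * qinf q a * qinf q (1 / z) /
  (qinf q (a * q / b) * qinf q (b / z) * (qinf q (a * q / c) * qinf q (c / z)) *
   (qinf q (a * q / d) * qinf q (d / z)) * (qinf q (a * q / e) * qinf q (e / z))).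

Definition companion_coef (q a z b c d e : C) : C :=
  - ((qinf q b * qinf q (a * q / (z * b)) / (qinf q (a * q / b) * qinf q (b / z))) *
     (qinf q c * qinf q (a * q / (z * c)) / (qinf q (a * q / c) * qinf q (c / z))) *
     (qinf q d * qinf q (a * q / (z * d)) / (qinf q (a * q / d) * qinf q (d / z))) *
     (qinf q e * qinf q (a * q / (z * e)) / (qinf q (a * q / e) * qinf q (e / z))) *
     (qinf q a * qinf q (q / z) / (qinf q (z * q) * qinf q (a / (z * z))))).

(** Jackson's sum with base a q^(2n) and second parameter a/z, solved for the first series. The
    companion base is (a/z)^2/(a q^(2n)) = (a/z^2) q^(-2n), and its other parameters are x q^(-n)/z;
    the quotients in [pair_product] do not depend on n. *)
Lemma col_sum_eq (q a z b c d e : C) (n : Z) :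
  (0 < Cmod q < 1)%R -> a <> 0 -> z <> 0 ->
  b <> 0 -> c <> 0 -> d <> 0 -> e <> 0 ->
  off_lattice q (a / (z * z)) -> a * z * q = b * c * d * e ->
  col_sum q a z b c d e n =
  qinf q (a * Cpowz q (2 * n)) * pair_product q a b c d e *
    (qinf q q * qinf q (1 / z * Cpowz q (- (2 * n))) *
     qinf q (z * q * Cpowz q (2 * n))) +
  1 / z * Cpowz q (- (2 * n)) * qinf q (a * Cpowz q (2 * n)) /
    qinf q (a / (z * z) * Cpowz q (- (2 * n))) *
    col_sum q (a / (z * z)) (1 / z) (b / z) (c / z) (d / z) (e / z) (- n).
Proof.
intros Hq Ha Hz Hb Hc Hd He Hazz Hbal. assert (Hq0 := q_neq0 q Hq).
assert (Qn := Cpowz_neq0 q n Hq0).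
assert (E2 := Cpowz_double q n Hq0).
assert (J := jackson_sum q (a * Cpowz q (2 * n)) (a / z) (b * Cpowz q n)
  (c * Cpowz q n) (d * Cpowz q n) (e * Cpowz q n) Hq).
assert (J' := J ltac:(rewrite E2; auto using Cmult_neq_0)
  ltac:(now apply Cdiv_neq0) ltac:(now apply Cmult_neq_0)
  ltac:(now apply Cmult_neq_0) ltac:(now apply Cmult_neq_0)
  ltac:(now apply Cmult_neq_0)). clear J.
assert (B : (a * Cpowz q (2 * n)) ^ 2 * q = a / z * (b * Cpowz q n) *
  (c * Cpowz q n) * (d * Cpowz q n) * (e * Cpowz q n)).
{ transitivity (a / z * (b * c * d * e) * (Cpowz q n) ^ 4).
  - rewrite <- Hbal, E2. field. auto.
  - ring. }
specialize (J' B). clear B.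
unfold jackson in J'. unfold col_sum, pair_product.
replace (2 * - n)%Z with (- (2 * n))%Z by lia.
assert (Ex : forall x : C, a / z * (x * Cpowz q n) / (a * Cpowz q (2 * n)) =
  x / z * Cpowz q (- n)).
{ intros x. rewrite E2, Cpowz_opp by auto. field. auto. }
assert (Ep : forall x y : C, x <> 0 -> y <> 0 ->
  a * Cpowz q (2 * n) * q / (x * Cpowz q n * (y * Cpowz q n)) = a * q / (x * y)).
{ intros x y Hx Hy. rewrite E2. field. auto. }
rewrite !Ex, !Ep in J' by auto.
replace (a / z * (a / z) / (a * Cpowz q (2 * n)))
  with (a / (z * z) * Cpowz q (- (2 * n))) in J'
  by (rewrite Cpowz_opp, E2 by auto; field; auto).
replace (a / z / (a * Cpowz q (2 * n))) with (1 / z * Cpowz q (- (2 * n))) in J'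
  by (rewrite Cpowz_opp, E2 by auto; field; auto).
replace (a * Cpowz q (2 * n) * q / (a / z)) with (z * q * Cpowz q (2 * n)) in J'
  by (field; auto).
replace (a / (z * z) / (1 / z)) with (a / z) by (field; auto).
assert (N := off_lattice_qinf_powz q _ (- (2 * n)) Hq Hazz).
set (P := qinf q (a / (z * z) * Cpowz q (- (2 * n)))) in *.
set (T' := total (jackson_term q (a / (z * z) * Cpowz q (- (2 * n))) _ _ _ _ _))
  in *.
set (T := total (jackson_term q (a * Cpowz q (2 * n)) _ _ _ _ _)) in *.
set (u := 1 / z * Cpowz q (- (2 * n))) in *.
replace T with ((P * T - u * qinf q (a * Cpowz q (2 * n)) * T' +
  u * qinf q (a * Cpowz q (2 * n)) * T') / P) by (field; auto).
rewrite J'. field. auto.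
Qed.

(** In the product part of [col_sum_eq] the products in q^(-n) and q^(-2n) combine into thetas, and
    [theta_product] leaves the term of base z. In the companion part all dependence on n is absorbed
    into the constant of column -n. *)
Lemma col_identity (q a z b c d e f g : C) (n : Z) :
  (0 < Cmod q < 1)%R -> generic q a z b c d e f g ->
  generic q (a / (z * z)) (1 / z) (b / z) (c / z) (d / z) (e / z) (f / z) (g / z) ->
  col_const q a z b c d e f g n * col_sum q a z b c d e n =
  main_coef q a z b c d e * (1 - z) *
    vwp_term q z [b; c; d; e; f; g] (z * z * q / (a * f * g)) n +
  companion_coef q a z b c d e *
    (col_const q (a / (z * z)) (1 / z) (b / z) (c / z) (d / z) (e / z) (f / z)
      (g / z) (- n) *
     col_sum q (a / (z * z)) (1 / z) (b / z) (c / z) (d / z) (e / z) (- n)).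
Proof.
intros Hq Hgen Hgen'. assert (Hq0 := q_neq0 q Hq).
apply generic_inv in Hgen. apply generic_inv in Hgen'.
destruct Hgen as (Ha & Hz & [Hb Hab] & [Hc Hac] & [Hd Had] & [He Hae] &
  (Hf & Hzf & _) & (Hg & Hzg & _) & Hbal).
destruct Hgen' as (Ha' & Hz' & [Hb' Hab'] & [Hc' Hac'] & [Hd' Had'] & [He' Hae'] &
  _ & _ & _).
assert (a0 := proj1 Ha). assert (z0 := proj1 Hz). assert (b0 := proj1 Hb).
assert (c0 := proj1 Hc). assert (d0 := proj1 Hd). assert (e0 := proj1 He).
assert (f0 := proj1 Hf). assert (g0 := proj1 Hg).
assert (Qn := Cpowz_neq0 q n Hq0).
rewrite (col_sum_eq q a z b c d e n) by auto.
set (S := col_sum q (a / (z * z)) _ _ _ _ _ _).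
assert (Ex : forall x : C, x <> 0 -> a / (z * z) * q / (x / z) = a * q / (z * x))
  by (intros x Hx; field; auto).
assert (Ey : forall x : C, x / z / (1 / z) = x) by (intros x; field; auto).
assert (Ez : forall x : C, x <> 0 -> 1 / z * q / (x / z) = q / x)
  by (intros x Hx; field; auto).
unfold col_const. rewrite !Ex, !Ey, !Ez, Z.opp_involutive by auto.
rewrite vwp_weight_reflect by auto.
replace (1 / z * q) with (q / z) by (field; auto).
assert (W : vwp_term q z [b; c; d; e; f; g] (z * z * q / (a * f * g)) n =
  qratio q b (z * q / b) n * qratio q c (z * q / c) n *
  qratio q d (z * q / d) n * qratio q e (z * q / e) n *
  Cpowz q n * Cpowz (z / a) n *
  ((1 - z * Cpowz q (2 * n)) *
   (qratio q f (z * q / f) n * qratio q g (z * q / g) n) *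
   Cpowz (z / (f * g)) n) / (1 - z)).
{ unfold vwp_term, Cprod. simpl fold_right. unfold qratio.
  replace (Cpowz (z * z * q / (a * f * g)) n)
    with (Cpowz q n * Cpowz (z / a) n * Cpowz (z / (f * g)) n).
  2:{ rewrite <- !Cpowz_mult; try (apply Cdiv_neq0); auto using Cmult_neq_0.
      - f_equal. field. auto.
      - apply Cmult_neq_0; auto. now apply Cdiv_neq0. }
  unfold Cdiv. ring. }
rewrite W. clear W.
set (al := (1 - z * Cpowz q (2 * n)) * _ * Cpowz (z / (f * g)) n).
assert (N1 := off_lattice_neq1 q z Hz).
assert (T := theta_product q z b c d e a n Hq a0 z0 Hb' Hc' Hd' He' Hbal).
assert (Oq : forall x : C, x <> 0 -> off_lattice q (x / z) ->
  off_lattice q (z * q / x)).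
{ intros x Hx H. replace (z * q / x) with (q / (x / z)) by (field; auto).
  now apply off_lattice_q_div. }
unfold theta in T.
assert (Et : forall x : C, x <> 0 -> q / (z * q / x * Cpowz q n) =
  x / z * Cpowz q (- n)).
{ intros x Hx. rewrite Cpowz_opp by auto. field. auto. }
assert (Et0 : forall x : C, x <> 0 -> q / (z * q / x) = x / z)
  by (intros x Hx; field; auto).
rewrite !Et, !Et0 in T by auto.
replace (q / (z * q * Cpowz q (2 * n))) with (1 / z * Cpowz q (- (2 * n))) in T
  by (rewrite Cpowz_opp by auto; assert (H := Cpowz_neq0 q (2 * n) Hq0);
      field; auto).
replace (q / (z * q)) with (1 / z) in T by (field; auto).
assert (Hn1 : forall x : C, off_lattice q x -> qinf q x <> 0)
  by (intros; now apply off_lattice_qinf).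
assert (Hn2 : forall (x : C) m, off_lattice q x -> qinf q (x * Cpowz q m) <> 0)
  by (intros; now apply off_lattice_qinf_powz).
unfold qratio.
rewrite !(qpoch_qinf q) by (auto using off_lattice_q).
replace (2 * - n)%Z with (- (2 * n))%Z by lia.
unfold main_coef, companion_coef.
set (Pp := pair_product q a b c d e).
assert (Haz : forall x : C, x <> 0 -> off_lattice q (a / (z * z) / (x / z)) ->
  qinf q (a * q / (z * x)) <> 0).
{ intros x Hx H. apply Hn1.
  replace (a * q / (z * x)) with (a / (z * z) / (x / z) * q) by (field; auto).
  now apply off_lattice_q. }
(* The power q^n of the column times the companion weight q^(-2n) is the power required in column
   -n. *)
assert (EQ : Cpowz q (- n) = Cpowz q n * Cpowz q (- (2 * n))).
{ rewrite <- Cpowz_add by auto. f_equal. lia. }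
pose proof (qinf_small_neq0 q q (proj2 Hq) (proj2 Hq)).
pose proof (Hn1 _ (off_lattice_q q z Hq0 Hz)).
pose proof (Hn1 _ Ha'). pose proof (Hn2 _ (2 * n)%Z Ha).
pose proof (Hn2 _ (- (2 * n))%Z Ha').
pose proof (Hn1 _ (off_lattice_q_div q z Hq0 Hz)).
let nonzero x x0 Hx Hax Hx' Hax' := (
  pose proof (Hn2 _ n Hx);
  pose proof (Hn1 _ (off_lattice_mul_q_div q a x Hq0 x0 Hax));
  pose proof (Hn1 _ Hx'); pose proof (Hn2 _ (- n)%Z Hx');
  pose proof (Hn1 _ (Oq x x0 Hx')); pose proof (Hn2 _ n (Oq x x0 Hx'));
  pose proof (Haz x x0 Hax')) in
nonzero b b0 Hb Hab Hb' Hab'; nonzero c c0 Hc Hac Hc' Hac';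
nonzero d d0 Hd Had Hd' Had'; nonzero e e0 He Hae He' Hae'.
abstract_qinf.
rewrite Cmult_plus_distr_l. apply (f_equal2 Cplus).
(* The theta quotient is cleared of its denominator and its numerator is isolated in the goal as a
   single factor [U * V]. *)
- match type of T with ?u / ?v = ?w =>
    assert (T' : u = w * v) end.
  { rewrite <- T. field. repeat split; auto. }
  match type of T' with ?u * ?v = _ =>
    set (U := u) in *; set (V := v) in *; clearbody U V end.
  match goal with |- ?l * (?x * ?p * (?y * V * U)) = _ =>
    transitivity (l * (x * p * y) * (U * V)); [ring|] end.
  rewrite T'. field. repeat split; auto.
- rewrite EQ. field. repeat split; auto.
Qed.

(** * Summation over the second index kept fixed *)

(** Each step in n divides the two thetas by minus their arguments, so their quotient is multiplied
    by y/x. *)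
Lemma theta_ratio (q x y : C) (n : Z) :
  (0 < Cmod q < 1)%R -> x <> 0 -> off_lattice q y ->
  theta q (x * Cpowz q n) =
  theta q (y * Cpowz q n) * (theta q x / theta q y * Cpowz (y / x) n).
Proof.
intros Hq Hx Hy. assert (Hq0 := q_neq0 q Hq). assert (y0 := proj1 Hy).
assert (N : forall m, theta q (y * Cpowz q m) <> 0).
{ intros m. apply theta_neq0; auto. now apply off_lattice_mult. }
assert (E := Z_geometric (fun n => theta q (x * Cpowz q n) /
  theta q (y * Cpowz q n)) (y / x) (Cdiv_neq0 _ _ y0 Hx)).
cbv beta in E. simpl (Cpowz q 0) in E. rewrite !Cmult_1_r in E.
rewrite <- E.
- field. auto.
- intros m. rewrite Cpowz_succ, !Cmult_assoc by auto.
  assert (Qm := Cpowz_neq0 q m Hq0).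
  rewrite !theta_q by (auto using Cmult_neq_0). specialize (N m).
  field. auto.
Qed.

(** The factor - z q^(2k) comes from turning 1 - z q^(2(k-m)) into the very-well-poised factor 1 -
    q^(2m-2k)/z of the reversed row. *)
Definition row_const (q a z b c d e f g : C) (k : Z) : C :=
  (1 - a * Cpowz q (2 * k)) *
  (qratio q b (a * q / b) k * qratio q c (a * q / c) k *
   qratio q d (a * q / d) k * qratio q e (a * q / e) k) *
  qratio q a (z * q) (2 * k) * Cpowz q k * (- z * Cpowz q (2 * k)) *
  (qratio q f (z * q / f) k * qratio q g (z * q / g) k) *
  Cpowz (z / (f * g)) k /
  (qinf q q * qinf q (q / a * Cpowz q (- (2 * k))) *
   qinf q (q / f * Cpowz q (- k)) * qinf q (q / g * Cpowz q (- k))).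

Lemma inv_qprod (q y : C) (m : nat) :
  (0 < Cmod q < 1)%R -> off_lattice q y ->
  / qprod q y m = qinf q (y * q ^ m) / qinf q y.
Proof.
intros Hq Hy. assert (E := inv_qpoch_add q y 0 m Hq Hy). simpl in E.
rewrite Cmult_1_r in E. rewrite <- E. now rewrite qpoch_of_nat.
Qed.

Lemma Cpow_div (x y : C) (m : nat) : y <> 0 -> (x / y) ^ m = x ^ m / y ^ m.
Proof. intros Hy. unfold Cdiv. now rewrite Cpow_mult_l, Cpow_inv. Qed.

(* Read downwards from n = k, the sum over n is a 6-phi-5 with base q^(-2k)/z. *)
Lemma dterm_row (q a z b c d e f g : C) (k : Z) (m : nat) :
  (0 < Cmod q < 1)%R -> generic q a z b c d e f g ->
  dterm q a z b c d e f g (k - Z.of_nat m) k =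
  row_const q a z b c d e f g k *
  phi65_term q (1 / z * Cpowz q (- (2 * k))) (a / z) (f / z * Cpowz q (- k))
    (g / z * Cpowz q (- k)) (z * z * q / (a * f * g)) m.
Proof.
intros Hq Hgen. assert (Hq0 := q_neq0 q Hq).
apply generic_inv in Hgen.
destruct Hgen as (Ha & Hz & [Hb Hab] & [Hc Hac] & [Hd Had] & [He Hae] &
  (Hf & Hzf & _) & (Hg & Hzg & _) & Hbal).
assert (a0 := proj1 Ha). assert (z0 := proj1 Hz).
assert (f0 := proj1 Hf). assert (g0 := proj1 Hg).
assert (Qk := Cpowz_neq0 q k Hq0). assert (Qm := Cpow_nz q m Hq0).
unfold dterm, row_const, phi65_term.
replace (k + (k - Z.of_nat m))%Z with (2 * k - Z.of_nat m)%Z by lia.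
replace (k - (k - Z.of_nat m))%Z with (Z.of_nat m) by lia.
rewrite qkernel_of_nat_qinf by auto.
assert (R : forall (x y : C) (n : Z), off_lattice q x -> off_lattice q y ->
  qratio q x y (n - Z.of_nat m) = qratio q x y n * ((y / x) ^ m *
    (qprod q (q / y * Cpowz q (- n)) m *
     (qinf q (q / x * Cpowz q (- n) * q ^ m) / qinf q (q / x * Cpowz q (- n)))))).
{ intros x y n Hx Hy. unfold qratio. rewrite qpoch_ratio_sub_nat by auto.
  assert (Ox : off_lattice q (q / x * Cpowz q (- n)))
    by (apply off_lattice_mult; auto; now apply off_lattice_q_div).
  assert (EQ : forall t : C, t <> 0 -> Cpowz q (1 - n) / t = q / t * Cpowz q (- n)).
  { intros t Ht. unfold Z.sub. rewrite Cpowz_add, Cpowz_1 by auto. field. auto. }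
  rewrite !EQ by (apply Hx || apply Hy).
  assert (I := inv_qprod q _ m Hq Ox).
  set (B := qprod q (q / x * Cpowz q (- n)) m) in *.
  unfold Cdiv at 2 3. rewrite I. reflexivity. }
rewrite !R by (auto using off_lattice_q, off_lattice_mul_q_div).
replace (q / (z * q)) with (1 / z) by (field; auto).
replace (q / (z * q / f)) with (f / z) by (field; auto).
replace (q / (z * q / g)) with (g / z) by (field; auto).
assert (E2 := Cpowz_double q k Hq0).
assert (E2' : Cpowz q (- (2 * k)) = / (Cpowz q k * Cpowz q k))
  by (rewrite Cpowz_opp, E2; auto).
replace (1 / z * Cpowz q (- (2 * k)) * q / (a / z))
  with (q / a * Cpowz q (- (2 * k))) by (field; auto).
assert (EX : forall x : C, x <> 0 -> 1 / z * Cpowz q (- (2 * k)) * q /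
  (x / z * Cpowz q (- k)) = q / x * Cpowz q (- k)).
{ intros x Hx. rewrite E2', Cpowz_opp by auto. field. auto. }
rewrite !EX by auto.
replace (2 * (k - Z.of_nat m))%Z with (2 * k - Z.of_nat m - Z.of_nat m)%Z by lia.
replace (Cpowz q (2 * k - Z.of_nat m - Z.of_nat m))
  with (Cpowz q (2 * k) / (q ^ m * q ^ m)).
2:{ unfold Z.sub. rewrite !Cpowz_add, !Cpowz_opp_of_nat by auto. field. auto. }
assert (y0 : z / (f * g) <> 0) by (apply Cdiv_neq0; auto using Cmult_neq_0).
replace (Cpowz (z / (f * g)) (k - Z.of_nat m))
  with (Cpowz (z / (f * g)) k / (z / (f * g)) ^ m).
2:{ unfold Z.sub. rewrite Cpowz_add, Cpowz_opp_of_nat by auto. reflexivity. }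
replace (1 - z * (Cpowz q (2 * k) / (q ^ m * q ^ m)))
  with (- z * Cpowz q (2 * k) * ((1 - 1 / z * Cpowz q (- (2 * k)) * q ^ m * q ^ m) /
    (q ^ m * q ^ m))).
2:{ rewrite E2', E2. field. auto. }
assert (EW : (z * z * q / (a * f * g)) ^ m = (z * q / a) ^ m *
  (z * q / f / f) ^ m * (z * q / g / g) ^ m / ((z / (f * g)) ^ m * (q ^ m * q ^ m))).
{ rewrite <- !Cpow_mult_l, <- Cpow_div by (auto using Cmult_neq_0).
  f_equal. field. auto. }
rewrite EW.
assert (N : forall (x : C) n, off_lattice q x -> qinf q (q / x * Cpowz q n) <> 0).
{ intros x n Hx. apply off_lattice_qinf_powz; auto. now apply off_lattice_q_div. }
assert (Na := N a (- (2 * k))%Z Ha). assert (Nf := N f (- k)%Z Hf).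
assert (Ng := N g (- k)%Z Hg). assert (ym := Cpow_nz _ m y0).
assert (Nq := qinf_small_neq0 q q (proj2 Hq) (proj2 Hq)).
field. repeat split; auto.
Qed.

Definition row_coef (q a z f g : C) : C :=
  - z * qinf q (1 / z) * (qinf q (z * q / (a * f)) * qinf q (z * q / (a * g))) *
  qinf q (z * q / (f * g)) /
  (qinf q (q / a) * (qinf q (q / f) * qinf q (q / g)) *
   qinf q (z * z * q / (a * f * g))).

(** The value of the 6-phi-5 has arguments in q^(-k) and q^(-2k). Completing them to thetas and
    comparing with a, f, g by [theta_ratio] brings back arguments in q^k; f and g are thereby
    exchanged for af/z and ag/z. *)
Lemma row_value (q a z b c d e f g : C) (k : Z) :
  (0 < Cmod q < 1)%R -> generic q a z b c d e f g ->
  (Cmod (z * z * q / (a * f * g)) < 1)%R ->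
  row_const q a z b c d e f g k *
  (qinf q q * qinf q (1 / z * Cpowz q (- (2 * k))) *
   qinf q (z * q / (a * f) * Cpowz q (- k)) *
   qinf q (z * q / (a * g) * Cpowz q (- k)) * qinf q (z * q / (f * g)) /
   qinf q (z * z * q / (a * f * g))) =
  row_coef q a z f g * (1 - a) *
  vwp_term q a [b; c; d; e; a * f / z; a * g / z] (z * q / (f * g)) k.
Proof.
intros Hq Hgen W1. assert (Hq0 := q_neq0 q Hq).
apply generic_inv in Hgen.
destruct Hgen as (Ha & Hz & _ & _ & _ & _ &
  (Hf & Hzf & Hh) & (Hg & Hzg & Hj) & _).
assert (a0 := proj1 Ha). assert (z0 := proj1 Hz).
assert (f0 := proj1 Hf). assert (g0 := proj1 Hg).
assert (Qk := Cpowz_neq0 q k Hq0).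
set (h := a * f / z) in *. set (j := a * g / z) in *.
assert (h0 := proj1 Hh). assert (j0 := proj1 Hj).
assert (T1 := theta_ratio q (z * q) a (2 * k) Hq ltac:(now apply Cmult_neq_0) Ha).
assert (T2 := theta_ratio q h f k Hq h0 Hf).
assert (T3 := theta_ratio q j g k Hq j0 Hg).
unfold theta in T1, T2, T3.
assert (ET : forall (x : C) n, x <> 0 -> q / (x * Cpowz q n) = q / x * Cpowz q (- n)).
{ intros x n Hx. assert (H := Cpowz_neq0 q n Hq0).
  rewrite Cpowz_opp by auto. field. auto. }
rewrite !ET in T1, T2, T3 by (auto using Cmult_neq_0).
replace (q / (z * q)) with (1 / z) in T1 by (field; auto).
replace (f / h) with (z / a) in T2 by (unfold h; field; auto).
replace (g / j) with (z / a) in T3 by (unfold j; field; auto).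
unfold row_const, row_coef.
replace (z * q / (a * f)) with (q / h) by (unfold h; field; auto).
replace (z * q / (a * g)) with (q / j) by (unfold j; field; auto).
assert (W : vwp_term q a [b; c; d; e; h; j] (z * q / (f * g)) k =
  (1 - a * Cpowz q (2 * k)) *
  (qratio q b (a * q / b) k * qratio q c (a * q / c) k *
   qratio q d (a * q / d) k * qratio q e (a * q / e) k) *
  (qratio q h (z * q / f) k * qratio q j (z * q / g) k) *
  (Cpowz q k * Cpowz (z / (f * g)) k) / (1 - a)).
{ unfold vwp_term, Cprod. simpl fold_right. unfold qratio.
  replace (a * q / h) with (z * q / f) by (unfold h; field; auto).
  replace (a * q / j) with (z * q / g) by (unfold j; field; auto).
  rewrite <- Cpowz_mult; [|auto|apply Cdiv_neq0; auto using Cmult_neq_0].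
  replace (q * (z / (f * g))) with (z * q / (f * g)) by (field; auto).
  unfold Cdiv. ring. }
rewrite W. clear W.
(* The geometric factors of the three theta quotients cancel the power q^(2k) contained in
   [row_const]. *)
assert (EP : Cpowz q (2 * k) * (Cpowz (a / (z * q)) (2 * k) *
  (Cpowz (z / a) k * Cpowz (z / a) k)) = 1).
{ replace (2 * k)%Z with (k + k)%Z by lia.
  assert (za : z / a <> 0) by now apply Cdiv_neq0.
  assert (azq : a / (z * q) <> 0) by (apply Cdiv_neq0; auto using Cmult_neq_0).
  rewrite !Cpowz_add by auto.
  assert (E : Cpowz q k * Cpowz (a / (z * q)) k * Cpowz (z / a) k = 1).
  { rewrite <- !Cpowz_mult by (auto using Cmult_neq_0).
    replace (q * (a / (z * q)) * (z / a)) with (RtoC 1) by (field; auto).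
    destruct k; simpl; [auto|apply Cpow_1_l|]. rewrite Cpow_1_l. field. }
  transitivity ((Cpowz q k * Cpowz (a / (z * q)) k * Cpowz (z / a) k) *
    (Cpowz q k * Cpowz (a / (z * q)) k * Cpowz (z / a) k)); [ring|].
  rewrite E. ring. }
unfold qratio at 5 6 7 12 13.
rewrite !(qpoch_qinf q) by (auto using off_lattice_q, off_lattice_mul_q_div).
assert (N1 := off_lattice_neq1 q a Ha).
assert (Hn : forall (x : C) m, off_lattice q x -> qinf q (x * Cpowz q m) <> 0)
  by (intros; now apply off_lattice_qinf_powz).
assert (Hd : forall (x : C) m, off_lattice q x -> qinf q (q / x * Cpowz q m) <> 0)
  by (intros; apply Hn; now apply off_lattice_q_div).
assert (Hn0 : forall x : C, off_lattice q x -> qinf q x <> 0)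
  by (intros; now apply off_lattice_qinf).
assert (Hd0 : forall x : C, off_lattice q x -> qinf q (q / x) <> 0)
  by (intros; apply Hn0; now apply off_lattice_q_div).
pose proof (qinf_small_neq0 q q (proj2 Hq) (proj2 Hq)).
pose proof (qinf_small_neq0 q _ (proj2 Hq) W1).
pose proof (Hn0 _ Ha).
pose proof (Hd0 _ Ha).
pose proof (Hn _ (2 * k)%Z Ha).
pose proof (Hd _ (- (2 * k))%Z Ha).
pose proof (Hn0 _ (off_lattice_q q z Hq0 Hz)).
pose proof (Hn _ (2 * k)%Z (off_lattice_q q z Hq0 Hz)).
pose proof (Hn0 _ Hf).
pose proof (Hd0 _ Hf).
pose proof (Hn _ k Hf).
pose proof (Hd _ (- k)%Z Hf).
pose proof (Hn0 _ Hg).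
pose proof (Hd0 _ Hg).
pose proof (Hn _ k Hg).
pose proof (Hd _ (- k)%Z Hg).
pose proof (Hn0 _ Hh).
pose proof (Hn _ k Hh).
pose proof (Hn0 _ Hj).
pose proof (Hn _ k Hj).
pose proof (Hn0 _ (off_lattice_mul_q_div q z f Hq0 f0 Hzf)).
pose proof (Hn _ k (off_lattice_mul_q_div q z f Hq0 f0 Hzf)).
pose proof (Hn0 _ (off_lattice_mul_q_div q z g Hq0 g0 Hzg)).
pose proof (Hn _ k (off_lattice_mul_q_div q z g Hq0 g0 Hzg)).
(* Each product in a negative power is completed to a theta so that [T1], [T2], [T3] apply. *)
replace (qinf q (1 / z * Cpowz q (- (2 * k)))) with
  (qinf q (z * q * Cpowz q (2 * k)) * qinf q (1 / z * Cpowz q (- (2 * k))) /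
   qinf q (z * q * Cpowz q (2 * k))) by (field; auto).
replace (qinf q (q / h * Cpowz q (- k))) with
  (qinf q (h * Cpowz q k) * qinf q (q / h * Cpowz q (- k)) /
   qinf q (h * Cpowz q k)) by (field; auto).
replace (qinf q (q / j * Cpowz q (- k))) with
  (qinf q (j * Cpowz q k) * qinf q (q / j * Cpowz q (- k)) /
   qinf q (j * Cpowz q k)) by (field; auto).
rewrite T1, T2, T3. clear T1 T2 T3.
match type of EP with ?u = _ => match goal with |- _ = ?r =>
  transitivity (r * u); [|rewrite EP; ring] end end.
clear EP ET Hn Hd Hn0 Hd0.
abstract_qinf.
field. repeat split; auto.
Qed.

(** * The transformation for generic parameters *)

Lemma Cmult_cancel_l (k u v : C) : k <> 0 -> k * u = k * v -> u = v.
Proof.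
intros Hk E. replace u with (/ k * (k * u)) by (field; auto).
rewrite E. field. auto.
Qed.

(** Columns are summed in k by Jackson's series and rows in n by the 6-phi-5. The common value l
    stays unnamed, because only the equality of the two iterated sums matters. *)
Lemma double_sum (q a z b c d e f g : C) :
  (0 < Cmod q < 1)%R -> generic q a z b c d e f g ->
  off_lattice q (b / z) -> off_lattice q (c / z) ->
  off_lattice q (d / z) -> off_lattice q (e / z) ->
  (Cmod (z * q / (f * g)) < 1)%R -> (Cmod (z * z * q / (a * f * g)) < 1)%R ->
  exists l,
    is_biseries (fun n => col_const q a z b c d e f g n * col_sum q a z b c d e n) l /\
    is_biseries (fun k => row_coef q a z f g * (1 - a) *
      vwp_term q a [b; c; d; e; a * f / z; a * g / z] (z * q / (f * g)) k) l.
Proof.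
intros Hq Hgen Hb Hc Hd He W2 W1. assert (Hq0 := q_neq0 q Hq).
destruct (dterm_bound q a z b c d e f g Hq Hgen W2 W1) as (K & s & Hs & HK).
assert (Hcol : forall n, is_biseries (dterm q a z b c d e f g n)
  (col_const q a z b c d e f g n * col_sum q a z b c d e n)).
{ intros n. apply is_biseries_supported with n.
  - intros k Hk. now apply dterm_supported.
  - apply has_sum_ext with (fun m => col_const q a z b c d e f g n *
      jackson_term q (a * Cpowz q (2 * n)) (a / z) (b * Cpowz q n)
        (c * Cpowz q n) (d * Cpowz q n) (e * Cpowz q n) m).
    + intros m. symmetry. now apply dterm_col.
    + apply has_sum_scal. now apply jackson_term_has_sum. }
assert (Hrow : forall k, is_biseries (fun n => dterm q a z b c d e f g n k)
  (row_coef q a z f g * (1 - a) *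
      vwp_term q a [b; c; d; e; a * f / z; a * g / z] (z * q / (f * g)) k)).
{ intros k. rewrite <- (row_value q a z b c d e f g k) by auto.
  assert (Hgen2 := Hgen). apply generic_inv in Hgen2.
  destruct Hgen2 as (Ha & Hz & _ & _ & _ & _ & (Hf & _ & _) & (Hg & _ & _) & _).
  assert (a0 := proj1 Ha). assert (z0 := proj1 Hz).
  assert (f0 := proj1 Hf). assert (g0 := proj1 Hg).
  assert (Qk := Cpowz_neq0 q k Hq0).
  assert (E2 : Cpowz q (- (2 * k)) = / (Cpowz q k * Cpowz q k)).
  { rewrite Cpowz_opp by auto. f_equal. rewrite <- Cpowz_add by auto.
    f_equal. lia. }
  apply is_biseries_supported_le with k.
  - intros n Hn. now apply dterm_supported.
  - apply has_sum_ext with (fun m => row_const q a z b c d e f g k *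
      phi65_term q (1 / z * Cpowz q (- (2 * k))) (a / z) (f / z * Cpowz q (- k))
        (g / z * Cpowz q (- k)) (z * z * q / (a * f * g)) m).
    + intros m. symmetry. now apply dterm_row.
    + apply has_sum_scal.
      assert (Qk' := Cpowz_neq0 q (- k) Hq0).
      assert (Q2k' := Cpowz_neq0 q (- (2 * k)) Hq0).
      assert (EX : forall x : C, x <> 0 -> 1 / z * Cpowz q (- (2 * k)) * q /
        (a / z * (x / z * Cpowz q (- k))) = z * q / (a * x) * Cpowz q (- k)).
      { intros x Hx. rewrite E2, Cpowz_opp by auto. field. auto. }
      rewrite <- !EX by auto.
      replace (z * q / (f * g)) with (1 / z * Cpowz q (- (2 * k)) * q /
        (f / z * Cpowz q (- k) * (g / z * Cpowz q (- k))))
        by (rewrite E2, Cpowz_opp by auto; field; auto).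
      apply has_sum_phi65; auto 6 using Cmult_neq_0, Cdiv_neq0, C1_nz.
      rewrite E2, Cpowz_opp by auto. field. auto. }
destruct (ex_is_biseries (2 * K / (1 - s)) s
  (fun n => col_const q a z b c d e f g n * col_sum q a z b c d e n) Hs)
  as [l Hl].
{ intros n. eapply Rle_trans.
  - apply (is_biseries_bound (K * s ^ Z.abs_nat n) s _ _ Hs) with (2 := Hcol n).
    intros k. specialize (HK n k). lra.
  - right. field. lra. }
exists l. split; [exact Hl|].
exact (is_biseries_exchange K s _ _ _ l Hs HK Hcol Hrow Hl).
Qed.

(* The coefficients of the three series, all multiplied by
   (q/a;q)_oo / (1/z;q)_oo: they remain finite when a or z is a power of q. *)
Definition coef_a (q a z f g : C) : C :=
  - z * (1 - a) * (qinf q (z * q / (a * f)) * qinf q (z * q / (a * g))) *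
  qinf q (z * q / (f * g)) /
  (qinf q (q / f) * qinf q (q / g) * qinf q (z * z * q / (a * f * g))).

Definition coef_z (q a z b c d e : C) : C :=
  qinf q (q / a) * (1 - z) * pair_product q a b c d e * qinf q a /
  (qinf q (a * q / b) * qinf q (b / z) * (qinf q (a * q / c) * qinf q (c / z)) *
   (qinf q (a * q / d) * qinf q (d / z)) * (qinf q (a * q / e) * qinf q (e / z))).

Definition coef_dual (q a z b c d e f g : C) : C :=
  - (qinf q (q / a) * qinf q a *
     (qinf q b * qinf q (a * q / (z * b)) / (qinf q (a * q / b) * qinf q (b / z)) *
      (qinf q c * qinf q (a * q / (z * c)) / (qinf q (a * q / c) * qinf q (c / z))) *
      (qinf q d * qinf q (a * q / (z * d)) / (qinf q (a * q / d) * qinf q (d / z))) *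
      (qinf q e * qinf q (a * q / (z * e)) / (qinf q (a * q / e) * qinf q (e / z)))) *
     (qinf q (z * z * q / (a * f)) * qinf q (z * z * q / (a * g)) *
      qinf q (z * q / (f * g))) /
     (qinf q (a * q / (z * z)) * (qinf q (z * z * q / a) *
      (qinf q (z * q / f) * qinf q (z * q / g)) *
      qinf q (z * z * q / (a * f * g))))).

(** [double_sum] for the given parameters and for their images expresses l by Sa and l' by Sd.
    Summing [col_identity] over n, with n -> -n in the companion part, gives l in terms of Sz and
    l'. *)
Lemma generic_identity (q a z b c d e f g Sa Sz Sd : C) :
  (0 < Cmod q < 1)%R -> generic q a z b c d e f g ->
  generic q (a / (z * z)) (1 / z) (b / z) (c / z) (d / z) (e / z) (f / z) (g / z) ->
  (Cmod (z * q / (f * g)) < 1)%R -> (Cmod (z * z * q / (a * f * g)) < 1)%R ->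
  is_biseries (vwp_term q a [b; c; d; e; a * f / z; a * g / z] (z * q / (f * g))) Sa ->
  is_biseries (vwp_term q z [b; c; d; e; f; g] (z * z * q / (a * f * g))) Sz ->
  is_biseries (vwp_term q (a / (z * z)) [b / z; c / z; d / z; e / z;
    a * f / z / z; a * g / z / z] (z * q / (f * g))) Sd ->
  coef_a q a z f g * Sa =
  coef_z q a z b c d e * Sz + coef_dual q a z b c d e f g * Sd.
Proof.
intros Hq Hgen Hgen' W2 W1 HSa HSz HSd. assert (Hq0 := q_neq0 q Hq).
assert (I := generic_inv _ _ _ _ _ _ _ _ _ Hgen).
assert (I' := generic_inv _ _ _ _ _ _ _ _ _ Hgen').
destruct I as (Ha & Hz & [Hb Hab] & [Hc Hac] & [Hd Had] & [He Hae] &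
  (Hf & Hzf & Hh) & (Hg & Hzg & Hj) & Hbal).
destruct I' as (Ha' & Hz' & [Hb' Hab'] & [Hc' Hac'] & [Hd' Had'] & [He' Hae'] &
  (Hf' & Hzf' & Hh') & (Hg' & Hzg' & Hj') & Hbal').
assert (a0 := proj1 Ha). assert (z0 := proj1 Hz). assert (b0 := proj1 Hb).
assert (c0 := proj1 Hc). assert (d0 := proj1 Hd). assert (e0 := proj1 He).
assert (f0 := proj1 Hf). assert (g0 := proj1 Hg).
destruct (double_sum q a z b c d e f g) as (l & L1 & L2); auto.
assert (Ef : forall x : C, x / z / (1 / z) = x) by (intros x; field; auto).
destruct (double_sum q (a / (z * z)) (1 / z) (b / z) (c / z) (d / z) (e / z)
  (f / z) (g / z)) as (l' & L1' & L2'); auto; try (rewrite Ef; auto).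
{ replace (1 / z * q / (f / z * (g / z))) with (z * q / (f * g))
    by (field; auto). auto. }
{ replace (1 / z * (1 / z) * q / (a / (z * z) * (f / z) * (g / z)))
    with (z * z * q / (a * f * g)) by (field; auto). auto. }
replace (1 / z * q / (f / z * (g / z))) with (z * q / (f * g)) in L2'
  by (field; auto).
replace (a / (z * z) * (f / z) / (1 / z)) with (a * f / z / z) in L2'
  by (field; auto).
replace (a / (z * z) * (g / z) / (1 / z)) with (a * g / z / z) in L2'
  by (field; auto).
assert (E1 := is_biseries_unique _ _ _ L2 (is_biseries_scal _ _ _ HSa)).
assert (E2 := is_biseries_unique _ _ _ L2' (is_biseries_scal _ _ _ HSd)).
assert (E3 : l = main_coef q a z b c d e * (1 - z) * Sz +
  companion_coef q a z b c d e * l').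
{ apply is_biseries_unique with (1 := L1).
  apply is_biseries_ext with (2 := is_biseries_plus _ _ _ _
    (is_biseries_scal (main_coef q a z b c d e * (1 - z)) _ _ HSz)
    (is_biseries_scal (companion_coef q a z b c d e) _ _
      (is_biseries_opp _ _ L1'))).
  intros n. symmetry. now apply col_identity. }
rewrite E1, E2 in E3. clear - E3 Hq Hq0 a0 z0 b0 c0 d0 e0 f0 g0 Ha Hz Ha' Hz'
  Hb Hc Hd He Hb' Hc' Hd' He' Hab Hac Had Hae Hf Hg Hf' Hg' Hzf Hzg W1 W2.
assert (Hn0 : forall x : C, off_lattice q x -> qinf q x <> 0)
  by (intros; now apply off_lattice_qinf).
assert (Hd0 : forall x : C, off_lattice q x -> qinf q (q / x) <> 0)
  by (intros; apply Hn0; now apply off_lattice_q_div).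
assert (N1 := Hn0 _ Hz'). assert (N2 := Hd0 _ Ha).
unfold row_coef, companion_coef, main_coef in E3.
replace (1 / z * q / (a / (z * z) * (f / z))) with (z * z * q / (a * f)) in E3
  by (field; auto).
replace (1 / z * q / (a / (z * z) * (g / z))) with (z * z * q / (a * g)) in E3
  by (field; auto).
replace (1 / z * q / (f / z * (g / z))) with (z * q / (f * g)) in E3
  by (field; auto).
replace (1 / z * (1 / z) * q / (a / (z * z) * (f / z) * (g / z)))
  with (z * z * q / (a * f * g)) in E3 by (field; auto).
replace (q / (a / (z * z))) with (z * z * q / a) in E3 by (field; auto).
replace (q / (f / z)) with (z * q / f) in E3 by (field; auto).
replace (q / (g / z)) with (z * q / g) in E3 by (field; auto).
replace (1 / (1 / z)) with z in E3 by (field; auto).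
rewrite (qinf_step q z) in E3 by lra.
rewrite (qinf_step q (a / (z * z))) in E3 by lra.
replace (a / (z * z) * q) with (a * q / (z * z)) in E3 by (field; auto).
unfold coef_a, coef_z, coef_dual.
assert (Ez : qinf q (1 / z) = (1 - 1 / z) * qinf q (q / z)).
{ rewrite (qinf_step q (1 / z)) by lra. do 2 f_equal. field. auto. }
(* Undoes the normalization of the three coefficients; the factor is nonzero for generic
   parameters. *)
apply (Cmult_cancel_l (qinf q (1 / z) / qinf q (q / a))); [now apply Cdiv_neq0|].
eapply eq_trans; [|eapply eq_trans; [exact E3|]].
- assert (M1 := Hd0 _ Hf). assert (M2 := Hd0 _ Hg).
  assert (M3 := qinf_small_neq0 q _ (proj2 Hq) W1).
  field. auto.
- assert (Haz : 1 - a / (z * z) <> 0) by now apply (off_lattice_neq1 q).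
  set (u := 1 - a / (z * z)) in *. clearbody u. rewrite Ez.
  assert (Hq1 : forall x : C, x <> 0 -> off_lattice q (a / x) ->
    qinf q (a * q / x) <> 0).
  { intros x Hx H. apply Hn0. now apply off_lattice_mul_q_div. }
  assert (M1 := Hq1 b b0 Hab). assert (M2 := Hq1 c c0 Hac).
  assert (M3 := Hq1 d d0 Had). assert (M4 := Hq1 e e0 Hae).
  assert (M5 := Hn0 _ Hb'). assert (M6 := Hn0 _ Hc').
  assert (M7 := Hn0 _ Hd'). assert (M8 := Hn0 _ He').
  assert (M9 := Hn0 _ (off_lattice_q q z Hq0 Hz)).
  assert (M10 := Hq1 (z * z) (Cmult_neq_0 _ _ z0 z0) Ha').
  assert (M11 := Hd0 _ Ha').
  replace (q / (a / (z * z))) with (z * z * q / a) in M11 by (field; auto).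
  assert (M12 := Hn0 _ (off_lattice_mul_q_div q z f Hq0 f0 Hzf)).
  assert (M13 := Hn0 _ (off_lattice_mul_q_div q z g Hq0 g0 Hzg)).
  assert (M14 := qinf_small_neq0 q _ (proj2 Hq) W1).
  clear E3 Ez Hn0 Hd0 Hq1.
  abstract_qinf. rewrite Cmult_plus_distr_l. apply (f_equal2 Cplus).
  + field. repeat split; auto.
  + field. repeat split; auto.
Qed.

(** * Continuity of the bilateral series *)

(** Cleared of denominators, so that each term is continuous in nonzero parameters whether or not
    the series is regular; [vwp_norm] restores the denominators. *)
Definition vwp_half (q a : C) (xs : list C) (w : C) (p : nat) : C :=
  (1 - a * q ^ p * q ^ p) *
  Cprod (map (fun x => qprod q x p * qinf q (a * q / x * q ^ p)) xs) * w ^ p.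

Definition vwp_norm (q a : C) (xs : list C) : C :=
  (1 - a) * Cprod (map (fun x => qinf q (a * q / x)) xs).

Definition vwp_half_sum (q a : C) (xs : list C) (w : C) : C :=
  total (vwp_half q a xs w) / vwp_norm q a xs.

Lemma Cprod_neq0 (l : list C) : List.Forall (fun x : C => x <> 0) l -> Cprod l <> 0.
Proof.
induction 1 as [|x l Hx _ IH]; [exact C1_nz|]. now apply Cmult_neq_0.
Qed.

Lemma qinf_regular (q a x : C) :
  (0 < Cmod q < 1)%R -> x <> 0 -> (forall k : nat, x <> a * q ^ S k) ->
  qinf q (a * q / x) <> 0.
Proof.
intros Hq Hx H. apply qinf_neq0; [lra|]. intros k E. apply (H k).
replace x with (x * (a * q / x * q ^ k)) by (rewrite E; ring).
simpl. field. auto.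
Qed.

Lemma vwp_norm_neq0 (q a : C) (xs : list C) :
  (0 < Cmod q < 1)%R -> List.Forall (fun x : C => x <> 0) xs ->
  vwp_regular q a xs -> vwp_norm q a xs <> 0.
Proof.
intros Hq Hxs [Ha H]. apply Cmult_neq_0.
- intros E. apply Ha. replace a with (1 - (1 - a)) by ring. rewrite E. ring.
- apply Cprod_neq0. apply List.Forall_map.
  rewrite List.Forall_forall in Hxs, H |- *. intros x Hx.
  apply qinf_regular; auto. intros k. now apply (H x).
Qed.

Lemma vwp_term_of_nat (q a : C) (xs : list C) (w : C) (p : nat) :
  (0 < Cmod q < 1)%R -> List.Forall (fun x : C => x <> 0) xs ->
  vwp_regular q a xs ->
  vwp_term q a xs w (Z.of_nat p) = / vwp_norm q a xs * vwp_half q a xs w p.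
Proof.
intros Hq Hxs Hreg. assert (N := vwp_norm_neq0 q a xs Hq Hxs Hreg).
destruct Hreg as [Ha H]. unfold vwp_term, vwp_half. unfold vwp_norm in N |- *.
rewrite Cpowz_of_nat. replace (2 * Z.of_nat p)%Z with (Z.of_nat (p + p)) by lia.
rewrite Cpowz_of_nat, Cpow_add_r.
assert (E : Cprod (map (fun x => qpoch q x (Z.of_nat p) /
    qpoch q (a * q / x) (Z.of_nat p)) xs) * Cprod (map (fun x => qinf q (a * q / x)) xs) =
  Cprod (map (fun x => qprod q x p * qinf q (a * q / x * q ^ p)) xs)).
{ clear N. induction xs as [|x xs IH]; [simpl; ring|].
  pose proof (Forall_inv Hxs) as Hx. pose proof (Forall_inv_tail Hxs) as Hxs'.
  pose proof (Forall_inv H) as Hk. pose proof (Forall_inv_tail H) as H'.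
  cbv beta in Hx, Hk. simpl. rewrite <- IH by auto. rewrite !qpoch_of_nat.
  assert (M : qinf q (a * q / x) <> 0).
  { apply qinf_regular; auto. intros k. apply Hk. }
  rewrite (qinf_shift q (a * q / x) p) in M |- * by lra.
  assert (qprod q (a * q / x) p <> 0) by (intros E; apply M; rewrite E; ring).
  unfold Cprod. field. auto. }
rewrite <- E.
assert (N1 : 1 - a <> 0) by (intros Z; apply N; rewrite Z; ring).
assert (N2 : Cprod (map (fun x => qinf q (a * q / x)) xs) <> 0)
  by (intros Z; apply N; rewrite Z; ring).
field. auto.
Qed.

Lemma bounded_Cprod (I : Type) (h : I -> C -> C) (xs : list C) :
  List.Forall (fun x => bounded (fun i => h i x)) xs ->
  bounded (fun i => Cprod (map (h i) xs)).
Proof.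
induction 1 as [|x xs Hx _ IH]; simpl; [apply bounded_const|].
now apply bounded_mult.
Qed.

Lemma climit_Cprod (h : nat -> C -> C) (h0 : C -> C) (xs : list C) :
  List.Forall (fun x => climit (fun j => h j x) (h0 x)) xs ->
  climit (fun j => Cprod (map (h j) xs)) (Cprod (map h0 xs)).
Proof.
induction 1 as [|x xs Hx _ IH]; simpl; [apply climit_const|].
now apply climit_mult.
Qed.

Lemma vwp_half_scaled (q a : C) (xs : list C) (w t : C) (p : nat) :
  List.Forall (fun x : C => x <> 0) xs -> t <> 0 ->
  vwp_half q (a * t * t) (map (fun x => x * t) xs) w p =
  (1 - a * t * t * q ^ p * q ^ p) *
  Cprod (map (fun x => qprod q (x * t) p * qinf q (a * q / x * t * q ^ p)) xs) *
  w ^ p.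
Proof.
intros Hxs Ht. unfold vwp_half. rewrite map_map. do 2 f_equal. f_equal.
apply map_ext_in. intros x Hx. rewrite List.Forall_forall in Hxs.
specialize (Hxs x Hx). do 2 f_equal. field. auto.
Qed.

Lemma vwp_half_bounded (q a : C) (xs : list C) (w : C) (t : nat -> C) :
  (0 < Cmod q < 1)%R -> List.Forall (fun x : C => x <> 0) xs ->
  bounded t -> (forall j, t j <> 0) ->
  exists K : R, forall j, geom_bounded K (Cmod w)
    (vwp_half q (a * t j * t j) (map (fun x => x * t j) xs) w).
Proof.
intros Hq Hxs [B HB] Ht. assert (Hq1 : (Cmod q < 1)%R) by lra.
assert (Bt : bounded (fun i : nat * nat => t (fst i))).
{ exists B. intros i. apply HB. }
assert (D : bounded (fun i : nat * nat =>
  (1 - a * t (fst i) * t (fst i) * q ^ snd i * q ^ snd i) *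
  Cprod (map (fun x => qprod q (x * t (fst i)) (snd i) *
    qinf q (a * q / x * t (fst i) * q ^ snd i)) xs))).
{ apply bounded_mult.
  - repeat first [exact Bt | apply bounded_const | apply bounded_qpow; exact Hq1
      | apply bounded_mult | apply bounded_minus].
  - apply (bounded_Cprod _ (fun (i : nat * nat) x => qprod q (x * t (fst i)) (snd i) *
      qinf q (a * q / x * t (fst i) * q ^ snd i))).
    apply List.Forall_forall. intros x _.
    repeat first [exact Bt | apply bounded_const | apply bounded_qpow; exact Hq1
      | apply bounded_qprod; [exact Hq1|] | apply bounded_qinf; [exact Hq1|]
      | apply bounded_mult | apply bounded_minus]. }
destruct D as [K HK]. exists K. intros j p. rewrite vwp_half_scaled by auto.
rewrite Cmod_mult, Cmod_pow. apply Rmult_le_compat_r; [apply pow_le, Cmod_ge_0|].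
exact (HK (j, p)).
Qed.

Lemma vwp_half_has_sum (q a : C) (xs : list C) (w : C) :
  (0 < Cmod q < 1)%R -> List.Forall (fun x : C => x <> 0) xs -> (Cmod w < 1)%R ->
  has_sum (vwp_half q a xs w) (total (vwp_half q a xs w)).
Proof.
intros Hq Hxs Hw.
destruct (vwp_half_bounded q a xs w (fun _ => 1) Hq Hxs (bounded_const _ _)
  (fun _ => C1_nz)) as [K HK].
assert (E : map (fun x : C => x * 1) xs = xs).
{ rewrite <- (map_id xs) at 2. apply map_ext. intros x. ring. }
specialize (HK 0%nat). rewrite E in HK. repeat rewrite Cmult_1_r in HK.
apply (total_has_sum K (Cmod w)); [|exact HK]. split; [apply Cmod_ge_0|auto].
Qed.

Lemma Forall_neq0_scal (xs : list C) (t : C) :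
  t <> 0 -> List.Forall (fun x : C => x <> 0) xs ->
  List.Forall (fun x : C => x <> 0) (map (fun x => x * t) xs).
Proof.
intros Ht H. apply List.Forall_map. revert H. apply List.Forall_impl.
intros x Hx. now apply Cmult_neq_0.
Qed.

(** The scaling does not touch w, so |w| is a common ratio for [tannery]; regularity is needed only
    at t = 1, where the limit of [vwp_norm] must not vanish. *)
Lemma climit_vwp_half_sum (q a : C) (xs : list C) (w : C) (t : nat -> C) :
  (0 < Cmod q < 1)%R -> List.Forall (fun x : C => x <> 0) xs -> (Cmod w < 1)%R ->
  vwp_regular q a xs -> bounded t -> (forall j, t j <> 0) -> climit t 1 ->
  climit (fun j => vwp_half_sum q (a * t j * t j) (map (fun x => x * t j) xs) w)
    (vwp_half_sum q a xs w).
Proof.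
intros Hq Hxs Hw Hreg Hb Ht Hlim. assert (Hq1 : (Cmod q < 1)%R) by lra.
assert (Hw0 := Cmod_ge_0 w).
apply climit_div; [| |now apply vwp_norm_neq0].
- destruct (vwp_half_bounded q a xs w t Hq Hxs Hb Ht) as [K HK].
  apply (tannery K (Cmod w)
    (fun j => vwp_half q (a * t j * t j) (map (fun x => x * t j) xs) w)
    (vwp_half q a xs w)); auto.
  + intros p. eapply climit_ext.
    { intros j. symmetry. now apply vwp_half_scaled. }
    apply climit_mult; [|apply climit_const]. apply climit_mult.
    * replace (1 - a * q ^ p * q ^ p) with (1 - a * 1 * 1 * q ^ p * q ^ p) by ring.
      repeat first [exact Hlim | apply climit_const | apply climit_mult
        | apply climit_minus].
    * apply (climit_Cprod (fun j x => qprod q (x * t j) p *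
        qinf q (a * q / x * t j * q ^ p))).
      apply List.Forall_forall. intros x _.
      replace (qprod q x p * qinf q (a * q / x * q ^ p))
        with (qprod q (x * 1) p * qinf q (a * q / x * 1 * q ^ p))
        by (rewrite !Cmult_1_r; reflexivity).
      apply climit_mult; [apply climit_qprod|apply climit_qinf; [exact Hq1|]];
      repeat first [exact Hlim | apply climit_const | apply climit_mult].
  + intros j. apply vwp_half_has_sum; auto. now apply Forall_neq0_scal.
  + now apply vwp_half_has_sum.
- apply climit_ext with (fun j => (1 - a * t j * t j) *
    Cprod (map (fun x => qinf q (a * q / x * t j)) xs)).
  { intros j. unfold vwp_norm. rewrite map_map. do 2 f_equal.
    apply map_ext_in. intros x Hx. rewrite List.Forall_forall in Hxs.
    specialize (Hxs x Hx). specialize (Ht j). f_equal. field. auto. }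
  unfold vwp_norm. apply climit_mult.
  + replace (1 - a) with (1 - a * 1 * 1) by ring.
    repeat first [exact Hlim | apply climit_const | apply climit_mult
      | apply climit_minus].
  + apply (climit_Cprod (fun j x => qinf q (a * q / x * t j))).
    apply List.Forall_forall. intros x _.
    replace (qinf q (a * q / x)) with (qinf q (a * q / x * 1))
      by (rewrite !Cmult_1_r; reflexivity).
    apply climit_qinf; [exact Hq1|].
    repeat first [exact Hlim | apply climit_const | apply climit_mult].
Qed.

(** * The negative half by reversal of the index *)

Lemma Cinv_0 : / RtoC 0 = 0.
Proof.
unfold Cinv, RtoC. simpl. f_equal; unfold Rdiv; ring.
Qed.

(** Also true at 0, by the default value of the inverse: thus 1/(y;q)_{-p} is a finite product even
    where that product vanishes. *)
Lemma Cinv_inv (x : C) : / / x = x.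
Proof.
destruct (Classical_Prop.classic (x = 0)) as [->|H].
- now rewrite !Cinv_0.
- field. auto.
Qed.

Lemma qpoch_opp_of_nat (q x : C) (p : nat) :
  qpoch q x (- Z.of_nat p) = / qprod q (x / q ^ p) p.
Proof.
destruct p as [|p].
- simpl. field.
- change (/ qprod q (x / q ^ Pos.to_nat (Pos.of_succ_nat p))
    (Pos.to_nat (Pos.of_succ_nat p)) = / qprod q (x / q ^ S p) (S p)).
  now rewrite SuccNat2Pos.id_succ.
Qed.

(** Only (x;q)_{-p} has to be finite. If aq/x sits at a pole of the other factorial, both sides are
    0, which the default inverse reproduces. *)
Lemma qpoch_ratio_opp (q a x : C) (p : nat) :
  (0 < Cmod q < 1)%R -> a <> 0 -> x <> 0 -> (forall k : nat, x <> q ^ S k) ->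
  qpoch q x (- Z.of_nat p) / qpoch q (a * q / x) (- Z.of_nat p) =
  (a * q / (x * x)) ^ p *
  (qpoch q (x / a) (Z.of_nat p) / qpoch q (1 / a * q / (x / a)) (Z.of_nat p)).
Proof.
intros Hq Ha Hx H. assert (Hq0 := q_neq0 q Hq).
rewrite !qpoch_opp_of_nat, !qpoch_of_nat.
replace (1 / a * q / (x / a)) with (q / x) by (field; auto).
assert (Nx : qprod q (x / q ^ p) p <> 0).
{ apply qprod_neq0. intros k Hk E. apply (H (p - S k)%nat).
  replace p with (S (p - S k) + k)%nat in E at 1 by lia.
  rewrite Cpow_add_r in E. assert (H1 := Cpow_nz q (S (p - S k)) Hq0).
  assert (H2 := Cpow_nz q k Hq0).
  replace x with (x / (q ^ S (p - S k) * q ^ k) * q ^ k * q ^ S (p - S k))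
    by (field; auto).
  rewrite E. ring. }
assert (Nq : qprod q (q / x) p <> 0).
{ apply qprod_neq0. intros k Hk E. apply (H k).
  replace x with (x * (q / x * q ^ k)) by (rewrite E; ring).
  simpl. field. auto. }
assert (R := qprod_reverse q x (a * q / x) p Hq0 Hx
  (Cdiv_neq0 _ _ (Cmult_neq_0 _ _ Ha Hq0) Hx)).
replace (q / (a * q / x)) with (x / a) in R by (field; auto).
assert (xp := Cpow_nz x p Hx).
replace ((a * q / (x * x)) ^ p) with ((a * q / x) ^ p / x ^ p).
2:{ rewrite <- Cpow_div by auto. f_equal. field. auto. }
unfold Cdiv at 1. rewrite Cinv_inv.
transitivity (qprod q (x / q ^ p) p * ((a * q / x) ^ p * qprod q (x / a) p) /
  (qprod q (x / q ^ p) p * (x ^ p * qprod q (q / x) p))); [|field; auto].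
rewrite R. field. auto.
Qed.

(** The six reversals contribute the product of the (aq/x^2)^p, which equals (q w)^(2p) for this w.
    The form of w is itself invariant under a -> 1/a, x -> x/a, and all three series of the theorem
    have it. *)
Lemma vwp_term_opp_of_nat (q a x1 x2 x3 x4 x5 x6 w : C) (p : nat) :
  (0 < Cmod q < 1)%R -> a <> 0 ->
  List.Forall (fun x : C => x <> 0) [x1; x2; x3; x4; x5; x6] ->
  vwp_regular q a [x1; x2; x3; x4; x5; x6] ->
  w = a ^ 3 * q ^ 2 / (x1 * x2 * x3 * x4 * x5 * x6) ->
  vwp_term q a [x1; x2; x3; x4; x5; x6] w (- Z.of_nat p) =
  vwp_term q (1 / a) [x1 / a; x2 / a; x3 / a; x4 / a; x5 / a; x6 / a] w
    (Z.of_nat p).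
Proof.
intros Hq Ha Hxs Hreg Hw. assert (Hq0 := q_neq0 q Hq).
assert (N : 1 - a <> 0).
{ intros E. apply (proj1 Hreg). replace a with (1 - (1 - a)) by ring.
  rewrite E. ring. }
assert (N' : a - 1 <> 0).
{ intros E. apply N. replace (1 - a) with (- (a - 1)) by ring. rewrite E. ring. }
destruct Hreg as [_ Hreg].
split_Forall.
unfold vwp_term, Cprod. simpl fold_right.
rewrite !(qpoch_ratio_opp q a) by (auto; match goal with
  H : forall k : nat, ?x <> q ^ S k /\ _ |- forall k : nat, ?x <> _ =>
    intros k; apply H end).
replace (2 * - Z.of_nat p)%Z with (- Z.of_nat (p + p))%Z by lia.
replace (2 * Z.of_nat p)%Z with (Z.of_nat (p + p)) by lia.
rewrite !Cpowz_opp_of_nat, !Cpowz_of_nat, Cpow_add_r.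
assert (qp := Cpow_nz q p Hq0).
assert (W0 : w <> 0).
{ rewrite Hw. apply Cdiv_neq0; auto 8 using Cmult_neq_0, Cpow_nz. }
assert (wp := Cpow_nz w p W0).
assert (E : (a * q / (x1 * x1)) ^ p * (a * q / (x2 * x2)) ^ p *
  (a * q / (x3 * x3)) ^ p * (a * q / (x4 * x4)) ^ p * (a * q / (x5 * x5)) ^ p *
  (a * q / (x6 * x6)) ^ p = q ^ p * q ^ p * (w ^ p * w ^ p)).
{ rewrite <- !Cpow_mult_l. f_equal. rewrite Hw. field. repeat split; auto. }
set (r1 := _ / qpoch q (1 / a * q / (x1 / a)) _).
set (r2 := _ / qpoch q (1 / a * q / (x2 / a)) _).
set (r3 := _ / qpoch q (1 / a * q / (x3 / a)) _).
set (r4 := _ / qpoch q (1 / a * q / (x4 / a)) _).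
set (r5 := _ / qpoch q (1 / a * q / (x5 / a)) _).
set (r6 := _ / qpoch q (1 / a * q / (x6 / a)) _).
set (e1 := (a * q / (x1 * x1)) ^ p) in *. set (e2 := (a * q / (x2 * x2)) ^ p) in *.
set (e3 := (a * q / (x3 * x3)) ^ p) in *. set (e4 := (a * q / (x4 * x4)) ^ p) in *.
set (e5 := (a * q / (x5 * x5)) ^ p) in *. set (e6 := (a * q / (x6 * x6)) ^ p) in *.
transitivity ((1 - a * / (q ^ p * q ^ p)) / (1 - a) *
  (r1 * (r2 * (r3 * (r4 * (r5 * (r6 * 1)))))) * / w ^ p *
  (e1 * e2 * e3 * e4 * e5 * e6)); [ring|].
rewrite E. field. auto.
Qed.

Lemma vwp_regular_reflect (q a : C) (xs : list C) :
  a <> 0 -> vwp_regular q a xs -> vwp_regular q (1 / a) (map (fun x => x / a) xs).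
Proof.
intros Ha [H1 H]. split.
- intros E. apply H1. replace a with (1 / (1 / a)) by (field; auto).
  rewrite E. field.
- apply List.Forall_map. revert H. apply List.Forall_impl.
  intros x Hx k. destruct (Hx k) as [A B]. split; intros E.
  + apply B. rewrite <- E. field. auto.
  + apply A. replace x with (x / a * a) by (field; auto). rewrite E. field. auto.
Qed.

Lemma Forall_neq0_div (xs : list C) (a : C) :
  a <> 0 -> List.Forall (fun x : C => x <> 0) xs ->
  List.Forall (fun x : C => x <> 0) (map (fun x => x / a) xs).
Proof.
intros Ha H. apply List.Forall_map. revert H. apply List.Forall_impl.
intros x Hx. now apply Cdiv_neq0.
Qed.

Lemma has_sum_vwp_term (q a : C) (xs : list C) (w : C) :
  (0 < Cmod q < 1)%R -> List.Forall (fun x : C => x <> 0) xs ->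
  vwp_regular q a xs -> (Cmod w < 1)%R ->
  has_sum (fun p => vwp_term q a xs w (Z.of_nat p)) (vwp_half_sum q a xs w).
Proof.
intros Hq Hxs Hreg Hw. unfold vwp_half_sum, Cdiv. rewrite Cmult_comm.
apply has_sum_ext with (fun p => / vwp_norm q a xs * vwp_half q a xs w p).
- intros p. symmetry. now apply vwp_term_of_nat.
- apply has_sum_scal. now apply vwp_half_has_sum.
Qed.

(** The -1 removes the term n = 0, which both halves contain. As an expression in [vwp_half_sum] it
    can be followed through the limit t -> 1. *)
Definition vwp_value (q a : C) (xs : list C) (w : C) : C :=
  vwp_half_sum q a xs w + (vwp_half_sum q (1 / a) (map (fun x => x / a) xs) w - 1).

Lemma is_biseries_vwp (q a x1 x2 x3 x4 x5 x6 w : C) :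
  (0 < Cmod q < 1)%R -> a <> 0 ->
  List.Forall (fun x : C => x <> 0) [x1; x2; x3; x4; x5; x6] ->
  vwp_regular q a [x1; x2; x3; x4; x5; x6] ->
  w = a ^ 3 * q ^ 2 / (x1 * x2 * x3 * x4 * x5 * x6) -> (Cmod w < 1)%R ->
  is_biseries (vwp_term q a [x1; x2; x3; x4; x5; x6] w)
    (vwp_value q a [x1; x2; x3; x4; x5; x6] w).
Proof.
intros Hq Ha Hxs Hreg Hw Hw1.
assert (Hreg' := vwp_regular_reflect _ _ _ Ha Hreg).
assert (Hxs' := Forall_neq0_div _ _ Ha Hxs).
apply is_biseries_iff.
exists (vwp_half_sum q a [x1; x2; x3; x4; x5; x6] w),
  (vwp_half_sum q (1 / a) (map (fun x => x / a) [x1; x2; x3; x4; x5; x6]) w - 1).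
repeat split.
- now apply has_sum_vwp_term.
- set (xs := map (fun x => x / a) [x1; x2; x3; x4; x5; x6]) in *.
  assert (E0 : vwp_term q (1 / a) xs w (Z.of_nat 0) = 1).
  { destruct Hreg' as [N _].
    assert (1 - 1 / a <> 0).
    { intros E. apply N. replace (1 / a) with (1 - (1 - 1 / a)) by ring.
      rewrite E. ring. }
    unfold vwp_term, xs, Cprod. simpl.
    replace (1 - 1 / a * 1) with (1 - 1 / a) by ring.
    set (u := 1 - 1 / a) in *. clearbody u. field. auto. }
  replace (vwp_half_sum q (1 / a) xs w - 1) with
    (vwp_half_sum q (1 / a) xs w - vwp_term q (1 / a) xs w (Z.of_nat 0))
    by now rewrite E0.
  apply has_sum_ext with (fun n => vwp_term q (1 / a) xs w (Z.of_nat (S n))).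
  + intros n. symmetry. now apply vwp_term_opp_of_nat.
  + apply (proj1 (has_sum_head (fun n => vwp_term q (1 / a) xs w (Z.of_nat n)) _)).
    now apply has_sum_vwp_term.
Qed.

(** The two halves change places. Used to pass from the base a/z^2 of the double series to z^2/a. *)
Lemma vwp_value_reflect (q a x1 x2 x3 x4 x5 x6 w : C) :
  a <> 0 ->
  vwp_value q (1 / a) [x1 / a; x2 / a; x3 / a; x4 / a; x5 / a; x6 / a] w =
  vwp_value q a [x1; x2; x3; x4; x5; x6] w.
Proof.
intros Ha. unfold vwp_value. simpl map.
replace (1 / (1 / a)) with a by (field; auto).
assert (E : forall x : C, x / a / (1 / a) = x) by (intros x; field; auto).
rewrite !E. ring.
Qed.

Lemma climit_vwp_value (q a : C) (xs : list C) (w : C) (t : nat -> C) :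
  (0 < Cmod q < 1)%R -> a <> 0 -> List.Forall (fun x : C => x <> 0) xs ->
  (Cmod w < 1)%R -> vwp_regular q a xs ->
  bounded t -> bounded (fun j => / t j) -> (forall j, t j <> 0) -> climit t 1 ->
  climit (fun j => vwp_value q (a * t j * t j) (map (fun x => x * t j) xs) w)
    (vwp_value q a xs w).
Proof.
intros Hq Ha Hxs Hw Hreg Hb Hb' Ht Hlim.
assert (Hlim' : climit (fun j => / t j) 1).
{ replace (RtoC 1) with (/ RtoC 1) by field. apply climit_inv; auto using C1_nz. }
unfold vwp_value. apply climit_plus; [now apply climit_vwp_half_sum|].
apply climit_minus; [|apply climit_const].
apply climit_ext with (fun j => vwp_half_sum q (1 / a * / t j * / t j)
  (map (fun x => x * / t j) (map (fun x => x / a) xs)) w).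
- intros j. specialize (Ht j). rewrite !map_map. f_equal; [field; auto|].
  apply map_ext. intros x. field. auto.
- apply climit_vwp_half_sum; auto.
  + now apply Forall_neq0_div.
  + now apply vwp_regular_reflect.
  + intros j. now apply Cinv_neq0.
Qed.

(* Two sequence members on the lattice would have a ratio that is a nonzero
   power of |q|, but the ratios of the s_i are too close to 1. *)
Lemma eventually_off_lattice (q c : C) (s : nat -> R) :
  (0 < Cmod q < 1)%R -> c <> 0 -> (forall j, (0 < s j)%R) ->
  (forall i j, (i < j)%nat -> (s j < s i)%R) ->
  (forall i j, (s i * Cmod q < s j)%R) ->
  eventually (fun j => off_lattice q (c * s j)).
Proof.
intros Hq Hc Hs0 Hdec Hclose. assert (Hq0 := q_neq0 q Hq).
assert (Hsc : forall j, RtoC (s j) <> 0).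
{ intros j. apply Cmod_gt_0. rewrite Cmod_R, Rabs_pos_eq; specialize (Hs0 j); lra. }
destruct (Classical_Prop.classic (exists i n, c * s i = Cpowz q n)) as [[i [n Hi]]|H].
- exists (S i). intros j Hj. split; [now apply Cmult_neq_0|]. intros m Hm.
  assert (Qn := Cpowz_neq0 q n Hq0). assert (Qm := Cpowz_neq0 q m Hq0).
  assert (E : Cpowz q (m - n) * s i = s j).
  { unfold Z.sub. rewrite Cpowz_add, Cpowz_opp, <- Hi, <- Hm by auto. field. auto. }
  apply (f_equal Cmod) in E. rewrite Cmod_mult, !Cmod_R in E.
  assert (Pi := Hs0 i). assert (Pj := Hs0 j).
  rewrite !Rabs_pos_eq in E by lra.
  assert (D : (s j < s i)%R) by (apply Hdec; lia).
  assert (Cl := Hclose i j).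
  destruct (Z_lt_le_dec 0 (m - n)) as [L|L].
  + replace (m - n)%Z with (Z.of_nat (S (Z.to_nat (m - n - 1)))) in E by lia.
    rewrite Cpowz_of_nat in E. simpl in E. rewrite Cmod_mult in E.
    assert (B := Cmod_qpow_le1 q (Z.to_nat (m - n - 1)) (proj2 Hq)).
    set (u := Cmod (q ^ Z.to_nat (m - n - 1))) in *.
    assert (P : (0 < s i * Cmod q)%R) by (apply Rmult_lt_0_compat; lra).
    assert (s i * Cmod q * u <= s i * Cmod q)%R by nra. nra.
  + replace (m - n)%Z with (- Z.of_nat (Z.to_nat (n - m)))%Z in E by lia.
    rewrite Cpowz_opp_of_nat, Cmod_inv in E by now apply Cpow_nz.
    assert (B := Cmod_qpow_le1 q (Z.to_nat (n - m)) (proj2 Hq)).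
    assert (B0 := proj1 (Cmod_gt_0 _) (Cpow_nz q (Z.to_nat (n - m)) Hq0)).
    set (u := Cmod (q ^ Z.to_nat (n - m))) in *.
    assert (1 <= / u)%R by (rewrite <- Rinv_1; apply Rinv_le_contravar; lra).
    nra.
- exists 0%nat. intros j _. split; [now apply Cmult_neq_0|].
  intros n E. apply H. now exists j, n.
Qed.

Lemma eventually_Forall (P : nat -> C -> Prop) (cs : list C) :
  List.Forall (fun c => eventually (fun j => P j c)) cs ->
  eventually (fun j => List.Forall (P j) cs).
Proof.
induction 1 as [|c cs Hc _ IH].
- exists 0%nat. auto.
- destruct Hc as [N HN]. destruct IH as [M HM]. exists (N + M)%nat.
  intros j Hj. constructor; [apply HN; lia|apply HM; lia].
Qed.

(** Each of the finitely many conditions holds from some index on, so dropping an initial segment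
    gives all of them at once. Members of cs are scaled by t, those of ds by t^2. *)
Lemma perturbation_sequence (q : C) (cs ds : list C) :
  (0 < Cmod q < 1)%R ->
  List.Forall (fun x : C => x <> 0) cs -> List.Forall (fun x : C => x <> 0) ds ->
  exists t : nat -> C, (forall j, t j <> 0) /\ bounded t /\
    bounded (fun j => / t j) /\ climit t 1 /\
    (forall j, List.Forall (fun c => off_lattice q (c * t j)) cs) /\
    (forall j, List.Forall (fun c => off_lattice q (c * (t j * t j))) ds).
Proof.
(* With |q| = 1 - 4h and s between 1 and 1 + h, (1+h)^2 (1-4h) < 1 keeps even the ratios of the
   squares above |q|. *)
intros Hq Hcs Hds. set (h := ((1 - Cmod q) / 4)%R).
assert (Hh : (0 < h)%R) by (unfold h; lra).
set (s := fun j => (1 + h / INR (S j))%R).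
assert (Hs1 : forall j, (1 < s j <= 1 + h)%R).
{ intros j. unfold s.
  assert (P : (1 <= INR (S j))%R) by (rewrite S_INR; assert (T := pos_INR j); lra).
  assert (P2 : (0 < h / INR (S j))%R) by (apply Rdiv_lt_0_compat; lra).
  assert (P3 : (h / INR (S j) <= h)%R).
  { apply Rle_div_l; [lra|]. nra. }
  lra. }
assert (Hdec : forall i j, (i < j)%nat -> (s j < s i)%R).
{ intros i j Hij. unfold s. apply Rplus_lt_compat_l. apply Rmult_lt_compat_l; auto.
  apply Rinv_lt_contravar.
  - apply Rmult_lt_0_compat; apply lt_0_INR; lia.
  - apply lt_INR. lia. }
assert (Hk : Cmod q = (1 - 4 * h)%R) by (unfold h; field).
assert (H1 : (0 < h < / 4)%R) by (split; [auto|unfold h; lra]).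
assert (EV : eventually (fun j =>
  List.Forall (fun c => off_lattice q (c * s j)) cs /\
  List.Forall (fun c => off_lattice q (c * (s j * s j)%R)) ds)).
{ apply filter_and.
  - apply eventually_Forall. revert Hcs. apply List.Forall_impl. intros c Hc.
    apply eventually_off_lattice; auto.
    + intros j. specialize (Hs1 j). lra.
    + intros i j. assert (A := Hs1 i). assert (B := Hs1 j). rewrite Hk. nra.
  - apply (eventually_Forall (fun j c => off_lattice q (c * (s j * s j)%R))).
    revert Hds. apply List.Forall_impl. intros c Hc.
    apply (eventually_off_lattice q c (fun j => (s j * s j)%R)); auto.
    + intros j. specialize (Hs1 j). nra.
    + intros i j Hij. assert (A := Hs1 i). assert (B := Hs1 j).
      assert (D := Hdec i j Hij). nra.
    + intros i j. assert (A := Hs1 i). assert (B := Hs1 j). rewrite Hk.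
      assert ((s i * s i) <= (1 + h) * (1 + h))%R by nra.
      assert (1 < s j * s j)%R by nra.
      assert ((1 + h) * (1 + h) * (1 - 4 * h) < 1)%R by nra.
      assert ((s i * s i) * (1 - 4 * h) <= (1 + h) * (1 + h) * (1 - 4 * h))%R
        by (apply Rmult_le_compat_r; lra).
      lra. }
destruct EV as [N HN].
assert (Hmod : forall j, Cmod (RtoC (s j)) = s j).
{ intros j. rewrite Cmod_R, Rabs_pos_eq; specialize (Hs1 j); lra. }
assert (Hnz : forall j, RtoC (s j) <> 0).
{ intros j. apply Cmod_gt_0. rewrite Hmod. specialize (Hs1 j). lra. }
exists (fun j => RtoC (s (N + j)%nat)). repeat split.
- intros j. apply Hnz.
- exists (1 + h)%R. intros j. rewrite Hmod. apply Hs1.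
- exists 1%R. intros j. rewrite Cmod_inv, Hmod by auto.
  rewrite <- Rinv_1. apply Rinv_le_contravar; [lra|]. left. apply Hs1.
- apply (climit_comp (fun j => RtoC (s j)) 1 (fun j => (N + j)%nat));
    [|intros; lia].
  apply climit_squeeze with (fun j => h * / INR (S j))%R.
  + intros j. replace (RtoC (s j) - 1) with (RtoC (h * / INR (S j))).
    * rewrite Cmod_R, Rabs_pos_eq; [lra|]. specialize (Hs1 j). unfold s, Rdiv in Hs1.
      lra.
    * unfold s, Rdiv. rewrite RtoC_plus. ring.
  + replace (Finite 0) with (Rbar_mult h 0) by (simpl; f_equal; ring).
    apply is_lim_seq_scal_l.
    apply (is_lim_seq_incr_1 (fun n => / INR n)%R).
    replace (Finite 0) with (Rbar_inv p_infty) by reflexivity.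
    apply is_lim_seq_inv; [apply is_lim_seq_INR|discriminate].
- intros j. apply HN. lia.
- intros j. specialize (HN (N + j)%nat ltac:(lia)). destruct HN as [_ H].
  revert H. apply List.Forall_impl. intros c Hc. now rewrite RtoC_mult in Hc.
Qed.

(** * Removal of the genericity assumptions *)

Lemma vwp_regular_off_lattice (q a : C) (xs : list C) :
  q <> 0 -> off_lattice q a ->
  List.Forall (fun x => off_lattice q x /\ off_lattice q (a / x)) xs ->
  vwp_regular q a xs.
Proof.
intros Hq Ha H. split.
- intros E. apply (off_lattice_neq1 q a Ha). rewrite E. ring.
- revert H. apply List.Forall_impl. intros x [[x0 Hx] [_ Hax]] k. split; intros E.
  + apply (Hx (Z.of_nat (S k))). now rewrite Cpowz_of_nat.
  + apply (Hax (- Z.of_nat (S k))%Z). rewrite Cpowz_opp_of_nat.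
    assert (Hk := Cpow_nz q (S k) Hq). rewrite E in x0 |- *. field.
    split; [auto|]. intros E0. apply x0. rewrite E0. ring.
Qed.

(* Replacing x by x t for the parameters, and a, z by a t^2, z t^2, leaves both
   arguments of the series unchanged.  The lists collect what has to avoid the
   powers of q; the reciprocals of their members then do so too. *)
Definition lattice_data4 (a z : C) (xs : list C) : list C :=
  flat_map (fun x => [x; a / x; z / x; z * x / a]) xs.

Definition lattice_data2 (a z : C) (xs : list C) : list C :=
  flat_map (fun x => [x; z / x; a * x / z; z * z / (a * x)]) xs.

Lemma generic_perturbed (q a z b c d e f g t : C) :
  q <> 0 -> a <> 0 -> z <> 0 -> t <> 0 ->
  List.Forall (fun x : C => x <> 0) [b; c; d; e; f; g] ->
  a * z * q = b * c * d * e ->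
  List.Forall (fun x => off_lattice q (x * t))
    (lattice_data4 a z [b; c; d; e] ++ lattice_data2 a z [f; g]) ->
  List.Forall (fun x => off_lattice q (x * (t * t))) [a; z; z * z / a] ->
  generic q (a * t * t) (z * t * t) (b * t) (c * t) (d * t) (e * t) (f * t) (g * t) /\
  generic q (a * t * t / (z * t * t * (z * t * t))) (1 / (z * t * t))
    (b * t / (z * t * t)) (c * t / (z * t * t)) (d * t / (z * t * t))
    (e * t / (z * t * t)) (f * t / (z * t * t)) (g * t / (z * t * t)).
Proof.
intros Hq Ha Hz Ht Hxs Hbal H1 H2.
apply List.Forall_app in H1. destruct H1 as [H4 H1].
assert (O4 : forall x, List.In x [b; c; d; e] -> x <> 0 /\
  off_lattice q (x * t) /\ off_lattice q (a / x * t) /\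
  off_lattice q (z / x * t) /\ off_lattice q (z * x / a * t)).
{ intros x Hx. rewrite List.Forall_forall in Hxs, H4.
  assert (I : forall y, List.In y [x; a / x; z / x; z * x / a] ->
    off_lattice q (y * t)).
  { intros y Hy. apply H4. apply List.in_flat_map. now exists x. }
  split; [apply Hxs; simpl in Hx |- *; tauto|].
  repeat split; try apply I; simpl; auto. }
assert (O2 : forall x, List.In x [f; g] -> x <> 0 /\
  off_lattice q (x * t) /\ off_lattice q (z / x * t) /\
  off_lattice q (a * x / z * t) /\ off_lattice q (z * z / (a * x) * t)).
{ intros x Hx. rewrite List.Forall_forall in Hxs, H1.
  assert (I : forall y, List.In y [x; z / x; a * x / z; z * z / (a * x)] ->
    off_lattice q (y * t)).
  { intros y Hy. apply H1. apply List.in_flat_map. now exists x. }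
  split; [apply Hxs; simpl in Hx |- *; tauto|].
  repeat split; try apply I; simpl; auto 6. }
assert (Oa := Forall_inv H2). apply Forall_inv_tail in H2.
assert (Oz := Forall_inv H2). apply Forall_inv_tail in H2.
assert (Od := Forall_inv H2). cbv beta in Oa, Oz, Od.
clear H1 H2 H4.
assert (inv : forall x y : C, off_lattice q x -> y = / x -> off_lattice q y).
{ intros x y Hx ->. now apply off_lattice_inv. }
assert (eqv : forall x y : C, off_lattice q x -> y = x -> off_lattice q y).
{ intros x y Hx ->. exact Hx. }
split; unfold generic.
- split; [apply (eqv _ _ Oa); ring|]. split; [apply (eqv _ _ Oz); ring|].
  split; [|split].
  + apply (proj2 (List.Forall_map (fun x => x * t)
      (fun x => off_lattice q x /\ off_lattice q (a * t * t / x)) [b; c; d; e])).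
    apply List.Forall_forall. intros x Hx. destruct (O4 x Hx) as (x0 & A & B & _).
    split; [exact A|]. apply (eqv _ _ B). field. auto.
  + apply (proj2 (List.Forall_map (fun x => x * t)
      (fun x => off_lattice q x /\ off_lattice q (z * t * t / x) /\
        off_lattice q (a * t * t * x / (z * t * t))) [f; g])).
    apply List.Forall_forall. intros x Hx. destruct (O2 x Hx) as (x0 & A & B & D & _).
    split; [exact A|]. split; [apply (eqv _ _ B)|apply (eqv _ _ D)]; field; auto.
  + transitivity (a * z * q * (t * t * t * t)); [ring|]. rewrite Hbal. ring.
- split; [apply (inv _ _ Od); field; auto|].
  split; [apply (inv _ _ Oz); field; auto|].
  split; [|split].
  + apply (proj2 (List.Forall_map (fun x => x * t / (z * t * t))
      (fun x => off_lattice q x /\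
        off_lattice q (a * t * t / (z * t * t * (z * t * t)) / x)) [b; c; d; e])).
    apply List.Forall_forall. intros x Hx. destruct (O4 x Hx) as (x0 & _ & _ & A & B).
    split; [apply (inv _ _ A)|apply (inv _ _ B)]; field; auto.
  + apply (proj2 (List.Forall_map (fun x => x * t / (z * t * t))
      (fun x => off_lattice q x /\ off_lattice q (1 / (z * t * t) / x) /\
        off_lattice q (a * t * t / (z * t * t * (z * t * t)) * x / (1 / (z * t * t))))
      [f; g])).
    apply List.Forall_forall. intros x Hx. destruct (O2 x Hx) as (x0 & A & B & _ & D).
    split; [apply (inv _ _ B)|split; [apply (inv _ _ A)|apply (inv _ _ D)]];
      field; auto.
  + transitivity (a * z * q / (z * z * z * z * (t * t * t * t))); [field; auto|].
    rewrite Hbal. field. auto.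
Qed.

(** Supplies the three convergence hypotheses of [generic_identity]: by azq = bcde each argument is
    the cube of the base times q^2 over the product of the six parameters. *)
Lemma generic_value_identity (q a z b c d e f g : C) :
  (0 < Cmod q < 1)%R -> generic q a z b c d e f g ->
  generic q (a / (z * z)) (1 / z) (b / z) (c / z) (d / z) (e / z) (f / z) (g / z) ->
  (Cmod (z * q / (f * g)) < 1)%R -> (Cmod (z * z * q / (a * f * g)) < 1)%R ->
  coef_a q a z f g *
    vwp_value q a [b; c; d; e; a * f / z; a * g / z] (z * q / (f * g)) =
  coef_z q a z b c d e *
    vwp_value q z [b; c; d; e; f; g] (z * z * q / (a * f * g)) +
  coef_dual q a z b c d e f g *
    vwp_value q (a / (z * z))
      [b / z; c / z; d / z; e / z; a * f / z / z; a * g / z / z] (z * q / (f * g)).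
Proof.
intros Hq G G' W2 W1. assert (Hq0 := q_neq0 q Hq).
assert (I := generic_inv _ _ _ _ _ _ _ _ _ G).
assert (I' := generic_inv _ _ _ _ _ _ _ _ _ G').
destruct I as (Oa & Oz & [Ob Oab] & [Oc Oac] & [Od Oad] & [Oe Oae] &
  (Of & Ozf & Oh) & (Og & Ozg & Oj) & Hbal).
destruct I' as (Oa' & Oz' & [Ob' Oab'] & [Oc' Oac'] & [Od' Oad'] & [Oe' Oae'] &
  (Of' & Ozf' & Oh') & (Og' & Ozg' & Oj') & _).
assert (a0 := proj1 Oa). assert (z0 := proj1 Oz). assert (b0 := proj1 Ob).
assert (c0 := proj1 Oc). assert (d0 := proj1 Od). assert (e0 := proj1 Oe).
assert (f0 := proj1 Of). assert (g0 := proj1 Og).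
assert (eqv : forall x y : C, off_lattice q x -> y = x -> off_lattice q y).
{ intros x y Hx ->. exact Hx. }
assert (inv : forall x y : C, off_lattice q x -> y = / x -> off_lattice q y).
{ intros x y Hx ->. now apply off_lattice_inv. }
assert (Ozx : forall x : C, x <> 0 -> off_lattice q (x / z) -> off_lattice q (z / x)).
{ intros x Hx H. apply (inv _ _ H). field. auto. }
assert (NF : forall xs : list C, List.Forall (fun x => off_lattice q x /\
  off_lattice q x) xs -> List.Forall (fun x : C => x <> 0) xs).
{ intros xs. apply List.Forall_impl. intros x [[Hx _] _]. exact Hx. }
assert (Oah : off_lattice q (a / (a * f / z)))
  by (apply (eqv _ _ Ozf); field; auto).
assert (Oaj : off_lattice q (a / (a * g / z)))
  by (apply (eqv _ _ Ozg); field; auto).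
assert (Oh2 : off_lattice q (a * f / z / z)) by (apply (eqv _ _ Oh'); field; auto).
assert (Oj2 : off_lattice q (a * g / z / z)) by (apply (eqv _ _ Oj'); field; auto).
assert (Oah' : off_lattice q (a / (z * z) / (a * f / z / z)))
  by (apply (eqv _ _ Ozf'); field; auto).
assert (Oaj' : off_lattice q (a / (z * z) / (a * g / z / z)))
  by (apply (eqv _ _ Ozg'); field; auto).
apply generic_identity; auto; apply is_biseries_vwp; auto;
  try (apply NF; repeat (apply List.Forall_cons; [split; assumption|]); constructor);
  try (apply vwp_regular_off_lattice; auto;
    repeat (apply List.Forall_cons; [split; auto|]); constructor).
- transitivity (a ^ 3 * q ^ 2 / (b * c * d * e * (a * f / z) * (a * g / z)));
    [|reflexivity].
  rewrite <- Hbal. field. auto.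
- rewrite <- Hbal. field. auto.
- apply Oa'.
- transitivity ((a / (z * z)) ^ 3 * q ^ 2 / (b * c * d * e / (z * z * z * z) *
    (a * f / z / z) * (a * g / z / z))).
  + rewrite <- Hbal. field. auto.
  + f_equal. field. auto.
Qed.

(** The base a/z^2 and its parameters scale by 1/t^2 and 1/t, so the third value is written with
    [/ t] to fit [climit_vwp_value]. *)
Lemma generic_identity_perturbed (q a z b c d e f g t : C) :
  (0 < Cmod q < 1)%R -> a <> 0 -> z <> 0 -> t <> 0 ->
  List.Forall (fun x : C => x <> 0) [b; c; d; e; f; g] ->
  a * z * q = b * c * d * e ->
  List.Forall (fun x => off_lattice q (x * t))
    (lattice_data4 a z [b; c; d; e] ++ lattice_data2 a z [f; g]) ->
  List.Forall (fun x => off_lattice q (x * (t * t))) [a; z; z * z / a] ->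
  (Cmod (z * q / (f * g)) < 1)%R -> (Cmod (z * z * q / (a * f * g)) < 1)%R ->
  coef_a q (a * t * t) (z * t * t) (f * t) (g * t) *
    vwp_value q (a * t * t)
      (map (fun x => x * t) [b; c; d; e; a * f / z; a * g / z]) (z * q / (f * g)) =
  coef_z q (a * t * t) (z * t * t) (b * t) (c * t) (d * t) (e * t) *
    vwp_value q (z * t * t) (map (fun x => x * t) [b; c; d; e; f; g])
      (z * z * q / (a * f * g)) +
  coef_dual q (a * t * t) (z * t * t) (b * t) (c * t) (d * t) (e * t) (f * t) (g * t) *
    vwp_value q (a / (z * z) * / t * / t) (map (fun x => x * / t)
      [b / z; c / z; d / z; e / z; a * f / z / z; a * g / z / z]) (z * q / (f * g)).
Proof.
intros Hq Ha Hz Ht Hxs Hbal H1 H2 W2 W1. assert (Hq0 := q_neq0 q Hq).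
destruct (generic_perturbed q a z b c d e f g t) as [G G']; auto.
rewrite List.Forall_forall in Hxs.
assert (f0 : f <> 0) by (apply Hxs; simpl; auto 8).
assert (g0 : g <> 0) by (apply Hxs; simpl; auto 8).
assert (E2 : z * t * t * q / (f * t * (g * t)) = z * q / (f * g))
  by (field; auto).
assert (E1 : z * t * t * (z * t * t) * q / (a * t * t * (f * t) * (g * t)) =
  z * z * q / (a * f * g)) by (field; auto).
assert (Ef : forall x : C, a * t * t * (x * t) / (z * t * t) = a * x / z * t)
  by (intros x; field; auto).
simpl map. rewrite <- !Ef.
replace (a / (z * z) * / t * / t) with (a * t * t / (z * t * t * (z * t * t)))
  by (field; auto).
assert (Ex : forall x : C, x / z * / t = x * t / (z * t * t))
  by (intros x; field; auto).
rewrite !Ex, <- !Ef. rewrite <- E1, <- E2.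
apply generic_value_identity; auto; rewrite ?E1, ?E2; assumption.
Qed.

(** * The passage to the limit *)

Lemma climit_scaled (c : C) (t : nat -> C) :
  climit t 1 -> climit (fun j => c * t j) c.
Proof.
intros H. assert (L := climit_scal c t 1 H). now rewrite Cmult_1_r in L.
Qed.

(** Descends through a coefficient, recognizing the infinite products by the power of t in their
    argument; denominators of the limit are nonzero by assumption. The shapes in t come before the
    general product rule, which would split them. *)
Ltac perturb_lim t L1 L1' L2 L2' M2 :=
  repeat lazymatch goal with
  | |- climit (fun _ => ?c) _ => apply climit_const
  | |- climit (fun j => qinf _ (?c * t j * t j)) _ => exact (L2 c)
  | |- climit (fun j => qinf _ (?c * / t j * / t j)) _ => exact (L2' c)
  | |- climit (fun j => qinf _ (?c * t j)) _ => exact (L1 c)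
  | |- climit (fun j => qinf _ (?c * / t j)) _ => exact (L1' c)
  | |- climit (fun j => ?c * t j * t j) _ => exact (M2 c)
  | |- climit (fun j => @?u j / @?v j) _ =>
      apply (climit_div u v); [| |repeat apply Cmult_neq_0; assumption]
  | |- climit (fun j => - @?u j) _ => apply (climit_opp u)
  | |- climit (fun j => @?u j - @?v j) _ => apply (climit_minus u v)
  | |- climit (fun j => @?u j * @?v j) _ => apply (climit_mult u v)
  end.

(** The identity holds at every t_j, and both sides are continuous as t_j tends to 1. The
    nonvanishing hypotheses concern the denominators of the limiting coefficients, so a or z may be
    a power of q as far as regularity allows. *)
Lemma vwp_value_identity (q a z b c d e f g : C) :
  (0 < Cmod q < 1)%R -> a <> 0 -> z <> 0 ->
  b <> 0 -> c <> 0 -> d <> 0 -> e <> 0 -> f <> 0 -> g <> 0 ->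
  a * z * q = b * c * d * e ->
  (Cmod (z * q / (f * g)) < 1)%R -> (Cmod (z * z * q / (a * f * g)) < 1)%R ->
  vwp_regular q a [b; c; d; e; a * f / z; a * g / z] ->
  vwp_regular q z [b; c; d; e; f; g] ->
  vwp_regular q (a / (z * z))
    [b / z; c / z; d / z; e / z; a * f / z / z; a * g / z / z] ->
  qinf q (q / f) <> 0 -> qinf q (q / g) <> 0 ->
  qinf q (z * q / f) <> 0 -> qinf q (z * q / g) <> 0 ->
  List.Forall (fun x => qinf q (a * q / x) <> 0 /\ qinf q (x / z) <> 0) [b; c; d; e] ->
  qinf q (a * q / (z * z)) <> 0 -> qinf q (z * z * q / a) <> 0 ->
  coef_a q a z f g *
    vwp_value q a [b; c; d; e; a * f / z; a * g / z] (z * q / (f * g)) =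
  coef_z q a z b c d e *
    vwp_value q z [b; c; d; e; f; g] (z * z * q / (a * f * g)) +
  coef_dual q a z b c d e f g *
    vwp_value q (a / (z * z))
      [b / z; c / z; d / z; e / z; a * f / z / z; a * g / z / z] (z * q / (f * g)).
Proof.
intros Hq Ha Hz Hb Hc Hd He Hf Hg Hbal W2 W1 R1 R2 R3 Nf Ng Nzf Nzg N4 N5 N6.
assert (Hq1 : (Cmod q < 1)%R) by lra. assert (Hq0 := q_neq0 q Hq).
destruct (perturbation_sequence q
  (lattice_data4 a z [b; c; d; e] ++ lattice_data2 a z [f; g])
  [a; z; z * z / a] Hq) as (t & Ht0 & Hb1 & Hb2 & Hlim & Ht1 & Ht2).
{ unfold lattice_data4, lattice_data2. simpl.
  repeat (apply List.Forall_cons; [auto using Cmult_neq_0, Cdiv_neq0|]). constructor. }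
{ repeat (apply List.Forall_cons; [auto using Cmult_neq_0, Cdiv_neq0|]). constructor. }
assert (Hinv : climit (fun j => / t j) 1).
{ replace (RtoC 1) with (/ RtoC 1) by field. apply climit_inv; auto using C1_nz. }
assert (L1 : forall c0 : C, climit (fun j => qinf q (c0 * t j)) (qinf q c0)).
{ intros c0. apply climit_qinf; [auto|]. now apply climit_scaled. }
assert (L1' : forall c0 : C, climit (fun j => qinf q (c0 * / t j)) (qinf q c0)).
{ intros c0. apply climit_qinf; [auto|]. now apply climit_scaled. }
assert (M2 : forall c0 : C, climit (fun j => c0 * t j * t j) c0).
{ intros c0. apply climit_ext with (fun j => c0 * (t j * t j)).
  - intros j. ring.
  - apply (climit_scaled c0 (fun j => t j * t j)).
    replace (RtoC 1) with (1 * 1) by ring. now apply climit_mult. }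
assert (M2' : forall c0 : C, climit (fun j => c0 * / t j * / t j) c0).
{ intros c0. apply climit_ext with (fun j => c0 * (/ t j * / t j)).
  - intros j. ring.
  - apply (climit_scaled c0 (fun j => / t j * / t j)).
    replace (RtoC 1) with (1 * 1) by ring. now apply climit_mult. }
assert (L2 : forall c0 : C, climit (fun j => qinf q (c0 * t j * t j)) (qinf q c0)).
{ intros c0. now apply climit_qinf. }
assert (L2' : forall c0 : C,
  climit (fun j => qinf q (c0 * / t j * / t j)) (qinf q c0)).
{ intros c0. now apply climit_qinf. }
assert (Hx : List.Forall (fun x : C => x <> 0) [b; c; d; e; f; g]).
{ repeat (apply List.Forall_cons; [auto|]). constructor. }
assert (T := fun j => generic_identity_perturbed q a z b c d e f g (t j) Hq Ha Hz
  (Ht0 j) Hx Hbal (Ht1 j) (Ht2 j) W2 W1).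
assert (V1 := climit_vwp_value q a [b; c; d; e; a * f / z; a * g / z]
  (z * q / (f * g)) t Hq Ha ltac:(repeat (apply List.Forall_cons;
    [auto using Cmult_neq_0, Cdiv_neq0|]); constructor) W2 R1 Hb1 Hb2 Ht0 Hlim).
assert (V2 := climit_vwp_value q z [b; c; d; e; f; g]
  (z * z * q / (a * f * g)) t Hq Hz Hx W1 R2 Hb1 Hb2 Ht0 Hlim).
(* The third series is perturbed by 1/t; the bound required for the inverse of 1/t is the one on t,
   by [Cinv_inv]. *)
assert (V3 := climit_vwp_value q (a / (z * z))
  [b / z; c / z; d / z; e / z; a * f / z / z; a * g / z / z]
  (z * q / (f * g)) (fun j => / t j) Hq
  (Cdiv_neq0 _ _ Ha (Cmult_neq_0 _ _ Hz Hz)) ltac:(repeat (apply List.Forall_cons;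
    [auto using Cmult_neq_0, Cdiv_neq0|]); constructor) W2 R3 Hb2).
assert (V3' := V3 ltac:(apply bounded_ext with t; [intros j; symmetry; apply Cinv_inv|auto])
  ltac:(intros j; now apply Cinv_neq0) Hinv). clear V3.
pose proof (Forall_inv N4) as [Na Nz]. apply Forall_inv_tail in N4.
pose proof (Forall_inv N4) as [Na0 Nz0]. apply Forall_inv_tail in N4.
pose proof (Forall_inv N4) as [Na1 Nz1]. apply Forall_inv_tail in N4.
pose proof (Forall_inv N4) as [Na2 Nz2]. clear N4.
assert (NW := qinf_small_neq0 q _ Hq1 W1).
assert (E2 : forall u : C, u <> 0 ->
  z * u * u * q / (f * u * (g * u)) = z * q / (f * g))
  by (intros u Hu; field; auto).
assert (E1 : forall u : C, u <> 0 -> z * u * u * (z * u * u) * q /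
  (a * u * u * (f * u) * (g * u)) = z * z * q / (a * f * g))
  by (intros u Hu; field; auto).
assert (Eq : forall x u : C, x <> 0 -> u <> 0 -> q / (x * u) = q / x * / u)
  by (intros x u Hx0 Hu; field; auto).
assert (Eqq : forall u : C, u <> 0 -> q / (a * u * u) = q / a * / u * / u)
  by (intros u Hu; field; auto).
assert (Eh : forall x u : C, x <> 0 -> u <> 0 ->
  z * u * u * q / (a * u * u * (x * u)) = z * q / (a * x) * / u)
  by (intros x u Hx0 Hu; field; auto).
assert (Ep : forall x y u : C, x <> 0 -> y <> 0 -> u <> 0 ->
  a * u * u * q / (x * u * (y * u)) = a * q / (x * y))
  by (intros x y u Hx0 Hy0 Hu; field; auto).
assert (Ea : forall x u : C, x <> 0 -> u <> 0 ->
  a * u * u * q / (x * u) = a * q / x * u)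
  by (intros x u Hx0 Hu; field; auto).
assert (Ez : forall x u : C, x <> 0 -> u <> 0 ->
  z * u * u * q / (x * u) = z * q / x * u)
  by (intros x u Hx0 Hu; field; auto).
assert (Exz : forall x u : C, u <> 0 -> x * u / (z * u * u) = x / z * / u)
  by (intros x u Hu; field; auto).
assert (Ezx : forall x u : C, x <> 0 -> u <> 0 ->
  a * u * u * q / (z * u * u * (x * u)) = a * q / (z * x) * / u)
  by (intros x u Hx0 Hu; field; auto).
assert (Ezz : forall x u : C, x <> 0 -> u <> 0 ->
  z * u * u * (z * u * u) * q / (a * u * u * (x * u)) = z * z * q / (a * x) * u)
  by (intros x u Hx0 Hu; field; auto).
assert (Ed : forall u : C, u <> 0 ->
  a * u * u * q / (z * u * u * (z * u * u)) = a * q / (z * z) * / u * / u)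
  by (intros u Hu; field; auto).
assert (Ed' : forall u : C, u <> 0 ->
  z * u * u * (z * u * u) * q / (a * u * u) = z * z * q / a * u * u)
  by (intros u Hu; field; auto).
assert (C1 : climit (fun j => coef_a q (a * t j * t j) (z * t j * t j) (f * t j)
  (g * t j)) (coef_a q a z f g)).
{ apply climit_ext with (fun j => - (z * t j * t j) * (1 - a * t j * t j) *
    (qinf q (z * q / (a * f) * / t j) * qinf q (z * q / (a * g) * / t j)) *
    qinf q (z * q / (f * g)) /
    (qinf q (q / f * / t j) * qinf q (q / g * / t j) *
     qinf q (z * z * q / (a * f * g)))).
  - intros j. unfold coef_a. now rewrite E1, E2, !Eq, !Eh.
  - unfold coef_a.
    perturb_lim t L1 L1' L2 L2' M2. }
assert (C2 : climit (fun j => coef_z q (a * t j * t j) (z * t j * t j) (b * t j)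
  (c * t j) (d * t j) (e * t j)) (coef_z q a z b c d e)).
{ apply climit_ext with (fun j => qinf q (q / a * / t j * / t j) *
    (1 - z * t j * t j) * pair_product q a b c d e * qinf q (a * t j * t j) /
    (qinf q (a * q / b * t j) * qinf q (b / z * / t j) *
     (qinf q (a * q / c * t j) * qinf q (c / z * / t j)) *
     (qinf q (a * q / d * t j) * qinf q (d / z * / t j)) *
     (qinf q (a * q / e * t j) * qinf q (e / z * / t j)))).
  - intros j. unfold coef_z, pair_product. now rewrite Eqq, !Ep, !Ea, !Exz.
  - unfold coef_z.
    perturb_lim t L1 L1' L2 L2' M2. }
assert (C3 : climit (fun j => coef_dual q (a * t j * t j) (z * t j * t j) (b * t j)
  (c * t j) (d * t j) (e * t j) (f * t j) (g * t j)) (coef_dual q a z b c d e f g)).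
{ apply climit_ext with (fun j => - (qinf q (q / a * / t j * / t j) *
     qinf q (a * t j * t j) *
     (qinf q (b * t j) * qinf q (a * q / (z * b) * / t j) /
        (qinf q (a * q / b * t j) * qinf q (b / z * / t j)) *
      (qinf q (c * t j) * qinf q (a * q / (z * c) * / t j) /
        (qinf q (a * q / c * t j) * qinf q (c / z * / t j))) *
      (qinf q (d * t j) * qinf q (a * q / (z * d) * / t j) /
        (qinf q (a * q / d * t j) * qinf q (d / z * / t j))) *
      (qinf q (e * t j) * qinf q (a * q / (z * e) * / t j) /
        (qinf q (a * q / e * t j) * qinf q (e / z * / t j)))) *
     (qinf q (z * z * q / (a * f) * t j) * qinf q (z * z * q / (a * g) * t j) *
      qinf q (z * q / (f * g))) /
     (qinf q (a * q / (z * z) * / t j * / t j) *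
      (qinf q (z * z * q / a * t j * t j) *
      (qinf q (z * q / f * t j) * qinf q (z * q / g * t j)) *
      qinf q (z * z * q / (a * f * g)))))).
  - intros j. unfold coef_dual.
    now rewrite Eqq, Ed, Ed', E1, E2, !Ezx, !Exz, !Ezz, !Ea, !Ez.
  - unfold coef_dual.
    perturb_lim t L1 L1' L2 L2' M2. }
eapply climit_unique.
- exact (climit_mult _ _ _ _ C1 V1).
- eapply climit_ext; [|exact (climit_plus _ _ _ _ (climit_mult _ _ _ _ C2 V2)
    (climit_mult _ _ _ _ C3 V3'))].
  intros j. symmetry. apply T.
Qed.

Theorem theorem1p5 :
  forall (q : C), (0 < Cmod q < 1)%R ->
  forall (a b c d e f g z : C),
  a <> 0 -> b <> 0 -> c <> 0 -> d <> 0 -> e <> 0 -> f <> 0 -> g <> 0 ->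
  z = b * c * d * e / (a * q) ->
  (Cmod (a ^ 2 * q / (f * g * z)) < 1)%R ->
  (Cmod (a * q / (f * g)) < 1)%R ->
  (* no denominator vanishes in the terms of the three series *)
  vwp_regular q a [b; c; d; e; f; g] ->
  vwp_regular q z [b; c; d; e; f * z / a; g * z / a] ->
  vwp_regular q (z ^ 2 / a)
    [b * z / a; c * z / a; d * z / a; e * z / a; f * z / a; g * z / a] ->
  (* no denominator vanishes in the coefficients *)
  Omega q [q] [f; g] <> 0 ->
  Omega q [a * q] [b; c; d; e] <> 0 ->
  Omega q [1 / z] [1 / b; 1 / c; 1 / d; 1 / e; f * g / (a ^ 2 * q)] <> 0 ->
  qinfs q [a * q / z ^ 2; z ^ 2 * q / a] <> 0 ->
  Omega q [q; a * q] [f; g] <> 0 ->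
  Omega q [1 / z] [1 / b; 1 / c; 1 / d; 1 / e] <> 0 ->
  (* the three series converge *)
  ex_biseries
    (vwp_term q a [b; c; d; e; f; g] (a ^ 2 * q / (f * g * z))) /\
  ex_biseries
    (vwp_term q z [b; c; d; e; f * z / a; g * z / a] (a * q / (f * g))) /\
  ex_biseries
    (vwp_term q (z ^ 2 / a)
       [b * z / a; c * z / a; d * z / a; e * z / a; f * z / a; g * z / a]
       (a ^ 2 * q / (f * g * z))) /\
  vwp_psi q a [b; c; d; e; f; g] (a ^ 2 * q / (f * g * z)) =
    (1 - 1 / z) * (qinfs q [a * q; q / a] / Omega q [q] [f; g]) *
    (Omega q [a * q]
       [b * c; b * d; b * e; c * d; c * e; d * e; f * g; f * z; g * z] /
     (Omega q [a * q] [b; c; d; e] *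
      Omega q [1 / z] [1 / b; 1 / c; 1 / d; 1 / e; f * g / (a ^ 2 * q)])) *
    vwp_psi q z [b; c; d; e; f * z / a; g * z / a] (a * q / (f * g))
  + 1 / z *
    (qinfs q [a * q; q / a] / qinfs q [a * q / z ^ 2; z ^ 2 * q / a]) *
    (Omega q [a * q / z; z * q] [f; g] / Omega q [q; a * q] [f; g]) *
    (qinfs q [b; c; d; e] * Omega q [a * q / z] [b; c; d; e] /
     (Omega q [1 / z] [1 / b; 1 / c; 1 / d; 1 / e] *
      Omega q [a * q] [b; c; d; e])) *
    vwp_psi q (z ^ 2 / a)
      [b * z / a; c * z / a; d * z / a; e * z / a; f * z / a; g * z / a]
      (a ^ 2 * q / (f * g * z)).
Proof.
intros q Hq a b c d e f g z Ha Hb Hc Hd He Hf Hg Hz W2 W1 R1 R2 R3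
  O1 O2 O3 O4 O5 O6.
assert (Hq0 := q_neq0 q Hq). assert (Hq1 : (Cmod q < 1)%R) by lra.
assert (z0 : z <> 0).
{ rewrite Hz. apply Cdiv_neq0; auto using Cmult_neq_0. }
assert (Hbal : a * z * q = b * c * d * e) by (rewrite Hz; field; auto).
clear Hz.
(* The identity is applied with fz/a and gz/a for f and g; its two arguments become those of the
   theorem. *)
assert (EW2 : z * q / (f * z / a * (g * z / a)) = a ^ 2 * q / (f * g * z))
  by (field; auto).
assert (EW1 : z * z * q / (a * (f * z / a) * (g * z / a)) = a * q / (f * g))
  by (field; auto).
assert (Ef : forall x : C, a * (x * z / a) / z = x) by (intros x; field; auto).
assert (R3' := vwp_regular_reflect _ _ _
  (Cdiv_neq0 _ _ (Cpow_nz z 2 z0) Ha) R3).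
simpl map in R3'.
assert (Er : forall x : C, x * z / a / (z ^ 2 / a) = x / z)
  by (intros x; field; auto).
assert (Ea : 1 / (z ^ 2 / a) = a / (z * z)) by (field; auto).
rewrite !Er, Ea in R3'.
unfold Omega, qinfs, Cprod in O1, O2, O3, O4, O5, O6. simpl in O1, O2, O3, O4, O5, O6.
assert (B1 : is_biseries
  (vwp_term q a [b; c; d; e; f; g] (a ^ 2 * q / (f * g * z)))
  (vwp_value q a [b; c; d; e; f; g] (a ^ 2 * q / (f * g * z)))).
{ apply is_biseries_vwp; auto.
  - repeat (apply List.Forall_cons; [auto|]). constructor.
  - rewrite <- Hbal. field. auto. }
assert (B2 : is_biseries
  (vwp_term q z [b; c; d; e; f * z / a; g * z / a] (a * q / (f * g)))
  (vwp_value q z [b; c; d; e; f * z / a; g * z / a] (a * q / (f * g)))).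
{ apply is_biseries_vwp; auto.
  - repeat (apply List.Forall_cons; [auto using Cmult_neq_0, Cdiv_neq0|]). constructor.
  - rewrite <- Hbal. field. auto. }
(* The value is recorded with base a/z^2, as it occurs in the identity; reflection identifies it
   with the sum for base z^2/a. *)
assert (B3 : is_biseries (vwp_term q (z ^ 2 / a)
    [b * z / a; c * z / a; d * z / a; e * z / a; f * z / a; g * z / a]
    (a ^ 2 * q / (f * g * z)))
  (vwp_value q (a / (z * z)) [b / z; c / z; d / z; e / z; f / z; g / z]
    (a ^ 2 * q / (f * g * z)))).
{ rewrite <- Ea, <- !Er, vwp_value_reflect by (apply Cdiv_neq0; auto using Cpow_nz).
  apply is_biseries_vwp; auto using Cdiv_neq0, Cpow_nz.
  - repeat (apply List.Forall_cons; [auto using Cmult_neq_0, Cdiv_neq0|]). constructor.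
  - transitivity ((z ^ 2 / a) ^ 3 * q ^ 2 / (b * c * d * e * (z / a) ^ 4 *
      (f * z / a) * (g * z / a))).
    + rewrite <- Hbal. field. auto.
    + f_equal. field. auto. }
split; [now eexists; apply B1|]. split; [now eexists; apply B2|].
split; [now eexists; apply B3|].
unfold vwp_psi. rewrite (Biseries_unique _ _ B1), (Biseries_unique _ _ B2),
  (Biseries_unique _ _ B3).
assert (Ez : forall x : C, x <> 0 -> 1 / z / (1 / x) = x / z)
  by (intros x Hx; field; auto).
rewrite !Ez in O3, O6 by auto.
assert (N1 : qinf q (q / f) <> 0) by (intros E; apply O1; rewrite E; ring).
assert (N2 : qinf q (q / g) <> 0) by (intros E; apply O1; rewrite E; ring).
assert (N3 : qinf q (a * q / b) <> 0) by (intros E; apply O2; rewrite E; ring).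
assert (N4 : qinf q (a * q / c) <> 0) by (intros E; apply O2; rewrite E; ring).
assert (N5 : qinf q (a * q / d) <> 0) by (intros E; apply O2; rewrite E; ring).
assert (N6 : qinf q (a * q / e) <> 0) by (intros E; apply O2; rewrite E; ring).
assert (N7 : qinf q (b / z) <> 0) by (intros E; apply O6; rewrite E; ring).
assert (N8 : qinf q (c / z) <> 0) by (intros E; apply O6; rewrite E; ring).
assert (N9 : qinf q (d / z) <> 0) by (intros E; apply O6; rewrite E; ring).
assert (N10 : qinf q (e / z) <> 0) by (intros E; apply O6; rewrite E; ring).
replace (a * q / (z * (z * 1))) with (a * q / (z * z)) in O4 by (field; auto).
replace (z * (z * 1) * q / a) with (z * z * q / a) in O4 by (field; auto).
assert (N11 : qinf q (a * q / (z * z)) <> 0)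
  by (intros E; apply O4; rewrite E; ring).
assert (N12 : qinf q (z * z * q / a) <> 0)
  by (intros E; apply O4; rewrite E; ring).
assert (N13 : qinf q (a * q / f) <> 0) by (intros E; apply O5; rewrite E; ring).
assert (N14 : qinf q (a * q / g) <> 0) by (intros E; apply O5; rewrite E; ring).
clear O1 O2 O3 O4 O5 O6.
(* The products (aq/(fz);q)_oo and (aq/(gz);q)_oo are numerators in the theorem but denominators in
   [coef_a]; they are nonzero by the regularity of the series with base z. *)
assert (Nreg : forall x : C, x <> 0 -> (forall k : nat, x <> q ^ S k) ->
  qinf q (q / x) <> 0).
{ intros x Hx H. apply qinf_neq0; [auto|]. intros k E. apply (H k).
  replace x with (x * (q / x * q ^ k)) by (rewrite E; ring).
  simpl. field. auto. }
assert (Rz := proj2 R2). rewrite List.Forall_forall in Rz.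
assert (N15 : qinf q (q / (f * z / a)) <> 0).
{ apply Nreg; auto using Cdiv_neq0, Cmult_neq_0.
  intros k. apply (Rz (f * z / a)). simpl. tauto. }
assert (N16 : qinf q (q / (g * z / a)) <> 0).
{ apply Nreg; auto using Cdiv_neq0, Cmult_neq_0.
  intros k. apply (Rz (g * z / a)). simpl. tauto. }
assert (Ezf : forall x : C, x <> 0 -> z * q / (x * z / a) = a * q / x)
  by (intros x Hx; field; auto).
assert (M := vwp_value_identity q a z b c d e (f * z / a) (g * z / a) Hq Ha z0
  Hb Hc Hd He (Cdiv_neq0 _ _ (Cmult_neq_0 _ _ Hf z0) Ha)
  (Cdiv_neq0 _ _ (Cmult_neq_0 _ _ Hg z0) Ha) Hbal).
rewrite EW1, EW2, !Ef, !Ezf in M by auto.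
specialize (M W2 W1 R1 R2 R3' N15 N16 N13 N14).
assert (N17 : List.Forall (fun x => qinf q (a * q / x) <> 0 /\ qinf q (x / z) <> 0)
  [b; c; d; e]).
{ repeat (apply List.Forall_cons; [split; assumption|]). constructor. }
specialize (M N17 N11 N12).
set (Sa := vwp_value q a _ _) in *. set (Sz := vwp_value q z _ _) in *.
set (Sd := vwp_value q (a / (z * z)) _ _) in *.
assert (NW2 := qinf_small_neq0 q _ Hq1 W2).
assert (NW1 := qinf_small_neq0 q _ Hq1 W1).
assert (N1a : 1 - a <> 0).
{ intros E. apply (proj1 R1). replace a with (1 - (1 - a)) by ring.
  rewrite E. ring. }
unfold coef_a, coef_z, coef_dual, pair_product in M.
assert (Eh : forall x : C, x <> 0 -> z * q / (a * (x * z / a)) = q / x)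
  by (intros x Hx; field; auto).
assert (Eh' : forall x : C, x <> 0 -> z * z * q / (a * (x * z / a)) = z * q / x)
  by (intros x Hx; field; auto).
rewrite EW1, EW2, !Eh, !Eh', !Ezf, (qinf_step q a Hq1) in M by auto.
unfold Omega, qinfs, Cprod. simpl map. simpl fold_right.
rewrite !Ez by auto.
replace (1 / z / (f * g / (a * (a * 1) * q))) with (a ^ 2 * q / (f * g * z))
  by (field; auto).
replace (a * q / (z * (z * 1))) with (a * q / (z * z)) by (field; auto).
replace (z * (z * 1) * q / a) with (z * z * q / a) by (field; auto).
assert (Efz : forall x : C, x <> 0 -> a * q / (x * z) = q / (x * z / a))
  by (intros x Hx; field; auto).
assert (Ezx : forall x : C, x <> 0 -> a * q / z / x = a * q / (z * x))
  by (intros x Hx; field; auto).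
rewrite (Efz f), (Efz g), !Ezx by auto.
replace (a * q / (z * f)) with (q / (f * z / a)) by (field; auto).
replace (a * q / (z * g)) with (q / (g * z / a)) by (field; auto).
(* The multiplier is [coef_a] at fz/a and gz/a, so the left side becomes that of [M]; what remains
   is to compare the coefficients of the other two series. *)
apply (Cmult_cancel_l (- z * (1 - a) * (qinf q (q / f) * qinf q (q / g)) *
  qinf q (a ^ 2 * q / (f * g * z)) /
  (qinf q (q / (f * z / a)) * qinf q (q / (g * z / a)) * qinf q (a * q / (f * g))))).
{ assert (- z <> 0).
  { intros E. apply z0. replace z with (- - z) by ring. rewrite E. ring. }
  apply Cdiv_neq0; auto 6 using Cmult_neq_0. }
rewrite M. clear M.
clear R1 R2 R3 R3' Rz Nreg B1 B2 B3 Er Ef Ez Ezf Eh Eh' Efz Ezx.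
set (ma := 1 - a) in *. clearbody Sa Sz Sd ma.
abstract_qinf. rewrite Cmult_plus_distr_l. apply (f_equal2 Cplus).
- field. repeat split; auto.
- field. repeat split; auto.
Qed.
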